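(* Let $G=\langle g_\lambda:\lambda\in\Lambda\rangle\in\mathcal{G}_{dis}$ and suppose $J_{\min}(G)\cap\bigcup_{\lambda\in\Lambda}J(g_\lambda)=\emptyset$. Then $\partial\hat K(G)\subset M'\subset\overline{\bigcup_{\lambda\in\Lambda}J(g_\lambda)}$, where $M'$ is the minimal (with respect to the surrounding order) connected component of $\overline{\bigcup_{\lambda\in\Lambda}J(g_\lambda)}$.
   Context: A polynomial semigroup is a semigroup of non-constant complex polynomials (self-maps of $\hat{\mathbb{C}}$) under composition. $F(G)$ is the set of points having a neighborhood on which $G$ is normal, $J(G)=\hat{\mathbb{C}}\setminus F(G)$, $J(g)=J(\langle g\rangle)$. $P(G)$ is the closure of the set of all critical values of all $g\in G$, $P^*(G)=P(G)\setminus\{\infty\}$. $\mathcal{G}$: polynomial semigroups all of whose elements have degree $\ge2$ and with $P^*(G)$ bounded in $\mathbb{C}$; $\mathcal{G}_{dis}$: those with $J(G)$ disconnected. $\hat K(G)=\{z\in\mathbb{C}:\{g(z):g\in G\}\text{ bounded}\}$. For $G\in\mathcal{G}_{dis}$, $J_{\min}(G)$ is the unique connected component of $J(G)$ not containing $\infty$ which meets $\partial\hat K(G)$. Surrounding order: for connected $K_1,K_2\subset\mathbb{C}$, $K_1\le K_2$ means $K_1=K_2$ or $K_1$ lies in a bounded component of $\mathbb{C}\setminus K_2$; the minimal component $M'$ is known to exist for $G\in\mathcal{G}_{dis}$. *)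

(* Defs.v *)
From HB Require Import structures.
From mathcomp Require Import all_boot all_order all_algebra.
From mathcomp Require Import complex.
From mathcomp Require Import reals.
Set Implicit Arguments. Unset Strict Implicit. Unset Printing Implicit Defensive.
Import Order.TTheory GRing.Theory Num.Theory.
Local Open Scope ring_scope.

Section Defs.
Variable R : realType.
Local Notation C := R[i].

Definition cabs (z : C) : R := let: Complex a b := z in Num.sqrt (a ^+ 2 + b ^+ 2).

(* The Riemann sphere \hat C = C u {oo}; None is oo. *)
Definition sphere := option C.

Definition sdist (x y : sphere) : R :=
  match x, y with
  | Some z, Some w => 2 * cabs (z - w) / Num.sqrt ((1 + cabs z ^+ 2) * (1 + cabs w ^+ 2))
  | Some z, None | None, Some z => 2 / Num.sqrt (1 + cabs z ^+ 2)
  | None, None => 0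
  end.

Definition cdist (z w : C) : R := cabs (z - w).

Definition pext (p : {poly C}) (x : sphere) : sphere :=
  match x with
  | Some z => Some p.[z]
  | None => if (size p <= 1)%N then Some p.[0] else None
  end.

Inductive gen_semigroup (Lam : Type) (g : Lam -> {poly C}) : {poly C} -> Prop :=
  | gen_base l : gen_semigroup g (g l)
  | gen_comp p q : gen_semigroup g p -> gen_semigroup g q ->
                   gen_semigroup g (p \Po q).

Definition cyclic_sg (h : {poly C}) : {poly C} -> Prop :=
  gen_semigroup (fun _ : unit => h).

Section Metric.
Variable T : Type.
Variable d : T -> T -> R.

Definition mopen (U : T -> Prop) : Prop :=
  forall x, U x -> exists2 e : R, 0 < e & forall y, d x y < e -> U y.

Definition mclosure (A : T -> Prop) : T -> Prop :=
  fun x => forall e : R, 0 < e -> exists2 a, A a & d x a < e.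

Definition mconnected (A : T -> Prop) : Prop :=
  ~ exists U V : T -> Prop,
      [/\ mopen U /\ mopen V,
          (forall x, A x -> U x \/ V x),
          (exists x, A x /\ U x), (exists x, A x /\ V x) &
          (forall x, A x -> U x -> V x -> False)].

Definition mcomponent (A : T -> Prop) (x : T) : T -> Prop :=
  fun y => exists B : T -> Prop,
      [/\ (forall z, B z -> A z), mconnected B, B x & B y].

Definition is_component (A K : T -> Prop) : Prop :=
  exists2 x, A x & K = mcomponent A x.

End Metric.

Definition loc_unif_cvg (U : sphere -> Prop) (f : nat -> sphere -> sphere)
    (h : sphere -> sphere) : Prop :=
  forall x, U x -> exists2 del : R, 0 < del &
    forall e : R, 0 < e -> exists N : nat, forall n, (N <= n)%N ->
      forall y, U y -> sdist x y < del -> sdist (f n y) (h y) < e.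

Definition normal_on (F : {poly C} -> Prop) (U : sphere -> Prop) : Prop :=
  forall s : nat -> {poly C}, (forall n, F (s n)) ->
  exists phi : nat -> nat, (forall n, (phi n < phi n.+1)%N) /\
  exists h : sphere -> sphere,
    loc_unif_cvg U (fun n => pext (s (phi n))) h.

Definition Fatou (F : {poly C} -> Prop) : sphere -> Prop :=
  fun x => exists U : sphere -> Prop, [/\ mopen sdist U, U x & normal_on F U].

Definition Julia (F : {poly C} -> Prop) : sphere -> Prop :=
  fun x => ~ Fatou F x.

Definition Julia1 (h : {poly C}) : sphere -> Prop := Julia (cyclic_sg h).

Definition crit_values (F : {poly C} -> Prop) : C -> Prop :=
  fun v => exists p, exists c, [/\ F p, (p^`()).[c] = 0 & v = p.[c]].

(* P(G) = closure in the sphere of all critical values (oo included,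
   as it is a critical value of every polynomial of degree >= 2) *)
Definition postcrit (F : {poly C} -> Prop) : sphere -> Prop :=
  mclosure sdist (fun x => match x with
                           | Some v => crit_values F v
                           | None => exists p, F p /\ (2 < size p)%N end).

Definition postcrit_star (F : {poly C} -> Prop) : C -> Prop :=
  fun z => postcrit F (Some z).

Definition bounded_C (A : C -> Prop) : Prop :=
  exists M : R, forall z, A z -> cabs z <= M.

Definition in_calG (F : {poly C} -> Prop) : Prop :=
  (forall p, F p -> (2 < size p)%N) /\ bounded_C (postcrit_star F).

Definition in_calG_dis (F : {poly C} -> Prop) : Prop :=
  in_calG F /\ ~ mconnected sdist (Julia F).

Definition Khat (F : {poly C} -> Prop) : C -> Prop :=
  fun z => exists M : R, forall p, F p -> cabs p.[z] <= M.

Definition bdry_C (A : C -> Prop) : C -> Prop :=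
  fun z => forall e : R, 0 < e ->
    (exists2 a, A a & cdist z a < e) /\ (exists2 b, ~ A b & cdist z b < e).

Definition is_Jmin (F : {poly C} -> Prop) (A : sphere -> Prop) : Prop :=
  [/\ is_component sdist (Julia F) A, ~ A None &
      exists z, A (Some z) /\ bdry_C (Khat F) z].

Definition toC (A : sphere -> Prop) : C -> Prop := fun z => A (Some z).

Definition surr_le (K1 K2 : C -> Prop) : Prop :=
  K1 = K2 \/
  exists B : C -> Prop,
    [/\ is_component cdist (fun z => ~ K2 z) B, bounded_C B &
        forall z, K1 z -> B z].

End Defs.

(* Main.v *)
(* Fix one element p of the semigroup G and pull its filled Julia set K_p back
   by the elements u of G: the frontiers E_u of u^-1(K_p) are connected, being
   limits of level curves |p^n u| = rho above all critical values, and their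
   union is dense in J(G).  Normality comes from Harnack's inequality for
   log|p^n u| where u avoids K_p.  If J(G) is disconnected, comparing the growth
   rates log|s|/deg s of suitable compositions s bounds J(G) in the plane, so
   each component of J(G) through a point of Khat is some J_min and misses the
   J(g_l).  By induction on words no component containing an E_u then meets
   Khat: the step from E_w to its preimage under g_l would map the unbounded
   complementary component of a component of J(G) into itself.  If the J(g_l)
   missed a neighbourhood of z in the boundary of Khat, take a component S of
   J(G) close to z; the complementary components of S meeting Khat would be
   forward invariant and bounded, hence inside Khat, a contradiction.  Finally
   every component of the closure of the union of the J(g_l) contains a limit of
   sets J(g_l), and so surrounds Khat unless it contains the given point. *)

Require Import Defs.
From HB Require Import structures.
From mathcomp Require Import all_boot all_order all_algebra.
From mathcomp Require Import complex.
From mathcomp Require Import reals.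
From mathcomp Require Import boolp classical_sets filter.
From mathcomp Require Import ring lra zify.
Import Order.TTheory GRing.Theory Num.Theory.
Local Open Scope ring_scope.
Set Implicit Arguments.
Unset Strict Implicit.
Unset Printing Implicit Defensive.

(** No compactness of the generating family is available, so [J(G)] is never written as a union of
    preimages under the generators; density of the frontiers and induction on words replace this.
    All analytic functions are polynomials: the open mapping and maximum principles come from
    factoring, and Harnack's inequality from polynomial approximations of roots of order [2 ^ k], so
    that no logarithm occurs in a proof. The hard point is that [J(G)] is bounded. An element [s]
    whose set [s^-1(K_p)] lies in a fixed disc grows, at a fixed point beyond the disc, at least
    like [kappa ^ deg s] with [kappa > 1]. Were [J(G)] unbounded, composing [s] with an element
    whose frontier reaches far out would give another such element, and interpolation on its filled
    set would show that the rate per degree has dropped by a fixed factor [theta > 1]. Finitely many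
    such steps contradict the lower bound. *)

Section Modulus.
Local Open Scope complex_scope.
Variable R : realType.
Local Notation C := R[i].
Implicit Types (x y z : C) (r : R).

Lemma normr_cabs z : `|z| = (cabs z)%:C.
Proof. by case: z => a b; rewrite normc_def. Qed.

Lemma cabs_ge0 z : 0 <= cabs z.
Proof. by rewrite -ler0c -normr_cabs. Qed.

Lemma cabsM x y : cabs (x * y) = cabs x * cabs y.
Proof. exact: Normc.normcM. Qed.

Lemma cabsD x y : cabs (x + y) <= cabs x + cabs y.
Proof. by rewrite -lecR rmorphD /= -!normr_cabs ler_normD. Qed.

Lemma cabsN x : cabs (- x) = cabs x.
Proof. by apply: complexI; rewrite -!normr_cabs normrN. Qed.

Lemma cabsB x y : cabs (x - y) = cabs (y - x).
Proof. by rewrite -cabsN opprB. Qed.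

Lemma cabs_real r : cabs (r%:C) = `|r|.
Proof. by rewrite /cabs /= expr0n addr0 sqrtr_sqr. Qed.

Lemma cabs0 : cabs (0 : C) = 0.
Proof. by rewrite (cabs_real 0) normr0. Qed.

Lemma cabs1 : cabs (1 : C) = 1.
Proof. by rewrite (cabs_real 1) normr1. Qed.

Lemma cabsX x n : cabs (x ^+ n) = cabs x ^+ n.
Proof. by elim: n => [|n IH]; rewrite ?expr0 ?cabs1 // !exprS cabsM IH. Qed.

Lemma cabsV x : cabs x^-1 = (cabs x)^-1.
Proof. exact: Normc.normcV. Qed.

Lemma cabs_div x y : cabs (x / y) = cabs x / cabs y.
Proof. by rewrite cabsM cabsV. Qed.

Lemma cabs_nat n : cabs (n%:R : C) = n%:R.
Proof. by rewrite -(rmorph_nat (real_complex R)) cabs_real normr_nat. Qed.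

Lemma cabs_eq0 x : (cabs x == 0) = (x == 0).
Proof.
apply/eqP/eqP => [h|->]; last exact: cabs0.
exact: Normc.eq0_normc.
Qed.

Lemma cabs_gt0 x : (0 < cabs x) = (x != 0).
Proof. by rewrite lt0r cabs_eq0 cabs_ge0 andbT. Qed.

Lemma cabs_tri y x z : cabs (x - z) <= cabs (x - y) + cabs (y - z).
Proof. by rewrite -[x - z](subrKA y) cabsD. Qed.

Lemma cabs_subl x y : cabs x - cabs y <= cabs (x - y).
Proof. by rewrite lerBlDr -{1}[x](subrK y) cabsD. Qed.

Lemma cabs_prod (I : Type) (s : seq I) (F : I -> C) :
  cabs (\prod_(i <- s) F i) = \prod_(i <- s) cabs (F i).
Proof.
by elim: s => [|i s IH]; rewrite ?big_nil ?cabs1 // !big_cons cabsM IH.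
Qed.

Lemma cabs_sum (I : Type) (s : seq I) (F : I -> C) :
  cabs (\sum_(i <- s) F i) <= \sum_(i <- s) cabs (F i).
Proof.
elim: s => [|i s IH]; rewrite ?big_nil ?cabs0 // !big_cons.
by apply: le_trans (cabsD _ _) _; rewrite lerD2l.
Qed.

Lemma cabs_Re z : `|complex.Re z| <= cabs z.
Proof.
case: z => a b /=; rewrite -sqrtr_sqr ler_sqrt ?addr_ge0 ?sqr_ge0 //.
by rewrite lerDl sqr_ge0.
Qed.

Lemma cabs_Im z : `|complex.Im z| <= cabs z.
Proof.
case: z => a b /=; rewrite -sqrtr_sqr ler_sqrt ?addr_ge0 ?sqr_ge0 //.
by rewrite lerDr sqr_ge0.
Qed.

Lemma cabs_le_ReIm z : cabs z <= `|complex.Re z| + `|complex.Im z|.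
Proof.
rewrite [z in leLHS]complexE; apply: le_trans (cabsD _ _) _.
rewrite cabsM !cabs_real; suff -> : cabs ('i : C) = 1 by rewrite mul1r.
by rewrite /cabs /= expr0n expr1n add0r sqrtr1.
Qed.

Lemma cabs_seq_bound (rs : seq C) : exists B : R, forall z, z \in rs -> cabs z <= B.
Proof.
elim: rs => [|a s [B hB]]; first by exists 0.
by exists (Num.max (cabs a) B) => z; rewrite inE le_max => /orP[/eqP ->|/hB ->]; rewrite ?lexx ?orbT.
Qed.

Lemma pos_below (r s : R) : 0 < r -> 0 < s -> exists m, [/\ 0 < m, m <= r & m <= s].
Proof. by move=> r0 s0; exists (Num.min r s); rewrite lt_min !ge_min !lexx orbT r0. Qed.

End Modulus.

(** * Limits along a nonprincipal ultrafilter on the naturals *)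

Section Ultrafilter.

Lemma nonprincipal_ultrafilter :
  exists U : set_system nat, UltraFilter U /\ (eventually `<=` U)%classic.
Proof. exact: ultraFilterLemma eventually_filter. Qed.

(** One ultrafilter, chosen once: every bounded sequence gets a definite limit, and a disjunction
    holding along the sequence holds for one fixed disjunct, so that subsequences are extracted only
    where normality asks for one. *)
Definition uev : (nat -> Prop) -> Prop := projT1 (cid nonprincipal_ultrafilter).

Lemma uev_ultra : UltraFilter (uev : set_system nat).
Proof. by rewrite /uev; case: cid => U []. Qed.

Implicit Types P Q : nat -> Prop.

Lemma uev_ev N P : (forall n, (N <= n)%N -> P n) -> uev P.
Proof.
move=> h; rewrite /uev; case: cid => U [/= UU]; apply.
by exists N.
Qed.

Lemma uevT P : (forall n, P n) -> uev P.
Proof. by move=> h; apply: (@uev_ev 0). Qed.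

Lemma uev_mono P Q : (forall n, P n -> Q n) -> uev P -> uev Q.
Proof. by case: uev_ultra => -[_ FF] _; apply: filterS. Qed.

Lemma uev_and P Q : uev P -> uev Q -> uev (fun n => P n /\ Q n).
Proof. by case: uev_ultra => -[_ FF] _; apply: filterI. Qed.

Lemma uev_false : ~ uev (fun _ => False).
Proof. by case: uev_ultra => -[F0 _] _; apply: F0. Qed.

Lemma uevN P : ~ uev P -> uev (fun n => ~ P n).
Proof. by case: (in_ultra_setVsetC P uev_ultra) => // h /(_ h). Qed.

Lemma uev_ex_ge N P : uev P -> exists2 n, (N <= n)%N & P n.
Proof.
move=> h; apply: contrapT => h'; apply: uev_false.
apply: uev_mono (uev_and h (@uev_ev N (fun n => (N <= n)%N) (fun n hn => hn))).
by move=> n [Pn Nn]; apply: h'; exists n.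
Qed.

Lemma uev_ex P : uev P -> exists n, P n.
Proof. by move/(@uev_ex_ge 0) => [n _ hn]; exists n. Qed.

Lemma uev_or P Q : uev (fun n => P n \/ Q n) -> uev P \/ uev Q.
Proof.
move=> h; case: (pselect (uev P)) => hP; [by left | right].
by apply: uev_mono (uev_and h (uevN hP)) => n [[]].
Qed.

Lemma uev2 P Q (S : nat -> Prop) :
  uev P -> uev Q -> (forall n, P n -> Q n -> S n) -> uev S.
Proof. by move=> hP hQ h; apply: uev_mono (uev_and hP hQ) => n []; apply: h. Qed.

End Ultrafilter.

(** * Compactness of bounded closed plane sets *)

Section Compactness.
Local Open Scope complex_scope.
Variable R : realType.
Local Notation C := R[i].

Lemma invn_lt (e : R) : 0 < e -> exists N : nat, forall n, (N <= n)%N -> n.+1%:R^-1 < e.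
Proof.
move=> e0; exists (Num.truncn e^-1) => n hn.
rewrite -[e]invrK ltf_pV2 ?posrE ?invr_gt0 ?ltr0n //.
by apply: lt_le_trans (truncnS_gt _) _; rewrite ler_nat.
Qed.

Lemma uev_invn (e : R) : 0 < e -> uev (fun n => n.+1%:R^-1 < e).
Proof. by move=> /invn_lt [N h]; apply: uev_ev h. Qed.

(** The limit is the supremum of the reals that lie below [a n] along the ultrafilter. *)
Lemma uev_real_lim (a : nat -> R) (M : R) : uev (fun n => `|a n| <= M) ->
  exists l, forall e, 0 < e -> uev (fun n => `|a n - l| < e).
Proof.
move=> hM; pose E : set R := fun x => uev (fun n => x <= a n).
have E0 : E (- M).
  rewrite /E; apply: uev_mono hM => n; rewrite ler_norml => /andP[] h _; exact: h.
have EM : ubound E M.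
  move=> x hx; case: (uev_ex (uev_and hM hx)) => n [h1 h2].
  by apply: le_trans h2 (le_trans (ler_norm _) h1).
have hs : has_sup E by split; [exists (- M) | exists M].
exists (sup E) => e e0.
have [x Ex hx] := sup_adherent e0 hs.
have h1 : ~ E (sup E + e / 2).
  move=> h; have := ub_le_sup hs.2 h; lra.
apply: (uev2 Ex (uevN h1)) => n h2 /negP; rewrite -ltNge => h3.
rewrite ltr_norml; lra.
Qed.

Lemma uev_lim (a : nat -> C) (M : R) : uev (fun n => cabs (a n) <= M) ->
  exists l, forall e, 0 < e -> uev (fun n => cabs (a n - l) < e).
Proof.
move=> hM.
have [l1 h1] : exists l, forall e : R, 0 < e -> uev (fun n => `|complex.Re (a n) - l| < e).
  by apply: (@uev_real_lim _ M); apply: uev_mono hM => n; apply: le_trans (cabs_Re _).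
have [l2 h2] : exists l, forall e : R, 0 < e -> uev (fun n => `|complex.Im (a n) - l| < e).
  by apply: (@uev_real_lim _ M); apply: uev_mono hM => n; apply: le_trans (cabs_Im _).
exists (l1 +i* l2) => e e0; have e2 : 0 < e / 2 by lra.
apply: (uev2 (h1 _ e2) (h2 _ e2)) => n k1 k2.
apply: le_lt_trans (cabs_le_ReIm _) _.
by case: (a n) k1 k2 => u v /=; lra.
Qed.

Definition closedC (S : C -> Prop) :=
  forall z, (forall e : R, 0 < e -> exists2 a, S a & cabs (z - a) < e) -> S z.

Lemma closedC_uev (S : C -> Prop) (a : nat -> C) l : closedC S ->
  uev (fun n => S (a n)) -> (forall e : R, 0 < e -> uev (fun n => cabs (a n - l) < e)) ->
  S l.
Proof.
move=> cS h1 h2; apply: cS => e e0.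
have [n [k1 k2]] := uev_ex (uev_and h1 (h2 e e0)).
by exists (a n) => //; rewrite cabsB.
Qed.

Lemma closedC_far (S : C -> Prop) z : closedC S -> ~ S z ->
  exists2 e : R, 0 < e & forall a, cabs (z - a) < e -> ~ S a.
Proof.
move=> cS nz; apply: contrapT => h; apply: nz; apply: cS => e e0.
apply: contrapT => h2; apply: h; exists e => // a ha Sa.
by apply: h2; exists a.
Qed.

(** The limit of a maximising sequence is a maximum point, by upper semicontinuity of [f] on [S]. *)
Lemma max_attained (S : C -> Prop) (f : C -> R) (M : R) :
  (exists z, S z) -> bounded_C S -> closedC S ->
  (forall x, S x -> f x <= M) ->
  (forall x, S x -> forall e : R, 0 < e -> exists2 d : R, 0 < d &
     forall y, S y -> cabs (x - y) < d -> f y < f x + e) ->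
  exists2 x, S x & forall y, S y -> f y <= f x.
Proof.
move=> [z0 Sz0] [B hB] cS fM fc.
pose E : set R := fun r => exists2 z, S z & r = f z.
have hs : has_sup E by split; [exists (f z0); exists z0 | exists M => _ [z Sz ->]; apply: fM].
have hex n : exists z, S z /\ sup E - n.+1%:R^-1 < f z.
  have n0 : 0 < n.+1%:R^-1 :> R by rewrite invr_gt0 ltr0n.
  have [_ [z Sz ->] hz] := sup_adherent n0 hs.
  by exists z.
have [a ha] := choice hex.
have [l hl] : exists l, forall e : R, 0 < e -> uev (fun n => cabs (a n - l) < e).
  by apply: (@uev_lim _ B); apply: uevT => n; apply: hB; case: (ha n).
have Sl : S l by apply: closedC_uev cS _ hl; apply: uevT => n; case: (ha n).
exists l => // y Sy; apply: le_trans (ub_le_sup hs.2 (_ : E (f y))) _; first by exists y.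
rewrite leNgt; apply/negP => hlt;
have e2 : 0 < (sup E - f l) / 2 by rewrite divr_gt0 // subr_gt0.
have [d d0 hd] := fc l Sl _ e2.
have [n [k1 k2]] := uev_ex (uev_and (hl d d0) (uev_invn e2)).
have := hd (a n) (ha n).1; rewrite cabsB => /(_ k1).
have := (ha n).2; move: k2 hlt; move: (sup E) (n.+1%:R^-1) => u v; lra.
Qed.

Lemma farthest (S : C -> Prop) (c : C) :
  (exists z, S z) -> bounded_C S -> closedC S ->
  exists2 x, S x & forall y, S y -> cabs (y - c) <= cabs (x - c).
Proof.
move=> S0 [B hB] cS.
apply: (@max_attained _ (fun y => cabs (y - c)) (B + cabs c)) => //; first by exists B.
  by move=> x Sx; apply: le_trans (cabsD _ _) _; rewrite cabsN lerD2r hB.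
move=> x Sx e e0; exists e => // y Sy h.
by apply: le_lt_trans (cabs_tri x _ _) _; rewrite addrC ltrD2l cabsB.
Qed.

End Compactness.

(** * Connectedness through locally constant predicates *)

Section LocallyConstant.
Local Open Scope complex_scope.
Variable R : realType.
Local Notation C := R[i].
Implicit Types (A B : C -> Prop) (x y z : C).

Definition lconst A (P : C -> Prop) :=
  forall x, A x -> exists2 e : R, 0 < e &
    forall y, A y -> cabs (x - y) < e -> (P x <-> P y).

Definition lconn A := forall P, lconst A P -> forall x y, A x -> A y -> P x -> P y.

Lemma lconst_sub A B P : (forall x, A x -> B x) -> lconst B P -> lconst A P.
Proof.
by move=> AB h x Ax; case: (h x (AB _ Ax)) => e e0 he; exists e => // y /AB; apply: he.
Qed.

Lemma lconn_iff A P : lconn A -> lconst A P -> forall x y, A x -> A y -> P x <-> P y.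
Proof. by move=> cA hP x y Ax Ay; split; apply: cA. Qed.

Lemma lconn_eq A B : (forall x, A x <-> B x) -> lconn A -> lconn B.
Proof.
move=> AB cA P hP x y /AB Ax /AB Ay; apply: cA => //.
by apply: lconst_sub hP => z /AB.
Qed.

Lemma lconn_bigU (I : Type) (B : I -> C -> Prop) z :
  (forall i, lconn (B i)) -> (forall i, B i z) -> lconn (fun x => exists i, B i x).
Proof.
move=> cB Bz P hP x y [i Bix] [j Bjy] Px.
have hs k : lconst (B k) P by apply: lconst_sub hP => w Bw; exists k.
by apply: (cB j _ (hs j) z y) => //; apply: (cB i _ (hs i) x z).
Qed.

Lemma lconn_U A B z : lconn A -> lconn B -> A z -> B z ->
  lconn (fun x => A x \/ B x).
Proof.
move=> cA cB Az Bz; apply: lconn_eq (@lconn_bigU bool (fun b => if b then A else B) z _ _).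
- by move=> x; split=> [[[] h]|[h|h]]; [left | right | exists true | exists false].
- by case.
- by case.
Qed.

Lemma lconn1 z : lconn (fun x => x = z).
Proof. by move=> P _ x y -> ->. Qed.

Definition cont_on A (f : C -> C) := forall x, A x -> forall e : R, 0 < e ->
  exists2 d : R, 0 < d & forall y, A y -> cabs (x - y) < d -> cabs (f x - f y) < e.

Lemma lconn_image A f : cont_on A f -> lconn A -> lconn (fun y => exists2 x, A x & y = f x).
Proof.
move=> fc cA P hP _ _ [x Ax ->] [y Ay ->]; apply: (cA (fun x => P (f x))) => // z Az.
have [e e0 he] := hP (f z) (ex_intro2 _ _ z Az erefl).
have [d d0 hd] := fc z Az e e0; exists d => // w Aw /(hd w Aw).
by apply: he; exists w.
Qed.

Definition clC A : C -> Prop := fun z => forall e : R, 0 < e -> exists2 a, A a & cabs (z - a) < e.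

Lemma clC_sub A x : A x -> clC A x.
Proof. by move=> Ax e e0; exists x => //; rewrite subrr cabs0. Qed.

Lemma lconn_closure A : lconn A -> lconn (clC A).
Proof.
move=> cA P hP x y Ax Ay Px.
have hs : lconst A P by apply: lconst_sub hP; apply: clC_sub.
case: (hP x Ax) => e e0 he; case: (Ax e e0) => a Aa /(he a (clC_sub Aa)) /iffLR /(_ Px) Pa.
case: (hP y Ay) => d d0 hd; case: (Ay d d0) => b Ab /(hd b (clC_sub Ab)) /iffRL; apply.
exact: (cA P hs a b).
Qed.

(** The supremum of the [t] where [P] holds satisfies [P] and cannot lie below 1. *)
Lemma real_lconst (P : R -> Prop) :
  (forall t, 0 <= t <= 1 -> exists2 e : R, 0 < e &
    forall s, 0 <= s <= 1 -> `|t - s| < e -> (P t <-> P s)) -> P 0 -> P 1.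
Proof.
move=> hP P0.
pose E : set R := fun t => 0 <= t <= 1 /\ P t.
have E0 : E 0 by split => //; rewrite lexx ler01.
have hs : has_sup E by split; [exists 0 | exists 1 => t [/andP[]]].
have s0 : 0 <= sup E by exact: (ub_le_sup hs.2 E0).
have s1 : sup E <= 1 by apply: (ge_sup hs.1) => t [/andP[]].
have [e e0 he] : exists2 e : R, 0 < e &
    forall s, 0 <= s <= 1 -> `|sup E - s| < e -> (P (sup E) <-> P s).
  by apply: hP; rewrite s0 s1.
have [t [t01 Pt] ht] := sup_adherent e0 hs.
have tE : t <= sup E by exact: (ub_le_sup hs.2 (conj t01 Pt)).
have Ps : P (sup E) by apply/(he t t01) => //; rewrite ger0_norm ?subr_ge0 //; lra.
have [s1'|s1'] := eqVneq (sup E) 1; first by rewrite s1' in Ps.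
have lt1 : sup E < 1 by rewrite lt_neqAle s1' s1.
pose s := Num.min 1 (sup E + e / 2).
have hss : s <= 1 /\ s <= sup E + e / 2 by split; rewrite /s ge_min lexx ?orbT.
have hs2 : sup E < s by rewrite /s lt_min lt1 /=; lra.
suff : E s by move=> /(ub_le_sup hs.2); rewrite leNgt hs2.
have s01 : 0 <= s <= 1 by rewrite hss.1 andbT; apply: le_trans s0 (ltW hs2).
split=> //; apply/(he s s01) => //.
rewrite ltr0_norm ?subr_lt0 // opprB; case: hss; clearbody s; lra.
Qed.

Lemma lconn_segment x y : lconn (fun z => exists2 t : R, 0 <= t <= 1 & z = x + t%:C * (y - x)).
Proof.
move=> P hP.
suff h : forall t, 0 <= t <= 1 -> P x <-> P (x + t%:C * (y - x)).
  by move=> _ _ [t ht ->] [s hs ->]; move/(h t ht)/(h s hs).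
move=> s /andP[s0 s1]; pose f (t : R) := x + t%:C * (y - x).
(* An equivalence is wanted, so the one-sided principle [real_lconst] is applied both to [P] and to
   its negation. *)
suff h : forall Q : C -> Prop, (Q = P \/ Q = (fun z => ~ P z)) -> Q (f 0) -> Q (f s).
  have f0 : f 0 = x by rewrite /f mul0r addr0.
  rewrite -/(f s) -{1}f0; split; first by apply: h; left.
  move=> hs; apply: contrapT => hn.
  by apply: (h (fun z => ~ P z)) hn hs; right.
move=> Q hQ; have := @real_lconst (fun t => Q (f (t * s))); rewrite mul1r mul0r; apply.
move=> t /andP[t0 t1].
have hin r : 0 <= r <= 1 -> exists2 u : R, 0 <= u <= 1 & f (r * s) = x + u%:C * (y - x).
  by move=> /andP[r0 r1]; exists (r * s) => //; rewrite mulr_ge0 //= mulr_ile1.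
have [e e0 he] := hP (f (t * s)) (hin t (introT andP (conj t0 t1))).
have h0 : 0 <= cabs (y - x) by apply: cabs_ge0.
exists (e / (1 + cabs (y - x))); first by rewrite divr_gt0 //; lra.
move=> r r01 hr; have : P (f (t * s)) <-> P (f (r * s)).
  apply: he; first exact: hin.
  rewrite /f opprD addrACA subrr add0r -mulrBl cabsM -rmorphB cabs_real -mulrBl normrM.
  rewrite (ger0_norm s0).
  rewrite ltr_pdivlMr in hr; last by lra.
  apply: le_lt_trans hr; rewrite -mulrA ler_wpM2l //; nra.
by case: hQ => -> // [h1 h2]; split=> h3 h4; apply: h3; auto.
Qed.

Definition convexC A := forall x y, A x -> A y -> forall t : R, 0 <= t <= 1 -> A (x + t%:C * (y - x)).

Lemma lconn_convex A : convexC A -> lconn A.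
Proof.
move=> cvA P hP x y Ax Ay.
apply: (@lconn_segment x y P); first by apply: lconst_sub hP => z [t ht ->]; apply: cvA.
  by exists 0; rewrite ?mul0r ?addr0 // lexx ler01.
by exists 1; rewrite ?mul1r ?subrKC // lexx ler01.
Qed.

Lemma cabs_convex c x y (t r : R) : 0 <= t <= 1 ->
  cabs (x - c) <= r -> cabs (y - c) <= r -> cabs (x + t%:C * (y - x) - c) <= r.
Proof.
move=> /andP[t0 t1] hx hy.
have -> : x + t%:C * (y - x) - c = (1 - t)%:C * (x - c) + t%:C * (y - c).
  by rewrite rmorphB rmorph1; ring.
apply: le_trans (cabsD _ _) _; rewrite !cabsM !cabs_real !ger0_norm ?subr_ge0 //.
move: (cabs _) (cabs _) hx hy => u v hx hy; nra.
Qed.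

Lemma lconn_cdisc c (r : R) : lconn (fun z => cabs (z - c) <= r).
Proof. by apply: lconn_convex => x y hx hy t ht; apply: cabs_convex. Qed.

Lemma lconn_disc c (r : R) : lconn (fun z => cabs (z - c) < r).
Proof.
apply: lconn_convex => x y hx hy t ht.
apply: (@le_lt_trans _ _ (Num.max (cabs (x - c)) (cabs (y - c)))).
  by apply: cabs_convex; rewrite // le_max lexx ?orbT.
by rewrite gt_max hx.
Qed.

Lemma lconn_ray c v : lconn (fun z => exists2 t : R, 0 <= t & z = c + t%:C * v).
Proof.
apply: lconn_convex => _ _ [t t0 ->] [s s0 ->] u /andP[u0 u1].
exists (t + u * (s - t)); first by nra.
by rewrite rmorphD rmorphM rmorphB /=; ring.
Qed.

Definition comp A x : C -> Prop := fun y => exists B, [/\ (forall z, B z -> A z), lconn B, B x & B y].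

Lemma comp_lconn A x : lconn (comp A x).
Proof.
pose I := {B : C -> Prop | [/\ (forall z, B z -> A z), lconn B & B x]}.
apply: lconn_eq (@lconn_bigU I (fun i => projT1 i) x _ _).
- move=> y; split=> [[[B [h1 h2 h3]] h4]|[B [h1 h2 h3 h4]]]; first by exists B.
  by exists (exist _ B (And3 h1 h2 h3)).
- by case=> B [].
- by case=> B [].
Qed.

Lemma comp_sub A x y : comp A x y -> A y.
Proof. by case=> B [h1 _ _ /h1]. Qed.

Lemma comp_max A x B : (forall z, B z -> A z) -> lconn B ->
  (exists2 y, comp A x y & B y) -> forall z, B z -> comp A x z.
Proof.
move=> BA cB [y [D [h1 h2 h3 h4]] By] z Bz.
exists (fun w => D w \/ B w); split; [by move=> w []; auto | | by left | by right].
exact: lconn_U By.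
Qed.

Lemma comp_refl A x : A x -> comp A x x.
Proof. by move=> Ax; exists (fun z => z = x); split=> // [z ->//|]; apply: lconn1. Qed.

Lemma comp_closed A x : closedC A -> closedC (comp A x).
Proof.
move=> cA z hz; case: (hz 1 ltr01) => a ca _.
exists (clC (comp A x)); split.
- by move=> w hw; apply: cA => e /hw [b /comp_sub]; exists b.
- by apply: lconn_closure; apply: comp_lconn.
- by apply: clC_sub; apply: comp_refl; case: ca => B [h1 _ /h1].
- exact: hz.
Qed.

End LocallyConstant.

(** * Limits of sequences of plane sets *)

Section Ulimits.
Variable R : realType.
Local Notation C := R[i].
Implicit Types (A Q : nat -> C -> Prop).

(** The Kuratowski limit along the ultrafilter; upper and lower limits agree, since a set of indices
    or its complement is large. *)
Definition Ulim A : C -> Prop := fun x => forall e : R, 0 < e ->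
  uev (fun n => exists2 y, A n y & cabs (x - y) < e).

Lemma Ulim_closed A : closedC (Ulim A).
Proof.
move=> z h e e0; have e2 : 0 < e / 2 by lra.
case: (h _ e2) => a ha h1; apply: uev_mono (ha _ e2) => n [y Ay hy]; exists y => //.
apply: le_lt_trans (cabs_tri a _ _) _; lra.
Qed.

Lemma Ulim_seq A (a : nat -> C) x : uev (fun n => A n (a n)) ->
  (forall e : R, 0 < e -> uev (fun n => cabs (a n - x) < e)) -> Ulim A x.
Proof.
move=> h1 h2 e e0; apply: (uev2 h1 (h2 e e0)) => n k1 k2.
by exists (a n) => //; rewrite cabsB.
Qed.

Lemma Ulim_nonempty A (M : R) : uev (fun n => forall y, A n y -> cabs y <= M) ->
  uev (fun n => exists y, A n y) -> exists x, Ulim A x.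
Proof.
move=> hM hne.
have [a ha] : {a : nat -> C & forall n, (exists y, A n y) -> A n (a n)}.
  apply: (@choice _ _ (fun n z => (exists y, A n y) -> A n z)) => n.
  by case: (pselect (exists y, A n y)) => [[y hy]|h]; [exists y | exists 0].
have hA : uev (fun n => A n (a n)) by apply: uev_mono hne.
have [l hl] : exists l, forall e : R, 0 < e -> uev (fun n => cabs (a n - l) < e).
  by apply: (@uev_lim _ _ M); apply: (uev2 hM hA) => n; apply.
by exists l; exact: Ulim_seq hA hl.
Qed.

(** The limits of the two parts of [A n] are closed, nonempty and cover the limit of [A n]; were
    they disjoint, they would disconnect it. *)
Lemma Ulim_split A Q (M : R) : uev (fun n => forall y, A n y -> cabs y <= M) ->
  lconn (Ulim A) ->
  uev (fun n => exists2 y, A n y & Q n y) -> uev (fun n => exists2 y, A n y & ~ Q n y) ->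
  exists x, Ulim (fun n y => A n y /\ Q n y) x /\ Ulim (fun n y => A n y /\ ~ Q n y) x.
Proof.
move=> hM cL hQ hNQ.
pose X := Ulim (fun n y => A n y /\ Q n y); pose Y := Ulim (fun n y => A n y /\ ~ Q n y).
have [x Xx] : exists x, X x.
  apply: (@Ulim_nonempty _ M); first by apply: uev_mono hM => n h y [/h].
  by apply: uev_mono hQ => n [y]; exists y.
have [y Yy] : exists x, Y x.
  apply: (@Ulim_nonempty _ M); first by apply: uev_mono hM => n h z [/h].
  by apply: uev_mono hNQ => n [z]; exists z.
have XA z : X z -> Ulim A z.
  by move=> h e e0; apply: uev_mono (h e e0) => n [w [Aw _]]; exists w.
have YA z : Y z -> Ulim A z.
  by move=> h e e0; apply: uev_mono (h e e0) => n [w [Aw _]]; exists w.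
apply: contrapT => hno.
have XY z : X z -> Y z -> False by move=> h1 h2; apply: hno; exists z.
have cov z : Ulim A z -> X z \/ Y z.
  move=> hz; case: (pselect (X z)) => [|nX]; [by left | right=> e e0].
  have [d d0 hd] := closedC_far (@Ulim_closed _) nX.
  have [e' [e'0 he']] : exists e' : R, 0 < e' /\ (e' <= e /\ ~ uev (fun n => exists2 y, A n y /\ Q n y & cabs (z - y) < e')).
    apply: contrapT => h; apply: nX => e1 e10.
    apply: contrapT => h2; apply: h; exists (Num.min e e1).
    rewrite lt_min e0 e10 ge_min lexx; split=> //; split=> // h3; apply: h2.
    by apply: uev_mono h3 => n [w hw]; rewrite lt_min => /andP[_ h]; exists w.
  apply: (uev2 (hz e' e'0) (uevN he'.2)) => n [w Aw hw] hn; exists w; last exact: lt_le_trans he'.1.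
  by split=> // Qw; apply: hn; exists w.
have hP : lconst (Ulim A) X.
  move=> z Lz; case: (cov z Lz) => hz.
    have [d d0 hd] : exists2 e : R, 0 < e & forall a, cabs (z - a) < e -> ~ Y a.
      by apply: closedC_far; [apply: Ulim_closed | move=> h; apply: XY h].
    exists d => // w Lw hw; split=> // _; by case: (cov w Lw) => // /(hd w hw).
  have [d d0 hd] : exists2 e : R, 0 < e & forall a, cabs (z - a) < e -> ~ X a.
    by apply: closedC_far; [apply: Ulim_closed | move=> h; apply: XY h hz].
  exists d => // w Lw hw; split=> h; last by case: (hd w hw h).
  by case: (XY z h hz).
have Xy : X y by apply: (cL X hP x y (XA _ Xx) (YA _ Yy) Xx).
exact: XY Xy Yy.
Qed.

(** By compactness the two sides of a locally constant [P] on the limit are at least [3 * e] apart.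
    For many [n] every point of [A n] is within [e] of the limit, and being within [e] of the side
    where [P] holds is then locally constant on [A n]. *)
Lemma lconn_Ulim A (M : R) : uev (fun n => forall y, A n y -> cabs y <= M) ->
  uev (fun n => lconn (A n)) -> lconn (Ulim A).
Proof.
move=> hM hc P hP x y Lx Ly Px; apply: contrapT => nPy.
have [e e0 sep] : exists2 e : R, 0 < e &
    forall a b, Ulim A a -> Ulim A b -> P a -> ~ P b -> 3 * e <= cabs (a - b).
  apply: contrapT => hno.
  have hex n : exists p : C * C, [/\ Ulim A p.1, Ulim A p.2, P p.1, ~ P p.2
                                    & cabs (p.1 - p.2) < n.+1%:R^-1].
    apply: contrapT => h; apply: hno; exists (n.+1%:R^-1 / 3); first by rewrite divr_gt0 ?invr_gt0 ?ltr0n.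
    move=> a b La Lb Pa Pb; rewrite mulrC divfK ?pnatr_eq0 // leNgt; apply/negP => hlt.
    by apply: h; exists (a, b).
  have [p hp] := choice hex.
  have LM z : Ulim A z -> cabs z <= M + 1.
    move=> /(_ 1 ltr01) h; have [n [k1 [w /k1 Aw hw]]] := uev_ex (uev_and hM h).
    have := cabs_subl z w; lra.
  have [l hl] : exists l, forall e : R, 0 < e -> uev (fun n => cabs ((p n).1 - l) < e).
    by apply: (@uev_lim _ _ (M + 1)); apply: uevT => n; apply: LM; case: (hp n).
  have Ll : Ulim A l.
    by apply: (closedC_uev (a := fun n => (p n).1)) hl; [exact: Ulim_closed | apply: uevT => n; case: (hp n)].
  have [e e0 he] := hP l Ll; have e2 : 0 < e / 2 by lra.
  have [n [k1 k2]] := uev_ex (uev_and (hl _ e2) (uev_invn e2)).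
  case: (hp n) => L1 L2 P1 P2 hlt; apply: P2; apply/(he _ L2).
    apply: le_lt_trans (cabs_tri (p n).1 _ _) _.
    by rewrite cabsB; move: hlt k1 k2; move: (n.+1%:R^-1) => u; lra.
  by apply/(he _ L1) => //; rewrite cabsB; lra.
have near : uev (fun n => forall z, A n z -> exists2 a, Ulim A a & cabs (z - a) < e).
  apply: contrapT => /uevN hn.
  pose A' n z := A n z /\ ~ exists2 a, Ulim A a & cabs (z - a) < e.
  have [z hz] : exists z, Ulim A' z.
    apply: (@Ulim_nonempty _ M); first by apply: uev_mono hM => n h w [/h].
    apply: uev_mono hn => n h; apply: contrapT => h2; apply: h => z Az.
    by apply: contrapT => h3; apply: h2; exists z.
  have Lz : Ulim A z by move=> d d0; apply: uev_mono (hz d d0) => n [w [Aw _]]; exists w.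
  by have [n [w [_ h]]] := uev_ex (hz e e0); rewrite cabsB => h2; apply: h; exists z.
have [n [[[hn cn] [x' Ax' hx']] [y' Ay' hy']]] :=
  uev_ex (uev_and (uev_and (uev_and near hc) (Lx e e0)) (Ly e e0)).
pose Q z := exists2 a, Ulim A a /\ P a & cabs (z - a) < e.
have key z w : A n z -> A n w -> cabs (z - w) < e -> Q z -> Q w.
  move=> Az Aw hzw [a [La Pa] ha]; have [b Lb hb] := hn w Aw.
  exists b => //; split=> //; apply: contrapT => Pb.
  have := sep a b La Lb Pa Pb; rewrite leNgt => /negP; apply.
  have := cabs_tri z a b; have := cabs_tri w z b; rewrite (cabsB a z) => h1 h2; lra.
have hQ : lconst (A n) Q.
  move=> z Az; exists e => // w Aw h; split; apply: key => //; by rewrite cabsB.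
have [|b [Lb Pb] hb] := cn Q hQ x' y' Ax' Ay'; first by exists x; rewrite // cabsB.
have := sep b y Lb Ly Pb nPy; have := cabs_tri y' b y.
by rewrite (cabsB b y') (cabsB y' y); lra.
Qed.

End Ulimits.

(** * Open mapping, maximum modulus and growth of polynomials *)

Section ComplexPolynomials.
Local Open Scope complex_scope.
Variable R : realType.
Local Notation C := R[i].
Implicit Types (q : {poly C}) (x y z : C).

Lemma poly_bound_lip q (M : R) : 0 <= M -> exists2 K : R, 0 <= K &
  forall x y, cabs x <= M -> cabs y <= M ->
  cabs q.[x] <= K /\ cabs (q.[x] - q.[y]) <= K * cabs (x - y).
Proof.
move=> M0; elim/poly_ind: q => [|q c [K K0 IH]].
  by exists 0 => // x y _ _; rewrite !horner0 subrr cabs0 mul0r.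
have c0 : 0 <= cabs c by apply: cabs_ge0.
exists (K + K * M + cabs c); first by rewrite !addr_ge0 ?mulr_ge0.
move=> x y hx hy; case: (IH x y hx hy) => h1 h2.
rewrite !hornerMXaddC; split.
  apply: le_trans (cabsD _ _) _; rewrite lerD2r cabsM.
  have : cabs q.[x] * cabs x <= K * M by rewrite ler_pM ?cabs_ge0.
  lra.
have -> : q.[x] * x + c - (q.[y] * y + c) = q.[x] * (x - y) + (q.[x] - q.[y]) * y by ring.
apply: le_trans (cabsD _ _) _; rewrite !cabsM.
have h0 := cabs_ge0 (x - y).
have : cabs q.[x] * cabs (x - y) <= K * cabs (x - y) by rewrite ler_wpM2r.
have : cabs (q.[x] - q.[y]) * cabs y <= K * cabs (x - y) * M by rewrite ler_pM ?cabs_ge0.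
have : 0 <= cabs c * cabs (x - y) by rewrite mulr_ge0.
nra.
Qed.

Lemma poly_bound q (M : R) : exists2 K : R, 0 <= K & forall x, cabs x <= M -> cabs q.[x] <= K.
Proof.
have h : 0 <= Num.max 0 M by rewrite le_max lexx.
case: (poly_bound_lip q h) => K K0 hK; exists K => // x hx.
by case: (hK x x) => //; rewrite le_max hx orbT.
Qed.

Lemma poly_cont q x (e : R) : 0 < e ->
  exists2 d : R, 0 < d & forall y, cabs (x - y) < d -> cabs (q.[x] - q.[y]) < e.
Proof.
move=> e0; have h0 := cabs_ge0 x.
case: (@poly_bound_lip q (cabs x + 1)) => [|K K0 hK]; first by lra.
have h1 : 0 < e / (K + 1) by rewrite divr_gt0 //; lra.
exists (Num.min 1 (e / (K + 1))); first by rewrite lt_min ltr01.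
move=> y; rewrite lt_min => /andP[y1 y2].
have hy : cabs y <= cabs x + 1 by have := cabs_subl y x; rewrite cabsB; lra.
case: (hK x y _ hy) => [|_ h]; first by lra.
apply: le_lt_trans h _; rewrite ltr_pdivlMr in y2; last by lra.
have := cabs_ge0 (x - y); nra.
Qed.

Lemma poly_cont_on q (A : C -> Prop) : cont_on A (fun z => q.[z]).
Proof. by move=> x _ e /(poly_cont q x) [d d0 hd]; exists d => // y _; apply: hd. Qed.

Lemma poly_lim q (a : nat -> C) l :
  (forall e : R, 0 < e -> uev (fun n => cabs (a n - l) < e)) ->
  forall e : R, 0 < e -> uev (fun n => cabs (q.[a n] - q.[l]) < e).
Proof.
move=> h e e0; case: (poly_cont q l e0) => d d0 hd.
by apply: uev_mono (h d d0) => n; rewrite cabsB => /hd; rewrite cabsB.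
Qed.

Lemma poly_factors q : exists rs : seq C,
  q = lead_coef q *: \prod_(z <- rs) ('X - z%:P) /\ (q != 0 -> size rs = (size q).-1).
Proof.
case: (closed_field_poly_normal q) => rs hq; exists rs; split=> // q0.
by rewrite hq size_scale ?lead_coef_eq0 // size_prod_XsubC.
Qed.

Lemma horner_factors (c : C) rs x :
  (c *: \prod_(z <- rs) ('X - z%:P)).[x] = c * \prod_(z <- rs) (x - z).
Proof.
rewrite hornerZ horner_prod; congr (_ * _).
by apply: eq_bigr => z _; rewrite hornerXsubC.
Qed.

Lemma deg_gt0 q : (1 < size q)%N -> (0 < (size q).-1)%N.
Proof. by case: (size q) => [|[]]. Qed.

(** For the root [r] nearest to [x], each linear factor at [x] has modulus at least
    [cabs (x - r)]. *)
Lemma root_near q x : (1 < size q)%N -> exists2 r, q.[r] = 0 &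
  cabs (lead_coef q) * cabs (x - r) ^+ (size q).-1 <= cabs q.[x].
Proof.
move=> sq; have q0 : q != 0 by rewrite -size_poly_gt0; apply: leq_trans sq.
case: (poly_factors q) => rs [hq /(_ q0) hs].
have [r [rin hr]] : exists r, r \in rs /\ cabs (x - r) ^+ size rs <= \prod_(z <- rs) cabs (x - z).
  have : (0 < size rs)%N by rewrite hs deg_gt0.
  elim: rs {hq hs} => // a s IH _; case: s IH => [|b s] IH.
    by exists a; rewrite big_seq1 expr1 mem_head.
  case: (IH isT) => r [rin hr].
  case: (lerP (cabs (x - r)) (cabs (x - a))) => h.
    exists r; split; first by rewrite inE rin orbT.
    by rewrite big_cons exprS ler_pM ?exprn_ge0 ?cabs_ge0.
  exists a; split; first by rewrite inE eqxx.
  rewrite big_cons exprS ler_pM ?exprn_ge0 ?cabs_ge0 //.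
  by apply: le_trans hr; rewrite lerXn2r ?nnegrE ?cabs_ge0 ?ltW.
exists r.
  apply/eqP; rewrite hq horner_factors mulf_eq0 prodf_seq_eq0; apply/orP; right; apply/hasP.
  by exists r => //=; rewrite subrr.
rewrite [in leRHS]hq horner_factors cabsM cabs_prod -hs.
by rewrite ler_wpM2l ?cabs_ge0.
Qed.

Lemma lead_coefB_const q y : (1 < size q)%N ->
  size (q - y%:P) = size q /\ lead_coef (q - y%:P) = lead_coef q.
Proof.
move=> sq; have h : (size (- y%:P : {poly C}) < size q)%N.
  by rewrite size_polyN; apply: leq_ltn_trans (size_polyC_leq1 _) sq.
by rewrite size_polyDl // lead_coefDl.
Qed.

(** [root_near] for [q - y]. The estimate depends on [q] only through its degree and leading
    coefficient, hence is uniform over polynomials that share both. *)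
Lemma preimage_near q x y : (1 < size q)%N -> exists2 r, q.[r] = y &
  cabs (lead_coef q) * cabs (x - r) ^+ (size q).-1 <= cabs (q.[x] - y).
Proof.
move=> sq; case: (lead_coefB_const y sq) => h1 h2.
case: (@root_near (q - y%:P) x); first by rewrite h1.
move=> r; rewrite h1 h2 !hornerE => /eqP; rewrite subr_eq0 => /eqP hr hle.
by exists r.
Qed.

Lemma lead_gt0 q : (1 < size q)%N -> 0 < cabs (lead_coef q).
Proof. by move=> sq; rewrite cabs_gt0 lead_coef_eq0 -size_poly_gt0 ltnW. Qed.

Lemma pow_small (c e : R) (n : nat) : 0 < c -> 0 < e -> (0 < n)%N ->
  exists2 d : R, 0 < d & forall t u : R, 0 <= t -> u < d -> c * t ^+ n <= u -> t < e.
Proof.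
move=> c0 e0 n0; exists (c * e ^+ n); first by rewrite mulr_gt0 ?exprn_gt0.
move=> t u t0 hu ht; have : c * t ^+ n < c * e ^+ n by apply: le_lt_trans ht hu.
rewrite ltr_pM2l // => h; rewrite ltNge; apply/negP => het; move: h.
by rewrite ltNge lerXn2r // nnegrE ltW.
Qed.

Lemma open_mapping q (e : R) : (1 < size q)%N -> 0 < e ->
  exists2 d : R, 0 < d & forall x y, cabs (q.[x] - y) < d ->
    exists2 r, q.[r] = y & cabs (x - r) < e.
Proof.
move=> sq e0; case: (@pow_small _ e (size q).-1 (lead_gt0 sq) e0); first exact: deg_gt0.
move=> d d0 hd; exists d => // x y hxy; case: (preimage_near x y sq) => r hr hle.
by exists r => //; apply: hd hxy hle; apply: cabs_ge0.
Qed.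

Lemma poly_surj q y : (1 < size q)%N -> exists r, q.[r] = y.
Proof. by move=> sq; case: (preimage_near 0 y sq) => r; exists r. Qed.

(** A value slightly farther from 0 than [q.[x]] is lifted back to a point near [x] by
    [open_mapping]. *)
Lemma not_local_max q x (e : R) : (1 < size q)%N -> 0 < e ->
  exists2 y, cabs (x - y) < e & cabs q.[x] < cabs q.[y].
Proof.
move=> sq e0; case: (open_mapping sq e0) => d d0 hd.
have [w hw1 hw2] : exists2 w, cabs (q.[x] - w) < d & cabs q.[x] < cabs w.
  case: (eqVneq q.[x] 0) => [->|qx0].
    exists (d / 2)%:C; rewrite ?sub0r ?cabsN ?cabs0 cabs_real ger0_norm; lra.
  have h0 : 0 < cabs q.[x] by rewrite cabs_gt0.
  exists (q.[x] + (d / 2 / cabs q.[x])%:C * q.[x]).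
    rewrite opprD addNKr cabsN cabsM cabs_real ger0_norm ?divfK ?gt_eqF //; first by lra.
    by rewrite !divr_ge0 ?ltW.
  rewrite -{2}[q.[x]]mul1r -mulrDl cabsM -(rmorph1 (real_complex R)) -rmorphD cabs_real.
  have h1 : 0 < d / 2 / cabs q.[x] by rewrite !divr_gt0.
  rewrite ger0_norm; last by lra.
  by rewrite mulrDl mul1r ltrDl mulr_gt0.
by case: (hd x w hw1) => r hr hxr; exists r; rewrite ?hr.
Qed.

Lemma max_modulus_disc q c (rho M : R) : 0 <= rho ->
  (forall z, cabs (z - c) = rho -> cabs q.[z] <= M) ->
  forall z, cabs (z - c) <= rho -> cabs q.[z] <= M.
Proof.
move=> r0 hM.
case: (ltnP 1 (size q)) => sq; last first.
  move=> z _; move: (size1_polyC sq); move: (q`_0) => k hk; subst q.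
  have := hM (c + rho%:C); rewrite !hornerC addrAC subrr add0r cabs_real.
  by rewrite ger0_norm //; apply.
pose S z := cabs (z - c) <= rho.
have Sb z : S z -> cabs z <= rho + cabs c.
  by rewrite /S => h; have := cabs_subl z c; lra.
have [K K0 hK] := poly_bound q (rho + cabs c).
have [x Sx hx] : exists2 x, S x & forall y, S y -> cabs q.[y] <= cabs q.[x].
  apply: (@max_attained _ S (fun z => cabs q.[z]) K).
  - by exists c; rewrite /S subrr cabs0.
  - by exists (rho + cabs c).
  - move=> z h; rewrite /S leNgt; apply/negP => hlt.
    have e0 : 0 < cabs (z - c) - rho by rewrite subr_gt0.
    case: (h _ e0) => a; rewrite /S => ha hza.
    have := cabs_tri a z c; lra.
  - by move=> z /Sb; apply: hK.
  - move=> z _ e e0; case: (poly_cont q z e0) => d d0 hd; exists d => // y _ /hd h.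
    by have := cabs_subl q.[y] q.[z]; rewrite cabsB; lra.
move=> z Sz; apply: le_trans (hx z Sz) _.
have [h|h] := eqVneq (cabs (x - c)) rho; first exact: hM.
have e0 : 0 < rho - cabs (x - c) by rewrite subr_gt0 lt_neqAle h.
case: (not_local_max x sq e0) => y hxy; rewrite ltNge hx //.
by rewrite /S; have := cabs_tri x y c; rewrite (cabsB y x); lra.
Qed.

Lemma poly_diff_quot q c : exists P : {poly C}, q = P * ('X - c%:P) + q.[c]%:P /\
  forall z, q.[z] - q.[c] = P.[z] * (z - c).
Proof.
have /factor_theorem [P hP] : root (q - q.[c]%:P) c.
  by rewrite rootE hornerD hornerN hornerC subrr.
exists P; split=> [|z]; first by rewrite -hP subrK.
by have := congr1 (fun r => r.[z]) hP; rewrite hornerM hornerXsubC hornerD hornerN hornerC.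
Qed.

(** Maximum modulus for the divided difference [(q - q(c)) / (z - c)], which is a polynomial. *)
Lemma schwarz_poly q c (rho M : R) : 0 < rho ->
  (forall z, cabs (z - c) <= rho -> cabs q.[z] <= M) ->
  forall z, cabs (z - c) <= rho -> cabs (q.[z] - q.[c]) <= 2 * M / rho * cabs (z - c).
Proof.
move=> r0 hM z hz; case: (poly_diff_quot q c) => P [_ hP].
rewrite hP cabsM ler_wpM2r ?cabs_ge0 //.
apply: (@max_modulus_disc _ c rho) hz; first exact: ltW.
move=> w hw; rewrite ler_pdivlMr // -hw -cabsM -hP.
apply: le_trans (cabsD _ _) _; rewrite cabsN.
have h1 := hM w; have h2 := hM c; rewrite subrr cabs0 in h2.
have := h1 (_ : _ <= _); have := h2 (ltW r0); rewrite hw lexx => k /(_ isT); lra.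
Qed.

(** The disc of radius [rho / 2] about [y] contains [x] and lies in the given disc, so the Schwarz
    bound applies with centre [y]. *)
Lemma poly_lip_of_bound q c (rho M : R) : 0 < rho ->
  (forall z, cabs (z - c) <= rho -> cabs q.[z] <= M) ->
  forall x y, cabs (x - c) <= rho / 4 -> cabs (y - c) <= rho / 4 ->
    cabs (q.[x] - q.[y]) <= 4 * M / rho * cabs (x - y).
Proof.
move=> r0 hM x y hx hy; have r2 : 0 < rho / 2 by lra.
have hxy : cabs (x - y) <= rho / 2 by have := cabs_tri c x y; rewrite (cabsB c); lra.
have := @schwarz_poly q y (rho / 2) M r2 _ x hxy.
have -> : 2 * M / (rho / 2) = 4 * M / rho by field; rewrite gt_eqF.
apply=> z hz; apply: hM; have := cabs_tri y z c; lra.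
Qed.

Lemma poly_growth q (M : R) : (1 < size q)%N ->
  exists2 r : R, 0 < r & forall z, r <= cabs z -> M <= cabs q.[z].
Proof.
move=> sq; have q0 : q != 0 by rewrite -size_poly_gt0; apply: leq_trans sq.
have l0 := lead_gt0 sq; set l := cabs _ in l0.
case: (poly_factors q) => rs [hq /(_ q0) hs].
pose A := Num.max 1 (M / l).
have A1 : 1 <= A by rewrite le_max lexx.
have AM : M <= A * l by rewrite -ler_pdivrMr // le_max lexx orbT.
have [B hB] := cabs_seq_bound rs.
have B0 : 0 <= Num.max 0 B by rewrite le_max lexx.
exists (Num.max 0 B + A); first by clearbody A; lra.
move=> z hz; rewrite hq horner_factors cabsM cabs_prod -/l.
apply: le_trans AM _; rewrite mulrC ler_wpM2l ?(ltW l0) // big_seq.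
have sz : (0 < size rs)%N by rewrite hs deg_gt0.
have hf w : w \in rs -> A <= cabs (z - w).
  move=> /hB hw; have := cabs_subl z w.
  have : B <= Num.max 0 B by rewrite le_max lexx orbT.
  clearbody A; move: (Num.max 0 B) hz => u; lra.
rewrite -big_seq; case: rs {hq hs hB} hf sz => // a s hf _; rewrite big_cons.
have : 1 <= \prod_(j <- s) cabs (z - j).
  have : forall j, j \in s -> A <= cabs (z - j) by move=> j js; apply: hf; rewrite inE js orbT.
  elim: s {hf} => [|b s IH] h; first by rewrite big_nil.
  rewrite big_cons; have h1 := h b (mem_head _ _).
  have h2 : 1 <= \prod_(j <- s) cabs (z - j).
    by apply: IH => j js; apply: h; rewrite inE js orbT.
  by apply: mulr_ege1 => //; apply: le_trans A1 h1.
have h1 := hf a (mem_head _ _); move=> h2.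
apply: le_trans h1 _; rewrite ler_peMr //; exact: cabs_ge0.
Qed.

(** Dividing [q - q(0)] by ['X] leaves a nonconstant polynomial, which exceeds 3 far out; the
    surplus over 2 absorbs [q.[0]]. *)
Lemma poly_growth2 q : (2 < size q)%N ->
  exists2 r : R, 1 <= r & forall z, r <= cabs z -> 2 * cabs z <= cabs q.[z].
Proof.
move=> sq; have /factor_theorem [P hP] : root (q - q.[0]%:P) 0 by rewrite rootE !hornerE subrr.
have [h1 _] := lead_coefB_const q.[0] (ltnW sq).
rewrite subr0 in hP.
have P0 : P != 0.
  by apply/eqP => P0; move: h1; rewrite hP P0 mul0r size_poly0 => h; rewrite -h in sq.
have sP : (1 < size P)%N by rewrite hP size_mulX // in h1; rewrite -h1 in sq.
case: (poly_growth 3 sP) => r r0 hr.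
exists (r + cabs q.[0] + 1); first by have := cabs_ge0 q.[0]; lra.
move=> z hz; have c0 := cabs_ge0 q.[0].
have := congr1 (fun u => u.[z]) hP; rewrite !hornerE => /= hz2.
have : 3 * cabs z <= cabs (q.[z] - q.[0]).
  by rewrite hz2 cabsM ler_wpM2r ?cabs_ge0 // hr //; lra.
have := cabsD q.[z] (- q.[0]); rewrite cabsN; lra.
Qed.

End ComplexPolynomials.

(** * Arcs of circles, and expansion near a regular point *)

Section LevelSets.
Local Open Scope complex_scope.
Variable R : realType.
Local Notation C := R[i].
Implicit Types (P q : {poly C}) (x y z w : C) (rho : R).

Lemma radial_proj_lip rho w v : 0 <= rho -> w != 0 -> v != 0 ->
  cabs ((rho / cabs w)%:C * w - (rho / cabs v)%:C * v) <= 2 * rho / cabs w * cabs (w - v).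
Proof.
move=> r0 w0 v0; have hw : 0 < cabs w by rewrite cabs_gt0.
have hv : 0 < cabs v by rewrite cabs_gt0.
have -> : (rho / cabs w)%:C * w - (rho / cabs v)%:C * v =
  (rho / cabs w)%:C * (w - v) + (rho / cabs w - rho / cabs v)%:C * v.
  by rewrite rmorphB /=; ring.
apply: le_trans (cabsD _ _) _; rewrite !cabsM !cabs_real.
have h1 : `|rho / cabs w| = rho / cabs w by rewrite ger0_norm // divr_ge0 // ltW.
have h2 : `|rho / cabs w - rho / cabs v| * cabs v = rho / cabs w * `|cabs v - cabs w|.
  have -> : rho / cabs w - rho / cabs v = rho / cabs w * ((cabs v - cabs w) / cabs v).
    by field; rewrite !gt_eqF.
  rewrite normrM h1 normrM normfV (ger0_norm (ltW hv)).
  by rewrite mulrA divfK // gt_eqF.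
have h3 : `|cabs v - cabs w| <= cabs (w - v).
  rewrite ler_norml; have := cabs_subl v w; have := cabs_subl w v; rewrite (cabsB v); lra.
rewrite h1 h2 -[2 * rho / _]mulrA.
have : 0 <= rho / cabs w by rewrite divr_ge0 // ltW.
move: (rho / cabs w) `|_| (cabs (w - v)) h3 => k a b; nra.
Qed.

(** The arc is the radial projection of the chord from [x] to [y], which avoids 0 because [y] is not
    antipodal to [x]. *)
Lemma circle_arc x y rho : 0 < rho -> cabs x = rho -> cabs y = rho -> y != - x ->
  exists A : C -> Prop, [/\ lconn A, A x, A y &
    forall z, A z -> cabs z = rho /\ cabs (z - x) <= 2 * cabs (x - y)].
Proof.
move=> r0 hx hy hxy.
pose S z := exists2 t : R, 0 <= t <= 1 & z = x + t%:C * (y - x).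
pose f w := (rho / cabs w)%:C * w.
have S0 z : S z -> z != 0.
  move=> [t /andP[t0 t1] ->]; apply/eqP => h.
  have h2 : (1 - t)%:C * x = - (t%:C * y).
    by apply/eqP; rewrite -subr_eq0 opprK -h rmorphB rmorph1; apply/eqP; ring.
  have := congr1 (@cabs R) h2; rewrite cabsN !cabsM !cabs_real hx hy !ger0_norm ?subr_ge0 //.
  have rn : rho != 0 by rewrite gt_eqF.
  move=> /(mulIf rn) h3; have ht : t = 1 / 2 by lra.
  move: h2; rewrite ht; have -> : 1 - 1 / 2 = 1 / 2 :> R by lra.
  rewrite -mulrN => /mulfI h4; case/eqP: hxy.
  by rewrite -[y]opprK -h4 ?fmorph_eq0 //; lra.
exists (fun w => exists2 z, S z & w = f z); split.
- apply: lconn_image; last exact: lconn_segment.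
  move=> w Sw e e0; have w0 := S0 w Sw; have hw : 0 < cabs w by rewrite cabs_gt0.
  exists (e / (2 * rho / cabs w)); first by rewrite !divr_gt0 ?mulr_gt0.
  move=> v /S0 v0; rewrite ltr_pdivlMr; last by rewrite divr_gt0 ?mulr_gt0.
  by rewrite mulrC; apply: le_lt_trans; apply: radial_proj_lip; rewrite ?ltW.
- exists x; first by exists 0; rewrite ?lexx ?ler01 ?mul0r ?addr0.
  by rewrite /f hx divff ?gt_eqF // mul1r.
- exists y; first by exists 1; rewrite ?lexx ?ler01 ?mul1r ?subrKC.
  by rewrite /f hy divff ?gt_eqF // mul1r.
move=> _ [w Sw ->]; have w0 := S0 w Sw; have hw : 0 < cabs w by rewrite cabs_gt0.
have -> : cabs (f w) = rho.
  by rewrite /f cabsM cabs_real ger0_norm ?divfK ?gt_eqF // divr_ge0 // ltW.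
split=> //.
have h1 : cabs (w - x) <= cabs (x - y).
  case: Sw => t /andP[t0 t1] ->; rewrite addrAC subrr add0r cabsM cabs_real ger0_norm // (cabsB x).
  by rewrite ler_piMl // cabs_ge0.
have h2 : cabs (f w - w) = `|rho - cabs w|.
  have -> : f w - w = (rho / cabs w - 1)%:C * w by rewrite /f rmorphB rmorph1; ring.
  rewrite cabsM cabs_real -{2}(ger0_norm (ltW hw)) -normrM mulrBl mul1r divfK ?gt_eqF //.
have h3 : `|rho - cabs w| <= cabs (w - x).
  rewrite ler_norml; have := cabs_subl x w; have := cabs_subl w x; rewrite (cabsB x) hx; lra.
by have := cabs_tri w (f w) x; lra.
Qed.

Lemma lconn_circle rho : 0 < rho -> lconn (fun z => cabs z = rho).
Proof.
move=> r0 P hP x y hx hy Px.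
have arc u v : cabs u = rho -> cabs v = rho -> v != - u -> P u -> P v.
  move=> hu hv huv; case: (circle_arc r0 hu hv huv) => A [cA Au Av hA].
  by apply: cA => //; apply: lconst_sub hP => z /hA [].
case: (eqVneq y (- x)) => [->|]; last by move/(arc x y hx hy); apply.
have x0 : x != 0 by rewrite -cabs_gt0 hx.
have ci : cabs ('i : C) = 1 by rewrite /cabs /= expr0n expr1n add0r sqrtr1.
have hix : cabs ('i * x) = rho by rewrite cabsM ci mul1r.
(* Antipodal points are joined in two steps, through a quarter turn of [x]. *)
apply: (arc ('i * x)); rewrite ?cabsN //.
  rewrite eqr_opp -{1}[x]mul1r (inj_eq (mulIf x0)).
  by apply/eqP => -[] /eqP; rewrite oner_eq0.
apply: (arc x) => //; rewrite -mulN1r (inj_eq (mulIf x0)).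
by apply/eqP => -[] _ /eqP; rewrite oppr0 oner_eq0.
Qed.

(* The Taylor remainder [P - P'(x) X] vanishes to second order at [x], so its
   Lipschitz constant near [x] is small compared with [|P'(x)|]. *)
Lemma poly_expand_near P x : (P^`()).[x] != 0 -> exists d k : R, [/\ 0 < d, 0 < k &
  forall y z, cabs (y - x) <= d -> cabs (z - x) <= d ->
    k * cabs (y - z) <= cabs (P.[y] - P.[z])].
Proof.
move=> dP; case: (poly_diff_quot P x) => S [PE hS]; case: (poly_diff_quot S x) => T [_ hT].
have Sx : S.[x] = (P^`()).[x].
  rewrite [in RHS]PE derivD derivC addr0 derivM derivB derivX derivC subr0 mulr1.
  by rewrite hornerD hornerM hornerXsubC subrr mulr0 add0r.
have [B B0 hB] := poly_bound T (cabs x + 1).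
pose k := cabs S.[x]; have k0 : 0 < k by rewrite /k Sx cabs_gt0.
pose E := P - S.[x] *: 'X - (P.[x] - S.[x] * x)%:P.
have EE z : E.[z] = P.[z] - S.[x] * z - (P.[x] - S.[x] * x).
  by rewrite /E !(hornerD, hornerN, hornerZ, hornerX, hornerC).
have hE z : E.[z] = T.[z] * (z - x) ^+ 2.
  have h1 := hS z; have h2 := hT z; rewrite EE.
  have -> : P.[z] = P.[x] + S.[z] * (z - x) by rewrite -h1; ring.
  have -> : S.[z] = S.[x] + T.[z] * (z - x) by rewrite -h2; ring.
  by ring.
(* The 8 makes the Lipschitz constant [4 * B * d] of the remainder [E] at most [k / 2], which leaves
   half of the expansion [k]. *)
pose d := Num.min 1 (k / (8 * (B + 1))).
have d0 : 0 < d by rewrite lt_min ltr01 divr_gt0 //; lra.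
have d1 : d <= 1 by rewrite ge_min lexx.
have d2 : 8 * (B + 1) * d <= k.
  by rewrite -ler_pdivlMl ?ge_min ?(mulrC _^-1) ?lexx ?orbT //; lra.
have bE z : cabs (z - x) <= d -> cabs E.[z] <= B * d ^+ 2.
  move=> hz; rewrite hE cabsM cabsX; apply: ler_pM; rewrite ?exprn_ge0 ?cabs_ge0 //.
    by apply: hB; have := cabs_subl z x; lra.
  by rewrite lerXn2r ?nnegrE ?cabs_ge0 // ltW.
exists (d / 4), (k / 2); split; [lra | lra |] => y z hy hz.
have := poly_lip_of_bound d0 bE hy hz.
have -> : 4 * (B * d ^+ 2) / d = 4 * B * d by field; rewrite gt_eqF.
have -> : E.[y] - E.[z] = (P.[y] - P.[z]) - S.[x] * (y - z) by rewrite !EE; ring.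
have := cabs_subl (S.[x] * (y - z)) (P.[y] - P.[z]); rewrite cabsM -/k (cabsB (S.[x] * _)).
have := cabs_ge0 (y - z); move: (cabs (y - z)) (cabs _) (cabs _) => u v w.
clearbody d k; nra.
Qed.

End LevelSets.

(** * Level curves of a convergent sequence of polynomials *)

Section LevelSetLimits.
Local Open Scope complex_scope.
Variable R : realType.
Local Notation C := R[i].
Implicit Types (q : {poly C}) (x y z w : C).

Variables (P : {poly C}) (Q : nat -> {poly C}) (rho B : R).
Hypothesis rho0 : 0 < rho.
Hypothesis sP : (1 < size P)%N.
Hypothesis sQ : forall n, size (Q n) = size P.
Hypothesis lQ : forall n, lead_coef (Q n) = lead_coef P.
Hypothesis bQ : forall n z, cabs (Q n).[z] = rho -> cabs z <= B.
Hypothesis cvQ : forall b e : R, 0 < e ->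
  uev (fun n => forall z, cabs z <= b -> cabs ((Q n).[z] - P.[z]) < e).

Lemma Ulim_level z :
  Ulim (fun n z => cabs (Q n).[z] = rho) z <-> cabs P.[z] = rho.
Proof.
split=> h.
  suff h0 (e : R) : 0 < e -> `|cabs P.[z] - rho| < e.
    apply/eqP; rewrite -subr_eq0 -normr_eq0 eq_le normr_ge0 andbT leNgt.
    by apply/negP => /h0; rewrite ltxx.
  move=> e0; have e2 : 0 < e / 2 by lra.
  case: (poly_cont P z e2) => d d0 hd.
  have [n [[y hy1 hy2] k]] := uev_ex (uev_and (h d d0) (cvQ B e2)).
  have h1 := hd y hy2; have h2 := k y (bQ hy1).
  have h3 : cabs (P.[z] - (Q n).[y]) < e.
    apply: le_lt_trans (cabs_tri P.[y] _ _) _; rewrite (cabsB P.[y]); lra.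
  rewrite ltr_norml -hy1.
  have := cabs_subl P.[z] (Q n).[y]; have := cabs_subl (Q n).[y] P.[z].
  by rewrite (cabsB _ P.[z]); lra.
move=> e e0.
case: (@pow_small _ _ e (size P).-1 (lead_gt0 sP) e0); first exact: deg_gt0.
move=> d d0 hd; apply: uev_mono (cvQ (cabs z) d0) => n /(_ z (lexx _)) hn.
case: (@preimage_near _ (Q n) z P.[z]); first by rewrite sQ.
move=> r hr; rewrite sQ lQ => hle; exists r; first by rewrite hr.
by apply: (hd _ _ _ hn hle); apply: cabs_ge0.
Qed.

Lemma lconn_level_lim : uev (fun n => lconn (fun z => cabs (Q n).[z] = rho)) ->
  lconn (fun z => cabs P.[z] = rho).
Proof.
move=> h; apply: lconn_eq Ulim_level _.
by apply: lconn_Ulim (B) _ h; apply: uevT => n z; apply: bQ.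
Qed.

(** If the curves of [Q n] split for many [n], both pieces accumulate at one point [x] of the limit
    curve, where [P] is regular. Near [x] the maps [Q n] are injective, and lifting a short arc of
    the circle joins the two pieces. *)
Lemma lconn_level_near : (forall z, cabs P.[z] = rho -> (P^`()).[z] != 0) ->
  lconn (fun z => cabs P.[z] = rho) -> uev (fun n => lconn (fun z => cabs (Q n).[z] = rho)).
Proof.
move=> ncrit cP; apply: contrapT => /uevN hn.
pose A n z := cabs (Q n).[z] = rho.
have [S hS] : {S : nat -> C -> Prop & forall n, ~ lconn (A n) ->
    [/\ lconst (A n) (S n), exists2 y, A n y & S n y & exists2 y, A n y & ~ S n y]}.
  apply: (@choice _ _ (fun n S => ~ lconn (A n) ->
    [/\ lconst (A n) S, exists2 y, A n y & S y & exists2 y, A n y & ~ S y])) => n.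
  case: (pselect (lconn (A n))) => [h|h]; first by exists (fun _ => True).
  apply: contrapT => h2; apply: h => S hS x y Ax Ay Sx.
  apply: contrapT => nSy; apply: h2; exists S => _.
  by split=> //; [exists x | exists y].
have {}hS : uev (fun n => [/\ lconst (A n) (S n), exists2 y, A n y & S n y & exists2 y, A n y & ~ S n y]).
  by apply: uev_mono hn => n /hS.
have cL : lconn (Ulim A) by apply: lconn_eq cP => z; split=> /Ulim_level.
have [x [Xx Yx]] : exists x, Ulim (fun n y => A n y /\ S n y) x /\ Ulim (fun n y => A n y /\ ~ S n y) x.
  apply: (@Ulim_split _ _ _ B) => //; first by apply: uevT => n z; apply: bQ.
    by apply: uev_mono hS => n [].
  by apply: uev_mono hS => n [].
have Px : cabs P.[x] = rho.
  by apply/Ulim_level => e e0; apply: uev_mono (Xx e e0) => n [y [Ay _]]; exists y.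
have [d [k [d0 k0 hdk]]] := poly_expand_near (ncrit x Px).
have injQ : uev (fun n => forall y z, cabs (y - x) <= d -> cabs (z - x) <= d ->
    k / 2 * cabs (y - z) <= cabs ((Q n).[y] - (Q n).[z])).
  (* This implies the bound [k / 2 * d] on the disc of radius [4 * d], which gives [Q n - P] the
     Lipschitz constant [k / 2] on the disc of radius [d]: the expansion [k] of [P] is halved at
     worst. *)
  have e0 : 0 < k / 2 * d / 4 by rewrite !mulr_gt0 ?invr_gt0.
  apply: uev_mono (cvQ (cabs x + 4 * d) e0) => n hQ y z hy hz.
  have d4 : 0 < 4 * d by lra.
  have hb w : cabs (w - x) <= 4 * d -> cabs (Q n - P).[w] <= k / 2 * d / 4 * 4.
    move=> hw; rewrite hornerD hornerN; apply: le_trans (ltW (hQ w _)) _.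
      by have := cabs_subl w x; lra.
    lra.
  have hd4 : 4 * d / 4 = d by lra.
  have := poly_lip_of_bound d4 hb; rewrite hd4 => /(_ y z hy hz).
  rewrite !hornerD !hornerN.
  have -> : 4 * (k / 2 * d / 4 * 4) / (4 * d) = k / 2 by field; rewrite gt_eqF.
  have -> : (Q n).[y] - P.[y] - ((Q n).[z] - P.[z]) = ((Q n).[y] - (Q n).[z]) - (P.[y] - P.[z]) by ring.
  have := hdk y z hy hz; have := cabs_subl (P.[y] - P.[z]) ((Q n).[y] - (Q n).[z]).
  rewrite (cabsB (P.[y] - _)); lra.
have d2 : 0 < d / 2 by lra.
case: (@pow_small _ _ (d / 2) (size P).-1 (lead_gt0 sP) d2); first exact: deg_gt0.
move=> eta eta0 heta.
(* [m <= rho] keeps the two values from being antipodal; [m <= eta / 2] keeps the joining arc, which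
   stays within [2 * m] of [(Q n).[a]], in the range that lifts to within [d / 2] of [a]. *)
have [m [m0 m1 m2]] := pos_below rho0 (divr_gt0 eta0 (ltr0n _ 2)).
have m4 : 0 < m / 4 by lra.
have [e e0 he] := poly_cont P x m4.
have [e' [e'0 e1 e2]] := pos_below e0 d2.
have [n [[[[hSn _ _] hinj] [[a [Aa Sa] ha] [b [Ab Sb] hb]]] hcv]] :=
  uev_ex (uev_and (uev_and (uev_and hS injQ) (uev_and (Xx e' e'0) (Yx e' e'0))) (cvQ B m4)).
have hab : cabs ((Q n).[a] - (Q n).[b]) < m.
  have h1 := hcv a (bQ Aa); have h2 := hcv b (bQ Ab).
  have h3 := he a (lt_le_trans ha e1); have h4 := he b (lt_le_trans hb e1).
  have := cabs_tri P.[a] (Q n).[a] (Q n).[b]; have := cabs_tri P.[b] P.[a] (Q n).[b].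
  have := cabs_tri P.[x] P.[a] P.[b]; rewrite (cabsB P.[a] P.[x]) (cabsB P.[b] (Q n).[b]); lra.
have hne : (Q n).[b] != - (Q n).[a].
  apply/eqP => h; move: hab; rewrite h opprK -mulr2n -[_ *+ 2]mulr_natl cabsM Aa (cabs_nat R 2); lra.
have [G [cG Ga Gb hG]] := circle_arc rho0 Aa Ab hne.
(* [T] carries [S n] over to the arc along the unique lift near [x]. *)
pose T w := exists r, [/\ cabs (r - x) <= d, (Q n).[r] = w & S n r].
have uniq r s : cabs (r - x) <= d -> cabs (s - x) <= d -> (Q n).[r] = (Q n).[s] -> r = s.
  move=> hr hs hrs; have := hinj r s hr hs; rewrite hrs subrr cabs0 => h.
  apply/eqP; rewrite -subr_eq0 -cabs_eq0 eq_le cabs_ge0 andbT.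
  by have := cabs_ge0 (r - s); nra.
have pre w : G w -> exists2 r, cabs (r - x) <= d & (Q n).[r] = w.
  move=> /hG [_ hw]; case: (@preimage_near _ (Q n) a w); first by rewrite sQ.
  move=> r hr; rewrite sQ lQ => hle; exists r => //.
  have h1 : cabs (a - r) < d / 2.
    apply: (heta _ _ (cabs_ge0 _) _ hle); rewrite cabsB; lra.
  have := cabs_tri a r x; rewrite (cabsB r a) (cabsB a x); lra.
have hT : lconst G T.
  move=> w Gw; case: (pre w Gw) => r hr hrw.
  have Ar : A n r by rewrite /A hrw; case: (hG w Gw).
  have [t t0 ht] := hSn r Ar.
  exists (k / 2 * t); first by rewrite mulr_gt0 // divr_gt0.
  move=> v Gv hwv; case: (pre v Gv) => s hs hsv.
  have As : A n s by rewrite /A hsv; case: (hG v Gv).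
  have hrs : cabs (r - s) < t.
    have := hinj r s hr hs; rewrite hrw hsv => h.
    by have := le_lt_trans h hwv; rewrite ltr_pM2l // divr_gt0.
  have TS u p : cabs (p - x) <= d -> (Q n).[p] = u -> T u <-> S n p.
    move=> hp hpu; split=> [[p' [hp' hpu' Sp']]|Sp]; last by exists p.
    by rewrite (uniq p p') // hpu hpu'.
  by rewrite (TS w r hr hrw) (TS v s hs hsv); apply: ht.
have hxa : cabs (a - x) <= d by rewrite cabsB; lra.
have hxb : cabs (b - x) <= d by rewrite cabsB; lra.
have [|r [hr hrb Sr]] := cG T hT _ _ Ga Gb; first by exists a.
by apply: Sb; rewrite -(uniq r b).
Qed.

End LevelSetLimits.

(** * Level curves above all critical values are connected *)

Section ConnectedLevelSets.
Local Open Scope complex_scope.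
Variable R : realType.
Local Notation C := R[i].
Implicit Types (q : {poly C}) (x y z w : C).

(* [t^n q(z/t)] with [n = deg q]: it joins the leading monomial of [q] at
   [t = 0] to [q] at [t = 1], and scales the critical values by [t^n]. *)
Definition dilate q (t : R) : {poly C} :=
  \poly_(k < size q) (q`_k * t%:C ^+ ((size q).-1 - k)).

Lemma lead_dilate q (t : R) : (0 < size q)%N ->
  q`_(size q).-1 * t%:C ^+ ((size q).-1 - (size q).-1) = lead_coef q.
Proof. by rewrite subnn expr0 mulr1. Qed.

Lemma size_dilate q (t : R) : (0 < size q)%N -> size (dilate q t) = size q.
Proof.
move=> sq; apply: size_poly_eq.
by rewrite lead_dilate // lead_coef_eq0 -size_poly_gt0.
Qed.

Lemma lead_coef_dilate q (t : R) : (0 < size q)%N -> lead_coef (dilate q t) = lead_coef q.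
Proof.
move=> sq; rewrite lead_coef_poly // ?lead_dilate //.
by rewrite lead_coef_eq0 -size_poly_gt0.
Qed.

Lemma horner_dilate q (t : R) z : (dilate q t).[z] =
  \sum_(k < size q) q`_k * t%:C ^+ ((size q).-1 - k) * z ^+ k.
Proof. exact: horner_poly. Qed.

Lemma dilate1 q : dilate q 1 = q.
Proof.
apply/polyP => k; rewrite coef_poly rmorph1 expr1n mulr1.
by case: ltnP => // h; rewrite nth_default.
Qed.

Lemma horner_dilate_scale q (t : R) z : t != 0 ->
  (dilate q t).[z] = t%:C ^+ (size q).-1 * q.[z / t%:C].
Proof.
move=> t0; have tC : t%:C != 0 by rewrite fmorph_eq0.
rewrite horner_dilate horner_coef mulr_sumr; apply: eq_bigr => k _.
have hk : (k <= (size q).-1)%N by rewrite -ltnS prednK // (leq_ltn_trans _ (ltn_ord k)).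
have -> : t%:C ^+ (size q).-1 = t%:C ^+ ((size q).-1 - k) * t%:C ^+ k by rewrite -exprD subnK.
rewrite expr_div_n; have : t%:C ^+ k != 0 by rewrite expf_neq0.
by move: (_ ^+ _) (t%:C ^+ k) => u v v0; field.
Qed.

Lemma poly_funext q r : (forall z, q.[z] = r.[z]) -> q = r.
Proof.
move=> h; apply/eqP; rewrite -subr_eq0; apply/eqP.
have h0 z : (q - r).[z] = 0 by rewrite hornerD hornerN h subrr.
case: (ltnP 1 (size (q - r))) => sq.
  by case: (poly_surj 1 sq) => z; rewrite h0 => /esym/eqP; rewrite oner_eq0.
by move: (h0 0); rewrite (size1_polyC sq) hornerC => ->.
Qed.

Lemma dilate_comp q (t : R) : t != 0 ->
  dilate q t = t%:C ^+ (size q).-1 *: (q \Po (t%:C^-1 *: 'X)).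
Proof.
move=> t0; apply: poly_funext => z.
by rewrite horner_dilate_scale // hornerZ horner_comp hornerZ hornerX mulrC [z / _]mulrC mulrC.
Qed.

Lemma dilate0 q : (0 < size q)%N -> dilate q 0 = lead_coef q *: 'X^((size q).-1).
Proof.
move=> sq; apply/polyP => k; rewrite coef_poly coefZ coefXn.
case: (ltngtP k (size q).-1) => hk.
- have -> : (k < size q)%N by rewrite (ltn_trans hk) // prednK.
  by rewrite rmorph0 expr0n subn_eq0 leqNgt hk /= mulr0 mulr0.
- have -> : (k < size q)%N = false by apply/negbTE; rewrite -leqNgt -(prednK sq).
  by rewrite mulr0.
by rewrite hk prednK // leqnn subnn expr0 !mulr1.
Qed.

(** The leading term does not depend on [t], and for [t <= 1] the other coefficients are at most
    those of [q] in modulus. *)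
Lemma dilate_bounded q (rho : R) : 0 < rho -> (1 < size q)%N ->
  exists B : R, forall t z, 0 <= t <= 1 -> cabs (dilate q t).[z] = rho -> cabs z <= B.
Proof.
move=> r0 sq; have l0 := lead_gt0 sq.
case sqE : (size q) (sq) => [|[|n]] // _.
have lE : lead_coef q = q`_n.+1 by rewrite lead_coefE sqE.
pose A := \sum_(k < n.+1) cabs q`_k.
have A0 : 0 <= A by apply: sumr_ge0 => k _; apply: cabs_ge0.
have AB : 0 <= (rho + A) / cabs (lead_coef q) by rewrite divr_ge0 // ?ltW //; lra.
exists (1 + (rho + A) / cabs (lead_coef q)) => t z /andP[t0 t1] hz.
rewrite leNgt; apply/negP => hlt.
have z1 : 1 <= cabs z by move: AB hlt; move: (_ / _) => u; lra.
move: hz; rewrite horner_dilate sqE big_ord_recr /= subnn expr0 mulr1 -lE => hz.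
have h1 : cabs (\sum_(k < n.+1) q`_k * t%:C ^+ (n.+1 - k) * z ^+ k) <= A * cabs z ^+ n.
  apply: le_trans (cabs_sum _ _) _; rewrite /A mulr_suml; apply: ler_sum => k _.
  rewrite !cabsM !cabsX cabs_real ger0_norm //.
  apply: ler_pM; rewrite ?mulr_ge0 ?exprn_ge0 ?cabs_ge0 //.
    by rewrite ler_piMr ?cabs_ge0 // exprn_ile1.
  by rewrite ler_weXn2l // -ltnS.
have h2 := cabs_subl (lead_coef q * z ^+ n.+1) (- \sum_(k < n.+1) q`_k * t%:C ^+ (n.+1 - k) * z ^+ k).
rewrite opprK cabsN [_ + \sum_(_ < _) _]addrC hz cabsM cabsX exprS in h2.
have h3 : 1 <= cabs z ^+ n by rewrite exprn_ege1.
have h4 : cabs (lead_coef q) * cabs z > rho + A.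
  rewrite mulrC -ltr_pdivrMr //; move: hlt; move: (_ / _) => u; lra.
move: h1 h2; move: (cabs (\sum_(_ < _) _)) => u h1 h2.
have h5 : (cabs (lead_coef q) * cabs z) * cabs z ^+ n <= rho + A * cabs z ^+ n by rewrite -mulrA; lra.
have h6 : (rho + A) * cabs z ^+ n < cabs (lead_coef q) * cabs z * cabs z ^+ n.
  by rewrite ltr_pM2r //; lra.
move: h3 h5 h6; move: (cabs z ^+ n) (_ * cabs z) => v w; nra.
Qed.

Lemma expr_lip (t s : R) m : 0 <= t <= 1 -> 0 <= s <= 1 -> `|t ^+ m - s ^+ m| <= m%:R * `|t - s|.
Proof.
move=> /andP[t0 t1] /andP[s0 s1]; elim: m => [|m IH]; first by rewrite !expr0 subrr normr0 mul0r.
have -> : t ^+ m.+1 - s ^+ m.+1 = t * (t ^+ m - s ^+ m) + (t - s) * s ^+ m by rewrite !exprS; ring.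
apply: le_trans (ler_normD _ _) _; rewrite !normrM -natr1 mulrDl mul1r.
apply: lerD; first by rewrite ger0_norm //; apply: le_trans IH; rewrite ler_piMl.
by rewrite ler_piMr // normrX ger0_norm // exprn_ile1.
Qed.

Lemma dilate_lip q (b : R) : exists2 K : R, 0 <= K & forall t s z,
  0 <= t <= 1 -> 0 <= s <= 1 -> cabs z <= b ->
  cabs ((dilate q t).[z] - (dilate q s).[z]) <= K * `|t - s|.
Proof.
exists (\sum_(k < size q) cabs q`_k * ((size q).-1 - k)%:R * `|b| ^+ k).
  by apply: sumr_ge0 => k _; rewrite !mulr_ge0 ?cabs_ge0 ?exprn_ge0.
move=> t s z ht hs hz; rewrite !horner_dilate -sumrB mulr_suml.
apply: le_trans (cabs_sum _ _) _; apply: ler_sum => k _.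
rewrite -mulrBl -mulrBr !cabsM cabsX -!rmorphXn -rmorphB cabs_real.
rewrite -mulrA [leRHS]mulrAC -[leRHS]mulrA -[leRHS]mulrA ler_wpM2l ?cabs_ge0 // mulrA.
apply: ler_pM; rewrite ?exprn_ge0 ?cabs_ge0 //; first exact: expr_lip.
by rewrite lerXn2r ?nnegrE ?cabs_ge0 //; apply: le_trans hz (ler_norm _).
Qed.

(** For nonzero [t] the critical values are those of [q] times a power of [t], still below [rho] in
    modulus; at [t = 0] only 0 can be critical, and it is off the curve. *)
Lemma dilate_ncrit q (rho t : R) z : 0 < rho -> (1 < size q)%N ->
  (forall c, (q^`()).[c] = 0 -> cabs q.[c] < rho) -> 0 <= t <= 1 ->
  cabs (dilate q t).[z] = rho -> ((dilate q t)^`()).[z] != 0.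
Proof.
move=> r0 sq hcrit /andP[t0 t1].
have [->|tn0] := eqVneq t 0.
  rewrite dilate0; last exact: ltnW.
  rewrite hornerZ hornerXn derivZ derivXn hornerZ hornerMn hornerXn cabsM cabsX => hz.
  have z0 : z != 0.
    apply/eqP => z0; move: hz; rewrite z0 cabs0 expr0n.
    by case: (size q) sq => [|[|m]] //= _; rewrite mulr0 => h; rewrite -h ltxx in r0.
  rewrite mulf_neq0 ?lead_coef_eq0 -?size_poly_gt0 1?ltnW // mulrn_eq0 negb_or expf_neq0 // andbT.
  by rewrite -lt0n deg_gt0.
move=> hz; apply/negP => /eqP; rewrite dilate_comp // derivZ deriv_comp derivZ derivX.
rewrite hornerZ hornerM horner_comp !hornerZ hornerX hornerC mulr1 => /eqP.
have tC : t%:C != 0 by rewrite fmorph_eq0.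
rewrite !mulf_eq0 (negbTE (expf_neq0 _ tC)) invr_eq0 (negbTE tC) /= orbF => /eqP h.
have := hcrit _ h; move: hz; rewrite horner_dilate_scale // cabsM cabsX cabs_real ger0_norm // mulrC.
rewrite [_^-1 * z]mulrC => hz; rewrite ltNge -hz ler_piMr ?cabs_ge0 // exprn_ile1 //.
Qed.

Lemma lconn_dilate0 q (rho : R) : 0 < rho -> (1 < size q)%N ->
  lconn (fun z => cabs (dilate q 0).[z] = rho).
Proof.
move=> r0 sq; have l0 := lead_gt0 sq.
have sX : (1 < size (dilate q 0))%N by rewrite size_dilate // ltnW.
case: (poly_surj rho%:C sX) => z0; rewrite dilate0; last exact: ltnW.
rewrite hornerZ hornerXn => /(congr1 (@cabs R)); rewrite cabs_real ger0_norm ?ltW // => h0.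
have n0 := deg_gt0 sq.
have z0r : 0 < cabs z0.
  rewrite cabs_gt0; apply/eqP => z00; move: h0.
  by rewrite z00 expr0n eqn0Ngt n0 mulr0 cabs0 => h; rewrite -h ltxx in r0.
apply: lconn_eq (lconn_circle z0r) => z; rewrite hornerZ hornerXn -h0 !cabsM !cabsX.
split=> [->//|/mulfI h]; have {}h := h (negbT (gt_eqF l0)).
by apply/eqP; rewrite -(@eqrXn2 _ (size q).-1) ?cabs_ge0 //; apply/eqP.
Qed.

(** Continuity method: the [t] for which the level curve of [dilate q t] is connected form an open
    set by [lconn_level_near], a closed one by [lconn_level_lim], and include 0, where the curve is
    a circle. *)
Theorem lconn_level q (rho : R) : 0 < rho -> (1 < size q)%N ->
  (forall c, (q^`()).[c] = 0 -> cabs q.[c] < rho) -> lconn (fun z => cabs q.[z] = rho).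
Proof.
move=> r0 sq hcrit.
pose good t := lconn (fun z => cabs (dilate q t).[z] = rho).
suff : good 1 by rewrite /good dilate1.
apply: (@real_lconst _ good); last exact: lconn_dilate0.
move=> t t01; apply: contrapT => hno.
have hex n : exists s, [/\ 0 <= s <= 1, `|t - s| < n.+1%:R^-1 & ~ (good t <-> good s)].
  apply: contrapT => h; apply: hno; exists n.+1%:R^-1; first by rewrite invr_gt0 ltr0n.
  by move=> s s01 hs; apply: contrapT => h2; apply: h; exists s.
have [s hs] := choice hex.
have [B hB] := dilate_bounded r0 sq.
have sq0 := ltnW sq.
have s1 : (1 < size (dilate q t))%N by rewrite size_dilate.
have s2 n : size (dilate q (s n)) = size (dilate q t) by rewrite !size_dilate.
have s3 n : lead_coef (dilate q (s n)) = lead_coef (dilate q t) by rewrite !lead_coef_dilate.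
have s4 n z : cabs (dilate q (s n)).[z] = rho -> cabs z <= B by apply: hB; case: (hs n).
have s5 (b e : R) : 0 < e -> uev (fun n => forall z, cabs z <= b ->
    cabs ((dilate q (s n)).[z] - (dilate q t).[z]) < e).
  move=> e0; have [K K0 hK] := dilate_lip q b.
  have e1 : 0 < e / (K + 1) by rewrite divr_gt0 //; lra.
  apply: uev_mono (uev_invn e1) => n hn z hz; case: (hs n) => s01 hts _.
  apply: le_lt_trans (hK _ _ _ s01 t01 hz) _; rewrite distrC.
  have := lt_trans hts hn; rewrite ltr_pdivlMr; last by lra.
  have := normr_ge0 (t - s n); nra.
have [hg|hg] : uev (fun n => good (s n)) \/ uev (fun n => ~ good (s n)).
  by case: (pselect (uev (fun n => good (s n)))) => h; [left | right; apply: uevN].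
- have gt := lconn_level_lim s1 s2 s3 s4 s5 hg.
  have [n gn] := uev_ex hg; have [_ _ []] := hs n.
  by split=> _; [exact: gn | exact: gt].
case: (pselect (good t)) => gt.
  have := lconn_level_near r0 s1 s2 s3 s4 s5 (fun z => dilate_ncrit r0 sq hcrit t01) gt.
  by move=> h; have [n [k1 k2]] := uev_ex (uev_and h hg).
have [n gn] := uev_ex hg; have [_ _ []] := hs n.
by split=> h; [case: (gt h) | case: (gn h)].
Qed.

End ConnectedLevelSets.

(** * Harnack's inequality for polynomials without zeros in a disc *)

Section Harnack.
Local Open Scope complex_scope.
Variable R : realType.
Local Notation C := R[i].
Implicit Types (q : {poly C}) (z w : C).

Lemma expr_small (t e : R) : 0 <= t < 1 -> 0 < e -> exists N, t ^+ N <= e.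
Proof.
move=> /andP[t0 t1] e0; have [->|tn0] := eqVneq t 0; first by exists 1%N; rewrite expr0n ltW.
have tp : 0 < t by rewrite lt_neqAle eq_sym tn0.
pose h := t^-1 - 1; have h0 : 0 < h by rewrite subr_gt0 invf_gt1.
have hb N : N%:R * h <= t^-1 ^+ N.
  elim: N => [|N IH]; first by rewrite mul0r ler01.
  have -> : t^-1 = 1 + h by rewrite /h; ring.
  have h1 : 1 <= (1 + h) ^+ N by rewrite exprn_ege1 // lerDl ltW.
  rewrite exprS -natr1; have : t^-1 = 1 + h by rewrite /h; ring.
  move=> hh; rewrite hh in IH; clearbody h; nra.
exists (Num.truncn (e * h)^-1).+1.
have := truncnS_gt (e * h)^-1; set N := (Num.truncn _).+1 => hN.
rewrite -[t]invrK exprVn -[e]invrK lef_pV2 ?posrE ?invr_gt0 ?exprn_gt0 ?invr_gt0 //.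
apply: le_trans (hb N); rewrite -ler_pdivrMr // -invfM; exact: ltW.
Qed.

Lemma expr_diff_le (a b : C) (B : R) m : cabs a <= B -> cabs b <= B ->
  cabs (a ^+ m - b ^+ m) <= m%:R * B ^+ m.-1 * cabs (a - b).
Proof.
move=> ha hb; have B0 : 0 <= B by apply: le_trans ha; apply: cabs_ge0.
elim: m => [|m IH]; first by rewrite !expr0 subrr cabs0 !mul0r.
have -> : a ^+ m.+1 - b ^+ m.+1 = a * (a ^+ m - b ^+ m) + (a - b) * b ^+ m by rewrite !exprS; ring.
apply: le_trans (cabsD _ _) _; rewrite !cabsM cabsX -natr1 !mulrDl mul1r; apply: lerD.
  case: m IH => [|m] IH; first by rewrite !expr0 subrr cabs0 mulr0 !mul0r.
  have -> : m.+1%:R * B ^+ m.+2.-1 * cabs (a - b) = B * (m.+1%:R * B ^+ m * cabs (a - b)).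
    by rewrite /= exprS; ring.
  by apply: ler_pM; rewrite ?cabs_ge0.
rewrite mulrC ler_wpM2r ?cabs_ge0 // lerXn2r ?nnegrE ?cabs_ge0 //.
Qed.

Variables (c : C) (rho : R).
Hypothesis rho0 : 0 < rho.
Let D z := cabs (z - c) <= rho.

Let Dbound q : exists2 K : R, 0 <= K & forall z, D z -> cabs q.[z] <= K.
Proof.
have [K K0 hK] := poly_bound q (rho + cabs c); exists K => // z; rewrite /D => hz; apply: hK.
by have := cabs_subl z c; lra.
Qed.

(** Up to a constant, a linear factor with root off the disc is [1 - u] with [u] of modulus at most
    [t < 1], where power series in [u] converge. *)
Let scaled r : ~ D r -> exists (u : {poly C}) (t : R), [/\ 0 <= t < 1,
  (forall z, D z -> cabs u.[z] <= t), r - c != 0 & forall z, z - r = (c - r) * (1 - u.[z])].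
Proof.
rewrite /D => /negP; rewrite -ltNge => hr.
have r0 : r - c != 0 by rewrite -cabs_gt0; apply: lt_trans hr.
have cr : 0 < cabs (r - c) by rewrite cabs_gt0.
have hu z : ((r - c)^-1 *: ('X - c%:P)).[z] = (r - c)^-1 * (z - c).
  by rewrite hornerZ hornerXsubC.
exists ((r - c)^-1 *: ('X - c%:P)), (rho / cabs (r - c)); split=> //.
- by rewrite divr_ge0 ?ltW //= ltr_pdivrMr // mul1r.
- by move=> z hz; rewrite hu cabsM cabsV mulrC ler_wpM2r // invr_ge0 ltW.
- by move=> z; rewrite hu; field.
Qed.

(** Root by root: a truncated geometric series in [u] inverts the linear factor. *)
Lemma inv_approx q : (forall z, D z -> q.[z] != 0) -> forall e : R, 0 < e ->
  exists T : {poly C}, forall z, D z -> cabs (T.[z] * q.[z] - 1) <= e.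
Proof.
case: (poly_factors q) => rs [-> _]; move: (lead_coef q) => l; elim: rs => [|r rs IH] hq e e0.
  have l0 : l != 0.
    by have := hq c; rewrite /D subrr cabs0 ltW // horner_factors big_nil mulr1; apply.
  exists (l^-1)%:P => z _; rewrite horner_factors big_nil hornerC mulr1 mulVf // subrr cabs0 ltW //.
have hq1 z : D z -> (l *: \prod_(w <- rs) ('X - w%:P)).[z] != 0 /\ z - r != 0.
  by move=> /hq; rewrite !horner_factors big_cons mulrCA mulf_eq0 negb_or andbC => /andP[].
have nDr : ~ D r by move=> /hq1 []; rewrite subrr eqxx.
have [u [t [ht hu rc0 hzr]]] := scaled nDr.
have hgeo N : exists S : {poly C}, forall z, S.[z] * (z - r) = 1 - u.[z] ^+ N.
  elim: N => [|N [S hS]]; first by exists 0 => z; rewrite horner0 mul0r expr0 subrr.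
  have cr0 : c - r != 0 by rewrite -opprB oppr_eq0.
  exists (S + (c - r)^-1 *: u ^+ N) => z.
  rewrite hornerD hornerZ horner_exp mulrDl hS (hzr z) exprS.
  have -> : (c - r)^-1 * u.[z] ^+ N * ((c - r) * (1 - u.[z])) = u.[z] ^+ N * (1 - u.[z]) by field.
  ring.
have [d [d0 d1 de]] := pos_below ltr01 (divr_gt0 e0 (ltr0n _ 3)).
have [T hT] := IH (fun z Dz => (hq1 z Dz).1) d d0.
have [N hN] := expr_small ht d0.
have [S hS] := hgeo N; exists (S * T) => z Dz.
rewrite hornerM horner_factors big_cons; have := hT z Dz; rewrite horner_factors.
move: (\prod_(_ <- _) _) => p hp.
have -> : S.[z] * T.[z] * (l * ((z - r) * p)) - 1 =
  (T.[z] * (l * p) - 1) * (S.[z] * (z - r)) + (S.[z] * (z - r) - 1) by ring.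
rewrite hS; have hk : cabs (u.[z] ^+ N) <= d.
  rewrite cabsX; apply: le_trans hN; rewrite lerXn2r ?nnegrE ?cabs_ge0 ?hu //.
  by case/andP: ht.
have -> : 1 - u.[z] ^+ N - 1 = - u.[z] ^+ N by ring.
apply: le_trans (cabsD _ _) _; rewrite cabsN cabsM.
have h2 : cabs (1 - u.[z] ^+ N) <= 2 by apply: le_trans (cabsD _ _) _; rewrite cabsN cabs1; lra.
have := cabs_ge0 (1 - u.[z] ^+ N); have := cabs_ge0 (T.[z] * (l * p) - 1).
move: (cabs _) (cabs _) (cabs _) hp h2 hk => x1 x2 x3; nra.
Qed.

Lemma sqrt_approx q : (forall z, D z -> q.[z] != 0) -> forall e : R, 0 < e ->
  exists S : {poly C}, forall z, D z -> cabs (S.[z] ^+ 2 - q.[z]) <= e.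
Proof.
case: (poly_factors q) => rs [-> _]; move: (lead_coef q) => l; elim: rs => [|r rs IH] hq e e0.
  exists (sqrtc l)%:P => z _.
  by rewrite horner_factors big_nil hornerC mulr1 sqr_sqrtc subrr cabs0 ltW.
have hq1 z : D z -> (l *: \prod_(w <- rs) ('X - w%:P)).[z] != 0 /\ z - r != 0.
  by move=> /hq; rewrite !horner_factors big_cons mulrCA mulf_eq0 negb_or andbC => /andP[].
have nDr : ~ D r by move=> /hq1 []; rewrite subrr eqxx.
have [u [t [/andP[t0 t1] hu rc0 hzr]]] := scaled nDr.
(* the fixed point [E = 1 - sqrt (1 - u)] of [E |-> (u + E^2) / 2] *)
have hiter N : exists E F : {poly C}, forall z, D z ->
    [/\ cabs E.[z] <= t, cabs F.[z] <= t, cabs (F.[z] - E.[z]) <= t ^+ N.+1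
      & F.[z] = (u.[z] + E.[z] ^+ 2) / 2].
  elim: N => [|N [E [F h]]].
    exists 0, ((2^-1)%:P * u) => z Dz; rewrite horner0 hornerM hornerC subr0 expr1.
    have h2 : cabs (2^-1 * u.[z]) <= t.
      rewrite cabsM cabsV (cabs_nat R 2); have := hu z Dz; have := cabs_ge0 u.[z]; lra.
    by rewrite cabs0; split=> //; rewrite expr0n addr0 mulrC.
  exists F, ((2^-1)%:P * (u + F ^+ 2)) => z Dz; case: (h z Dz) => h1 h2 h3 h4.
  rewrite hornerM hornerC hornerD horner_exp.
  split=> //.
  - rewrite cabsM cabsV (cabs_nat R 2).
    have h5 : cabs (u.[z] + F.[z] ^+ 2) <= t + t * t.
      apply: le_trans (cabsD _ _) _; rewrite cabsX expr2; apply: lerD; first exact: hu.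
      by apply: ler_pM; rewrite ?cabs_ge0.
    nra.
  - have -> : 2^-1 * (u.[z] + F.[z] ^+ 2) - F.[z] = (F.[z] - E.[z]) * ((F.[z] + E.[z]) / 2).
      by rewrite [X in _ - X]h4; field.
    rewrite cabsM exprSr; apply: ler_pM; rewrite ?cabs_ge0 //.
    rewrite cabs_div (cabs_nat R 2); have := cabsD F.[z] E.[z]; lra.
  - by rewrite mulrC.
have [K K0 hK] := Dbound (l *: \prod_(w <- rs) ('X - w%:P)).
have [A A0 hA] := Dbound ('X - r%:P).
(* The two error terms at the end are at most [d * A] and [(K + 1) * d]. *)
have AK : 0 < A + K + 2 by lra.
have [d [hd0 hd1]] := pos_below ltr01 (divr_gt0 e0 AK); rewrite ler_pdivlMr // => hd2.
have [S hS] := IH (fun z Dz => (hq1 z Dz).1) d hd0.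
pose b := cabs (c - r); have b0 : 0 <= b by apply: cabs_ge0.
have e1 : 0 < d / (2 * b + 1) by rewrite divr_gt0 //; lra.
have [N hN] : exists N, t ^+ N <= d / (2 * b + 1) by apply: expr_small e1; rewrite t0.
have [E [F hEF]] := hiter N.
exists (S * ((sqrtc (c - r))%:P * (1 - E))) => z Dz.
case: (hEF z Dz) => h1 h2 h3 h4.
rewrite horner_factors big_cons; have := hS z Dz; have := hK z Dz; rewrite horner_factors.
move: (\prod_(_ <- _) _) => p hp1 hp2.
have := hA z Dz; rewrite hornerXsubC => hzA.
rewrite !hornerM hornerD hornerN !hornerC.
have -> : (S.[z] * (sqrtc (c - r) * (1 - E.[z]))) ^+ 2 =
  S.[z] ^+ 2 * (sqrtc (c - r) ^+ 2 * (1 - E.[z]) ^+ 2) by ring.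
rewrite sqr_sqrtc.
have -> : (c - r) * (1 - E.[z]) ^+ 2 = (z - r) + 2 * (c - r) * (F.[z] - E.[z]).
  by rewrite (hzr z) h4; field.
have -> : S.[z] ^+ 2 * (z - r + 2 * (c - r) * (F.[z] - E.[z])) - l * ((z - r) * p) =
  (S.[z] ^+ 2 - l * p) * (z - r) + S.[z] ^+ 2 * (2 * (c - r) * (F.[z] - E.[z])) by ring.
apply: le_trans (cabsD _ _) _.
rewrite (cabsM (S.[z] ^+ 2 - l * p)) (cabsM (S.[z] ^+ 2)) (cabsM (2 * (c - r))) (cabsM 2) (cabs_nat R 2) -/b.
have h5 : cabs (F.[z] - E.[z]) * (2 * b + 1) <= d.
  rewrite -ler_pdivlMr; last lra.
  apply: le_trans h3 (le_trans _ hN); rewrite exprS ler_piMl ?exprn_ge0 // ltW //.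
have h6 : cabs (S.[z] ^+ 2) <= K + 1.
  have := cabs_subl (S.[z] ^+ 2) (l * p); lra.
have n1 := cabs_ge0 (F.[z] - E.[z]); have n2 := cabs_ge0 (S.[z] ^+ 2).
have n3 := cabs_ge0 (S.[z] ^+ 2 - l * p); have n4 := cabs_ge0 (z - r).
move: (cabs (F.[z] - _)) (cabs (_ ^+ 2)) (cabs (_ - l * p)) (cabs (z - r)) hp2 hzA h5 h6 n1 n2 n3 n4.
clearbody b; move=> x1 x2 x3 x4 g1 g2 g3 g4 n1 n2 n3 n4.
have k1 : x3 * x4 <= d * A by apply: ler_pM.
have k2 : x2 * (2 * b * x1) <= (K + 1) * d by apply: ler_pM => //; [rewrite !mulr_ge0 | nra].
lra.
Qed.

(** Iterated square roots. The lower bound 1 on [q] keeps a good enough approximate root free of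
    zeros, so that the next square root can be taken. *)
Lemma root_pow2_approx q k : (forall z, D z -> 1 <= cabs q.[z]) -> forall e : R, 0 < e ->
  exists T : {poly C}, forall z, D z -> cabs (T.[z] ^+ (2 ^ k) - q.[z]) <= e.
Proof.
move=> hq; elim: k => [|k IH] e e0.
  by exists q => z _; rewrite expn0 expr1 subrr cabs0 ltW.
have half0 : 0 < 2^-1 :> R by rewrite invr_gt0 ltr0n.
have [d [d0 d1 de]] := pos_below half0 (divr_gt0 e0 (ltr0n _ 2)).
have [T hT] := IH d d0.
have T0 z : D z -> T.[z] != 0.
  move=> Dz; apply/eqP => h; have := hT z Dz; have := hq z Dz.
  rewrite h expr0n expn_eq0 /= sub0r cabsN; lra.
have [K K0 hK] := Dbound T.
pose m := (2 ^ k)%N.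
have [L LE L0] : exists2 L : R, L = m%:R * (K + 1) ^+ m.-1 & 0 <= L.
  by exists (m%:R * (K + 1) ^+ m.-1); rewrite // mulr_ge0 // exprn_ge0 //; lra.
have L1 : 0 < L + 1 by lra.
have [f [f0 f1]] := pos_below ltr01 (divr_gt0 d0 L1); rewrite ler_pdivlMr // => fd.
have [S hS] := sqrt_approx T0 f0; exists S => z Dz.
rewrite expnS exprM.
have h1 : cabs (S.[z] ^+ 2) <= K + 1.
  by have := cabs_subl (S.[z] ^+ 2) T.[z]; have := hS z Dz; have := hK z Dz; lra.
have h2 : cabs T.[z] <= K + 1 by have := hK z Dz; lra.
have := expr_diff_le m h1 h2; rewrite -LE => h3.
have := cabs_tri (T.[z] ^+ m) ((S.[z] ^+ 2) ^+ m) q.[z].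
have := hT z Dz; have := hS z Dz; rewrite -/m; have := cabs_ge0 (S.[z] ^+ 2 - T.[z]).
move: (cabs _) (cabs _) (cabs _) (cabs _) h3 => x1 x2 x3 x4; nra.
Qed.

(** Let [m = 2 ^ k] with [k] least such that [a <= 2 ^+ m]. An approximate [m]-th root [T] of [q] is
    at most about 2 at the centre, and a polynomial [W] close to its reciprocal is bounded on the
    disc. The Schwarz bound keeps [W] away from 0 near the centre, so [T] is at most 3 and [q] at
    most [4 ^+ m] there; leastness of [k] turns this into a power of [a]. *)
Theorem harnack q : (forall z, D z -> 1 <= cabs q.[z]) ->
  forall z, cabs (z - c) <= rho / 24 -> cabs q.[z] <= 4 * cabs q.[c] ^+ 4.
Proof.
move=> hq z hz; have Dz : D z by move: (rho0) => r0; rewrite /D; lra.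
have Dc : D c by rewrite /D subrr cabs0 ltW.
have a1 := hq c Dc; set a := cabs q.[c] in a1 *.
have hex : exists k : nat, a <= 2 ^+ (2 ^ k).
  exists (Num.truncn a).+1; apply: le_trans (ltW (truncnS_gt a)) _.
  rewrite -natrX ler_nat; apply: leq_trans (ltnW (ltn_expl _ (ltnSn 1))) _.
  by rewrite leq_exp2l // ltnW // ltn_expl.
have [k hk kmin] := ex_minnP hex.
have h24 : 0 < 24^-1 :> R by rewrite invr_gt0.
have [T hT] := root_pow2_approx k hq h24.
pose m := (2 ^ k)%N; have m0 : (0 < m)%N by rewrite expn_gt0.
have T1 w : D w -> 23 / 24 <= cabs T.[w].
  move=> Dw; rewrite leNgt; apply/negP => hlt.
  have h1 := hT w Dw; have h2 := hq w Dw.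
  have := cabs_subl q.[w] (T.[w] ^+ m); rewrite cabsB cabsX => h3.
  have : cabs T.[w] ^+ m <= cabs T.[w].
    by rewrite -[leRHS]expr1 ler_wiXn2l ?cabs_ge0 //; lra.
  rewrite -/m in h1; lra.
have T0 w : D w -> T.[w] != 0.
  by move=> /T1 h; rewrite -cabs_gt0; lra.
have Tc : cabs T.[c] <= 50 / 24.
  rewrite leNgt; apply/negP => hlt.
  have h1 := hT c Dc; have := cabs_subl (T.[c] ^+ m) q.[c]; rewrite cabsX -/a => h3.
  have : 2 ^+ m + 2 / 24 <= cabs T.[c] ^+ m.
    apply: (@le_trans _ _ ((50 / 24) ^+ m)); last by apply: lerXn2r; rewrite ?nnegrE; lra.
    rewrite -(prednK m0) !exprS; have h4 : 1 <= 2 ^+ m.-1 :> R by rewrite exprn_ege1 // ler1n.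
    have : 2 ^+ m.-1 <= (50 / 24) ^+ m.-1 :> R by apply: lerXn2r; rewrite ?nnegrE; lra.
    lra.
  rewrite -/m in h1 hk; lra.
have [W hW] := inv_approx T0 h24.
have Wle w : D w -> cabs W.[w] <= 25 / 23.
  move=> Dw; have := cabs_subl (W.[w] * T.[w]) 1; rewrite cabsM cabs1.
  have := hW w Dw; have := T1 w Dw; have := cabs_ge0 W.[w]; nra.
have Wc : 23 / 50 <= cabs W.[c].
  have := cabs_subl 1 (W.[c] * T.[c]); rewrite cabsM cabs1 cabsB.
  have := hW c Dc; have := cabs_ge0 W.[c]; have := T1 c Dc; nra.
have Wz : 36 / 100 <= cabs W.[z].
  have := schwarz_poly rho0 Wle Dz; have := cabs_subl W.[c] W.[z]; rewrite (cabsB W.[c]).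
  (* The radius [rho / 24] makes this variation about 0.091, less than [23 / 50 - 36 / 100]. *)
  have : 2 * (25 / 23) / rho * cabs (z - c) <= 2 * (25 / 23) * 24^-1.
    rewrite -mulrA ler_wpM2l //; first lra.
    by rewrite mulrC ler_pdivrMr // mulrC.
  lra.
have Tz : cabs T.[z] <= 3.
  have := cabs_subl (W.[z] * T.[z]) 1; rewrite cabsM cabs1.
  have := hW z Dz; have := cabs_ge0 T.[z]; nra.
have qz : cabs q.[z] <= 4 ^+ m.
  have := cabs_subl q.[z] (T.[z] ^+ m); rewrite cabsB cabsX.
  have := hT z Dz; rewrite -/m.
  have : cabs T.[z] ^+ m <= 3 ^+ m by rewrite lerXn2r ?nnegrE ?cabs_ge0.
  have : 3 ^+ m + 1 <= 4 ^+ m :> R.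
    rewrite -(prednK m0) !exprS; have h4 : 1 <= 3 ^+ m.-1 :> R by rewrite exprn_ege1 // ler1n.
    have : 3 ^+ m.-1 <= 4 ^+ m.-1 :> R by apply: lerXn2r; rewrite ?nnegrE; lra.
    lra.
  lra.
apply: le_trans qz _; rewrite /m; case: k kmin {hk hT m m0 T1 Tc} => [|k] kmin.
  rewrite expn0 expr1 ler_peMr // exprn_ege1 //.
(* By leastness the preceding exponent fails; its fourth power is exactly the bound
   [4 ^+ (2 ^ k.+1)]. *)
have hlt : 2 ^+ (2 ^ k) < a.
  rewrite ltNge; apply/negP => h; have := kmin k h; by rewrite ltnn.
have -> : 4 ^+ (2 ^ k.+1) = (2 ^+ (2 ^ k)) ^+ 4 :> R.
  have -> : 4 = 2 ^+ 2 :> R by rewrite -natrX.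
  by rewrite -!exprM expnS; congr (_ ^+ _); lia.
apply: (@le_trans _ _ (a ^+ 4)); first by rewrite lerXn2r ?nnegrE ?exprn_ge0 //; lra.
by rewrite ler_peMl ?exprn_ge0 //; lra.
Qed.

End Harnack.

(** * The chordal metric and the plane *)

Section Sphere.
Local Open Scope complex_scope.
Variable R : realType.
Local Notation C := R[i].
Local Notation sd := (@sdist R).
Implicit Types (z w : C) (x y : sphere R).

Lemma sdistC x y : sd x y = sd y x.
Proof. by case: x y => [z|] [w|] //=; rewrite cabsB mulrC [(1 + _) * _]mulrC mulrC. Qed.

Lemma sqrt_1sqr_ge1 (t : R) : 1 <= Num.sqrt (1 + t ^+ 2).
Proof. by rewrite -{1}[1]sqrtr1 ler_sqrt ?lerDl ?sqr_ge0 // addr_ge0 // sqr_ge0. Qed.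

Lemma sqrt_1sqr_le (t : R) : 0 <= t -> Num.sqrt (1 + t ^+ 2) <= 1 + t.
Proof.
move=> t0; have h : 0 <= 1 + t by lra.
rewrite -[leRHS](ger0_norm h) -sqrtr_sqr ler_sqrt ?sqr_ge0 // sqrrD expr1n mul1r.
by rewrite -addrA lerD2l lerDr mulrn_wge0.
Qed.

Lemma sqrt_1sqr_ge (t : R) : 0 <= t -> t <= Num.sqrt (1 + t ^+ 2).
Proof.
move=> t0; rewrite -[leLHS](ger0_norm t0) -sqrtr_sqr ler_sqrt ?lerDr //.
by rewrite addr_ge0 // sqr_ge0.
Qed.

Lemma sdist_le z w : sd (Some z) (Some w) <= 2 * cabs (z - w).
Proof.
rewrite /= sqrtrM ?addr_ge0 ?sqr_ge0 // ler_pdivrMr ?mulr_gt0 ?(lt_le_trans ltr01) ?sqrt_1sqr_ge1 //.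
rewrite ler_peMr ?mulr_ge0 ?cabs_ge0 //.
by apply: mulr_ege1; apply: sqrt_1sqr_ge1.
Qed.

Lemma sdist_None z : 0 < cabs z -> sd (Some z) None <= 2 / cabs z.
Proof.
move=> z0; rewrite /= ler_wpM2l // lef_pV2 ?posrE ?sqrt_1sqr_ge ?cabs_ge0 //.
exact: lt_le_trans (sqrt_1sqr_ge1 _).
Qed.

(** On bounded sets the chordal distance controls the Euclidean one; the factor [Num.min 1 d] makes
    the radius exclude the point at infinity as well. *)
Lemma sdist_near (M d : R) : 0 < d -> exists2 e : R, 0 < e & forall z x,
  cabs z <= M -> sd (Some z) x < e -> exists2 w, x = Some w & cabs (z - w) < d.
Proof.
move=> d0; have [N [N0 MN]] : exists N : R, 0 <= N /\ M <= N.
  by exists (Num.max 0 M); rewrite !le_max !lexx orbT.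
pose e := 2 * Num.min 1 d / ((1 + N) * (1 + N + d)).
have m0 : 0 < Num.min 1 d by rewrite lt_min ltr01.
have m1 : Num.min 1 d <= 1 by rewrite ge_min lexx.
have m2 : Num.min 1 d <= d by rewrite ge_min lexx orbT.
have D0 : 0 < (1 + N) * (1 + N + d) by rewrite mulr_gt0 //; lra.
exists e; first by rewrite /e divr_gt0 // mulr_gt0.
move=> z x hz; rewrite /e ltr_pdivlMr // => H.
have z1 := sqrt_1sqr_ge1 (cabs z); have z2 := sqrt_1sqr_le (cabs_ge0 z).
case: x H => [w|] /= H.
  exists w => //; rewrite ltNge; apply/negP => hd.
  have w1 := sqrt_1sqr_ge1 (cabs w); have w2 := sqrt_1sqr_le (cabs_ge0 w).
  have hw : cabs w <= cabs z + cabs (z - w) by have := cabs_subl w z; rewrite (cabsB w); lra.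
  rewrite sqrtrM ?addr_ge0 ?sqr_ge0 // in H.
  set A := Num.sqrt _ in z1 z2 H; set B := Num.sqrt _ in w1 w2 H.
  have AB : 0 < A * B by rewrite mulr_gt0 //; lra.
  have : 2 * cabs (z - w) / (A * B) * ((1 + N) * (1 + N + d)) >= 2 * d.
    rewrite mulrAC ler_pdivlMr // -!mulrA ler_wpM2l //.
    have hA : A <= 1 + N by lra.
    have hB : B <= 1 + N + cabs (z - w) by lra.
    apply: (@le_trans _ _ (d * ((1 + N) * (1 + N + cabs (z - w))))).
      by rewrite ler_wpM2l ?(ltW d0) // ler_pM //; lra.
    move: (cabs (z - w)) hd => u hd; nra.
  lra.
exfalso; move: H; apply/negP; rewrite -leNgt.
set A := Num.sqrt _ in z1 z2 *.
have A0 : 0 < A by lra.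
rewrite mulrAC ler_pdivlMr //; nra.
Qed.

Lemma mopen_toC (U : sphere R -> Prop) : mopen sd U -> mopen (@cdist R) (toC U).
Proof.
move=> oU z /oU [e e0 he]; exists (e / 2); first by lra.
move=> w hw; apply: he; apply: le_lt_trans (sdist_le _ _) _; rewrite /cdist in hw; lra.
Qed.

Definition ofC (A : C -> Prop) : sphere R -> Prop := fun x => exists2 z, A z & x = Some z.

Lemma mopen_ofC (U : C -> Prop) : mopen (@cdist R) U -> mopen sd (ofC U).
Proof.
move=> oU _ [z Uz ->]; have [d d0 hd] := oU z Uz.
have [e e0 he] := sdist_near (cabs z) d0; exists e => // y hy.
by have [w -> hw] := he z y (lexx _) hy; exists w => //; apply: hd.
Qed.

Lemma mopen_disc c (r : R) : mopen (@cdist R) (fun z => cabs (z - c) < r).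
Proof.
move=> z hz; exists (r - cabs (z - c)); first by rewrite subr_gt0.
by move=> w; rewrite /cdist => hw; have := cabs_tri z w c; rewrite (cabsB w z); lra.
Qed.

End Sphere.

(** * Agreement of the two notions of connectedness in the plane *)

Section MetricConnectedness.
Variable R : realType.
Local Notation C := R[i].
Implicit Types (x y z : C).

Lemma lconn_mconnected (A : C -> Prop) : lconn A -> mconnected (@cdist R) A.
Proof.
move=> cA [U [V [[oU oV] cov [x [Ax Ux]] [y [Ay Vy]] dis]]].
apply: (dis y Ay) Vy; apply: (cA U _ x y Ax Ay Ux) => z Az.
case: (cov z Az) => hz.
  have [e e0 he] := oU z hz; exists e => // w Aw hw; split=> // _; exact: he.
have [e e0 he] := oV z hz; exists e => // w Aw hw; split=> h.
  by case: (dis z Az h hz).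
by case: (dis w Aw h (he w hw)).
Qed.

(* The union of half-balls on which a locally constant predicate is constant. *)
Lemma lconst_open (A P : C -> Prop) : lconst A P -> exists U : C -> Prop,
  [/\ mopen (@cdist R) U, (forall z, A z -> P z -> U z) & (forall z, A z -> U z -> P z)].
Proof.
move=> hP; exists (fun z => exists a e, [/\ 0 < e, cabs (a - z) < e &
  forall y, A y -> cabs (a - y) < e -> P y]); split.
- move=> z [a [e [e0 hz he]]]; exists (e - cabs (a - z)); first by rewrite subr_gt0.
  move=> w; rewrite /cdist => hw; exists a, e; split=> //.
  by have := cabs_tri z a w; lra.
- move=> x Ax Px; have [e e0 he] := hP x Ax; exists x, e; split=> //.
    by rewrite subrr cabs0.
  by move=> y Ay hy; apply/(he y Ay hy).
by move=> x Ax [a [e [_ hx]]]; apply.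
Qed.

Lemma lconstN (A P : C -> Prop) : lconst A P -> lconst A (fun z => ~ P z).
Proof.
move=> hP x Ax; have [e e0 he] := hP x Ax; exists e => // y Ay hy.
by have [h1 h2] := he y Ay hy; split=> h3 h4; apply: h3; auto.
Qed.

Lemma mconnected_lconn (A : C -> Prop) : mconnected (@cdist R) A -> lconn A.
Proof.
move=> mA P hP x y Ax Ay Px; apply: contrapT => nPy.
have [U [oU hU1 hU2]] := lconst_open hP; have [V [oV hV1 hV2]] := lconst_open (lconstN hP).
apply: mA; exists U, V; split=> //.
- by move=> z Az; case: (pselect (P z)) => h; [left; apply: hU1 | right; apply: hV1].
- by exists x; split=> //; apply: hU1.
- by exists y; split=> //; apply: hV1.
- by move=> z Az /(hU2 z Az) h /(hV2 z Az); apply.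
Qed.

End MetricConnectedness.

(** * Connectedness in the plane and on the sphere *)

Section SphereConnectedness.
Variable R : realType.
Local Notation C := R[i].
Local Notation sd := (@sdist R).

Lemma lconn_mconnected_ofC (A : C -> Prop) : lconn A -> mconnected sd (ofC A).
Proof.
move=> /lconn_mconnected cA [U [V [[oU oV] cov [_ [[x Ax ->] Ux]] [_ [[y Ay ->] Vy]] dis]]].
apply: cA; exists (toC U), (toC V); split.
- by split; apply: mopen_toC.
- by move=> z Az; apply: cov; exists z.
- by exists x.
- by exists y.
- by move=> z Az; apply: dis; exists z.
Qed.

Lemma mconnected_toC (A : sphere R -> Prop) : ~ A None -> mconnected sd A -> lconn (toC A).
Proof.
move=> nA mA; apply: mconnected_lconn => -[U [V [[oU oV] cov [x [Ax Ux]] [y [Ay Vy]] dis]]].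
apply: mA; exists (ofC U), (ofC V); split.
- by split; apply: mopen_ofC.
- case=> [z|//] Az; by case: (cov z Az) => h; [left | right]; exists z.
- by exists (Some x); split=> //; exists x.
- by exists (Some y); split=> //; exists y.
- by case=> [z|//] Az [w Uw [zw]] [v Vv [zv]]; move: Uw Vv; rewrite -zw -zv; apply: dis.
Qed.

End SphereConnectedness.

(** * Normal families of polynomials *)

Section Normality.
Local Open Scope complex_scope.
Variable R : realType.
Local Notation C := R[i].
Local Notation sd := (@sdist R).
Implicit Types (F : {poly C} -> Prop) (s : nat -> {poly C}) (z w : C).

Lemma strictly_increasing_ge (phi : nat -> nat) :
  (forall n, (phi n < phi n.+1)%N) -> forall n, (n <= phi n)%N.
Proof. by move=> h; elim=> // n IH; apply: leq_ltn_trans IH (h n). Qed.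

(** Convergence along the ultrafilter becomes a true subsequence: stage [n] picks a later index
    whose error is below [1 / (n + 1)]. *)
Lemma normal_seq_of_uev s (U : sphere R -> Prop) (h : sphere R -> sphere R) :
  (forall e : R, 0 < e -> uev (fun n => forall x, U x -> sd (pext (s n) x) (h x) < e)) ->
  exists phi : nat -> nat, (forall n, (phi n < phi n.+1)%N) /\
  exists h : sphere R -> sphere R, loc_unif_cvg U (fun n => pext (s (phi n))) h.
Proof.
move=> hU.
have hex (p : nat * nat) : exists n, (p.1 < n)%N /\
    forall x, U x -> sd (pext (s n) x) (h x) < p.2.+1%:R^-1.
  have e0 : 0 < p.2.+1%:R^-1 :> R by rewrite invr_gt0 ltr0n.
  by have [n n1 n2] := uev_ex_ge p.1.+1 (hU _ e0); exists n.
have [f hf] := choice hex.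
pose phi := fix phi n := if n is m.+1 then f (phi m, n) else f (0%N, 0%N).
have hphi n : forall x, U x -> sd (pext (s (phi n)) x) (h x) < n.+1%:R^-1.
  by case: n => [|n]; [case: (hf (0%N, 0%N)) | case: (hf (phi n, n.+1))].
exists phi; split; first by move=> n; case: (hf (phi n, n.+1)).
exists h => x Ux; exists 1 => // e /invn_lt [N hN]; exists N => n hn y Uy _.
exact: lt_trans (hphi n y Uy) (hN n hn).
Qed.

(** Montel's theorem: bounded polynomials are equi-Lipschitz on the quarter disc, hence so is their
    pointwise limit [h]. Points of slow convergence would accumulate at some [y], where convergence
    holds. *)
Lemma normal_seq_bounded s z (rho M : R) : 0 < rho ->
  uev (fun n => forall y, cabs (y - z) <= rho -> cabs (s n).[y] <= M) ->
  exists h, forall e : R, 0 < e -> uev (fun n => forall x,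
    ofC (fun y => cabs (y - z) < rho / 4) x -> sd (pext (s n) x) (h x) < e).
Proof.
move=> r0 hM.
have [h hh] : {h : C -> C & forall y, cabs (y - z) <= rho ->
    forall e : R, 0 < e -> uev (fun n => cabs ((s n).[y] - h y) < e)}.
  apply: (@choice _ _ (fun y l => cabs (y - z) <= rho ->
    forall e : R, 0 < e -> uev (fun n => cabs ((s n).[y] - l) < e))) => y.
  case: (pselect (cabs (y - z) <= rho)) => hy; last by exists 0.
  have [l hl] : exists l, forall e : R, 0 < e -> uev (fun n => cabs ((s n).[y] - l) < e).
    by apply: (@uev_lim _ _ M); apply: uev_mono hM => n; apply.
  by exists l.
pose L := 4 * M / rho.
have sL : uev (fun n => forall x y, cabs (x - z) <= rho / 4 -> cabs (y - z) <= rho / 4 ->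
    cabs ((s n).[x] - (s n).[y]) <= L * cabs (x - y)).
  by apply: uev_mono hM => n hn x y; apply: poly_lip_of_bound hn x y.
have small y : cabs (y - z) <= rho / 4 -> cabs (y - z) <= rho by move: (cabs _) => u; lra.
have hL x y : cabs (x - z) <= rho / 4 -> cabs (y - z) <= rho / 4 ->
    cabs (h x - h y) <= L * cabs (x - y).
  move=> hx hy; rewrite leNgt; apply/negP => hlt.
  have e0 : 0 < (cabs (h x - h y) - L * cabs (x - y)) / 2 by rewrite divr_gt0 // subr_gt0.
  have [n [[k1 k2] k3]] :=
    uev_ex (uev_and (uev_and (hh x (small x hx) _ e0) (hh y (small y hy) _ e0)) sL).
  have := k3 x y hx hy; have := cabs_tri (s n).[x] (h x) (h y).
  have := cabs_tri (s n).[y] (s n).[x] (h y).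
  by move: k1; rewrite (cabsB _ (h x)); lra.
exists (fun x => if x is Some y then Some (h y) else None) => e e0.
apply: contrapT => /uevN hn.
pose bad n y := cabs (y - z) <= rho / 4 /\ e / 2 <= cabs ((s n).[y] - h y).
have {}hn : uev (fun n => exists y, bad n y).
  apply: uev_mono hn => n hn; apply: contrapT => h2; apply: hn => _ [y hy ->].
  apply: le_lt_trans (sdist_le _ _) _; rewrite ltNge; apply/negP => h3.
  by apply: h2; exists y; split; [apply: ltW | lra].
have [y hy] : exists y, Ulim bad y.
  apply: (@Ulim_nonempty _ _ (cabs z + rho / 4)) => //; apply: uevT => n y [hy _].
  by have := cabs_subl y z; lra.
have yz : cabs (y - z) <= rho / 4.
  rewrite leNgt; apply/negP => hlt.
  have d0 : 0 < cabs (y - z) - rho / 4 by rewrite subr_gt0.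
  have [n [w [hw _] hyw]] := uev_ex (hy _ d0); have := cabs_tri w y z; lra.
have M0 : 0 <= M.
  have zz : cabs (z - z) <= rho by rewrite subrr cabs0 ltW.
  by have [n hn'] := uev_ex hM; apply: le_trans (hn' z zz); apply: cabs_ge0.
have L0 : 0 <= L by rewrite /L divr_ge0 ?mulr_ge0 // ltW.
have d0 : 0 < e / 8 / (L + 1) by rewrite !divr_gt0 //; clearbody L; lra.
have e8 : 0 < e / 8 by lra.
have [n [[k1 [w [hw1 hw2] hyw]] k3]] :=
  uev_ex (uev_and (uev_and (hh y (small y yz) _ e8) (hy _ d0)) sL).
have := k3 y w yz hw1; have := hL y w yz hw1.
have : L * cabs (y - w) <= e / 8.
  rewrite ltr_pdivlMr in hyw; last by clearbody L; lra.
  have := cabs_ge0 (y - w); clearbody L; nra.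
have := cabs_tri (s n).[y] (s n).[w] (h w); have := cabs_tri (h y) (s n).[y] (h w).
rewrite (cabsB (s n).[w] (s n).[y]); clear -k1 hw2 e0; lra.
Qed.

(** Otherwise some members of [F'] exceed [n] at points tending to [z]. A fixed early term and a
    late term of a convergent subsequence are both compared with the limit [h] at the same point
    [y], so that continuity of [h] never enters. *)
Lemma Fatou_equibounded F F' z (M : R) : Fatou F (Some z) ->
  (forall q, F' q -> F q) -> (forall q, F' q -> cabs q.[z] <= M) ->
  exists r M' : R, 0 < r /\ forall q, F' q -> forall y, cabs (z - y) < r -> cabs q.[y] <= M'.
Proof.
move=> [U [oU Uz nU]] FF hM; apply: contrapT => hno.
have hex n : exists qy : {poly C} * C, [/\ F' qy.1, cabs (z - qy.2) < n.+1%:R^-1 &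
    n%:R < cabs qy.1.[qy.2]].
  apply: contrapT => h; apply: hno; exists n.+1%:R^-1, n%:R.
  split; first by rewrite invr_gt0 ltr0n.
  by move=> q Fq y hy; rewrite leNgt; apply/negP => h2; apply: h; exists (q, y).
have [f hf] := choice hex.
have [phi [hphi [h hcv]]] := nU (fun n => (f n).1) (fun n => FF _ (let: And3 a _ _ := hf n in a)).
have phi_ge := strictly_increasing_ge hphi.
have [del del0 hdel] := hcv _ Uz.
have [e1 e10 he1] := sdist_near (M + 1) (@ltr01 R).
have [e2 e20 he2] := sdist_near (M + 2) (@ltr01 R).
have e0 : 0 < Num.min e1 e2 by rewrite lt_min e10.
have [N hN] := hdel _ e0.
have [dU dU0 hdU] := oU _ Uz.
have [d d0 hd] := poly_cont (f (phi N)).1 z (@ltr01 R).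
have m0 : 0 < Num.min d (Num.min (dU / 2) (del / 2)) by rewrite !lt_min d0 !divr_gt0.
have [K hK] := invn_lt m0.
(* [n] passes the convergence index [N], the index [K] from which the chosen points are close to
   [z], and the bound [M + 3]. *)
pose n := (N + K + (Num.truncn (M + 3)).+1)%N.
have hn1 : (phi n).+1%:R^-1 < Num.min d (Num.min (dU / 2) (del / 2)).
  by apply: hK; apply: leq_trans (phi_ge n); rewrite /n -addnA addnCA leq_addr.
have [Fq hy hbig] := hf (phi n); move: hy; set y := (f (phi n)).2 => hy.
have := lt_trans hy hn1; rewrite !lt_min => /and3P[y1 y2 y3].
have Uy : U (Some y) by apply: hdU; apply: le_lt_trans (sdist_le _ _) _; lra.
have hzy : sd (Some z) (Some y) < del by apply: le_lt_trans (sdist_le _ _) _; lra.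
have := hN N (leqnn _) (Some y) Uy hzy; rewrite lt_min => /andP[k1 _].
have b1 : cabs (f (phi N)).1.[y] <= M + 1.
  have := hd y y1; have [FN _ _] := hf (phi N); have := hM _ FN.
  have := cabs_subl (f (phi N)).1.[y] (f (phi N)).1.[z]; rewrite (cabsB (_.[y])); lra.
have [w hw hw2] := he1 _ _ b1 k1.
have Nn : (N <= n)%N by rewrite /n -addnA leq_addr.
have := hN n Nn (Some y) Uy hzy; rewrite lt_min hw sdistC => /andP[_ k2].
have b2 : cabs w <= M + 2.
  by have := cabs_subl w (f (phi N)).1.[y]; rewrite (cabsB w); lra.
have [v [hv] hv2] := he2 _ _ b2 k2.
move: hbig; rewrite -/y hv => hbig.
have : cabs v <= M + 3 by have := cabs_subl v w; rewrite (cabsB v); lra.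
have := truncnS_gt (M + 3).
have : (Num.truncn (M + 3)).+1%:R <= (phi n)%:R :> R.
  by rewrite ler_nat; apply: leq_trans (phi_ge n); rewrite /n leq_addl.
move: hbig; move: (_%:R) (_%:R) => u v'; lra.
Qed.

End Normality.

(** * Filled Julia sets, escape to infinity, and a criterion for normality *)

Section FilledJulia.
Local Open Scope complex_scope.
Variable R : realType.
Local Notation C := R[i].
Implicit Types (p q : {poly C}) (z w : C).

Definition filled p z := exists M : R, forall n, cabs (iter n (horner p) z) <= M.

Definition iterp p n : {poly C} := iter n (fun q => p \Po q) 'X.

Lemma horner_iterp p n z : (iterp p n).[z] = iter n (horner p) z.
Proof. by elim: n => [|n IH] /=; rewrite ?hornerX // horner_comp IH. Qed.

Lemma size_comp_gt2 p q : (2 < size p)%N -> (1 < size q)%N -> (2 < size (p \Po q))%N.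
Proof.
move=> sp sq; have := size_comp_poly p q.
move: (size p) (size q) (size (p \Po q)) sp sq => a b c.
case: a b c => [|[|[|a]]] // [|[|b]] // c _ _ /=; nia.
Qed.

Lemma size_iterp p n : (2 < size p)%N -> (1 < size (iterp p n))%N.
Proof.
move=> sp; elim: n => [|n IH]; first by rewrite /= size_polyX.
exact: ltnW (size_comp_gt2 sp IH).
Qed.

Variable p : {poly C}.
Hypothesis sp : (2 < size p)%N.

Lemma escape_radius : exists2 r : R, 1 <= r & forall z, r <= cabs z -> 2 * cabs z <= cabs p.[z].
Proof. exact: poly_growth2. Qed.

Definition esc : R := projT1 (cid2 escape_radius).

Lemma esc_ge1 : 1 <= esc.
Proof. by rewrite /esc; case: cid2. Qed.

Lemma esc_double z : esc <= cabs z -> 2 * cabs z <= cabs p.[z].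
Proof. by rewrite /esc; case: cid2 => r h1 h2; apply: h2. Qed.

Lemma esc_iter z n : esc <= cabs z -> 2 ^+ n * cabs z <= cabs (iter n (horner p) z).
Proof.
have e1 := esc_ge1; move=> hz; elim: n => [|n IH]; first by rewrite expr0 mul1r.
have h2 : 1 <= 2 ^+ n :> R by rewrite exprn_ege1 // ler1n.
have hz' : esc <= cabs (iter n (horner p) z).
  by apply: le_trans IH; apply: le_trans hz _; rewrite ler_peMl // cabs_ge0.
rewrite iterS exprS -mulrA; have := esc_double hz'; lra.
Qed.

Lemma esc_mono z n m : (n <= m)%N -> esc <= cabs (iter n (horner p) z) ->
  cabs (iter n (horner p) z) <= cabs (iter m (horner p) z).
Proof.
move=> nm hn; rewrite -(subnK nm) iterD; apply: le_trans (esc_iter _ hn).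
by rewrite ler_peMl ?cabs_ge0 // exprn_ege1 // ler1n.
Qed.

Lemma esc_infty z n (M : R) : esc <= cabs (iter n (horner p) z) ->
  exists N, forall m, (N <= m)%N -> M <= cabs (iter m (horner p) z).
Proof.
move=> hn; exists (n + (Num.truncn M).+1)%N => m hm.
have nm : (n <= m)%N by apply: leq_trans hm; rewrite leq_addr.
rewrite -(subnK nm) iterD; apply: le_trans (esc_iter _ hn).
apply: le_trans (ltW (truncnS_gt M)) _.
have e1 := esc_ge1.
apply: (@le_trans _ _ (2 ^+ (m - n))); last by rewrite ler_peMr ?exprn_ge0 //; lra.
rewrite -natrX ler_nat; apply: leq_trans (ltnW (ltn_expl _ (ltnSn 1))).
by rewrite leq_subRL.
Qed.

Lemma filledP z : filled p z <-> forall n, cabs (iter n (horner p) z) <= esc.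
Proof.
split=> [[M hM] n|h]; last by exists esc.
rewrite leNgt; apply/negP => /ltW /(@esc_infty _ _ (M + 1)) [N /(_ N (leqnn _))].
have := hM N; lra.
Qed.

Lemma nfilledP z : ~ filled p z <-> exists n, esc < cabs (iter n (horner p) z).
Proof.
split=> [h|[n hn] /filledP /(_ n)]; last by rewrite leNgt hn.
apply: contrapT => h2; apply: h; apply/filledP => n; rewrite leNgt; apply/negP => h3.
by apply: h2; exists n.
Qed.

Lemma filled_horner z : filled p p.[z] <-> filled p z.
Proof.
split=> [[M hM]|[M hM]]; last by exists M => n; rewrite -iterSr.
exists (Num.max M (cabs z)) => -[|n]; first by rewrite le_max lexx orbT.
by rewrite iterSr le_max hM.
Qed.

Lemma filled_iter n z : filled p (iter n (horner p) z) <-> filled p z.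
Proof. by elim: n => // n IH; rewrite iterS; split=> [/filled_horner/IH|/IH/filled_horner]. Qed.

Lemma filled_le z : filled p z -> cabs z <= esc.
Proof. by move/filledP/(_ 0%N). Qed.

Lemma filled_closed : closedC (filled p).
Proof.
move=> z hz; apply/filledP => n; rewrite leNgt; apply/negP => hn.
have e0 : 0 < cabs (iter n (horner p) z) - esc by rewrite subr_gt0.
have [d d0 hd] := poly_cont (iterp p n) z e0.
have [a /filledP /(_ n) ha /hd] := hz d d0; rewrite !horner_iterp.
have := cabs_subl (iter n (horner p) z) (iter n (horner p) a); lra.
Qed.

(** The quantity [c * Num.max 1 (cabs z)] is normalised so that the inequality iterates without new
    constants; [b] lets later uses ask for a larger [c]. *)
Lemma poly_degree_upper (b : R) : exists2 c : R, 1 + `|b| <= c & forall z,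
  c * Num.max 1 (cabs p.[z]) <= (c * Num.max 1 (cabs z)) ^+ (size p).-1.
Proof.
pose A := \sum_(k < size p) cabs p`_k.
have A0 : 0 <= A by apply: sumr_ge0 => k _; apply: cabs_ge0.
have n1 : (1 < (size p).-1)%N by case: (size p) sp => [|[|[]]].
pose B := A + `|b|; have AB : A <= B by rewrite lerDl.
have B0 : 0 <= B by apply: le_trans AB.
exists (1 + B) => [|z]; first by rewrite /B; lra.
clearbody B.
have m1 : 1 <= Num.max 1 (cabs z) by rewrite le_max lexx.
have m2 : cabs z <= Num.max 1 (cabs z) by rewrite le_max lexx orbT.
move: (Num.max 1 (cabs z)) m1 m2 => m m1 m2.
have mn : 1 <= m ^+ (size p).-1 by rewrite exprn_ege1.
have h1 : cabs p.[z] <= A * m ^+ (size p).-1.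
  rewrite horner_coef; apply: le_trans (cabs_sum _ _) _; rewrite mulr_suml; apply: ler_sum => k _.
  rewrite cabsM cabsX ler_wpM2l ?cabs_ge0 //.
  apply: (@le_trans _ _ (m ^+ k)); first by rewrite lerXn2r ?nnegrE ?cabs_ge0 //; lra.
  by rewrite ler_weXn2l // -ltnS prednK // (leq_ltn_trans _ (ltn_ord k)).
have h2 : Num.max 1 (cabs p.[z]) <= (1 + B) * m ^+ (size p).-1.
  by rewrite ge_max; apply/andP; split; nra.
rewrite exprMn; apply: (@le_trans _ _ ((1 + B) ^+ 2 * m ^+ (size p).-1)).
  by rewrite expr2 -mulrA ler_wpM2l //; lra.
rewrite ler_wpM2r ?exprn_ge0 //; first lra.
by rewrite ler_weXn2l //; lra.
Qed.

Lemma iter_upper (b : R) : exists2 c : R, 1 + `|b| <= c & forall n z,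
  c * Num.max 1 (cabs (iter n (horner p) z)) <= (c * Num.max 1 (cabs z)) ^+ ((size p).-1 ^ n).
Proof.
have [c cb hc] := poly_degree_upper b; exists c => // n z.
have c1 : 1 <= c by apply: le_trans cb; rewrite lerDl.
elim: n => [|n IH]; first by rewrite expn0 expr1.
rewrite iterS; apply: le_trans (hc _) _; rewrite expnSr exprM.
have h (t : R) : 0 <= c * Num.max 1 t by rewrite mulr_ge0 ?le_max ?ler01 //; lra.
by rewrite lerXn2r ?nnegrE ?exprn_ge0.
Qed.

(** The factor [a] absorbs the leading coefficient and the factors 2 lost in comparing
    [cabs (z - w)] with [cabs z] for the roots [w]. *)
Lemma iter_lower : exists a r : R, [/\ 0 < a, a <= 1, 1 <= r & forall n z, r <= cabs z ->
  (a * cabs z) ^+ ((size p).-1 ^ n) <= a * cabs (iter n (horner p) z)].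
Proof.
have l0 := lead_gt0 (ltnW sp).
have p0 : p != 0 by rewrite -size_poly_gt0; apply: ltn_trans sp.
have n1 : (1 < (size p).-1)%N by case: (size p) sp => [|[|[]]].
case: (poly_factors p) => rs [hp /(_ p0) hs].
have [B hB] := cabs_seq_bound rs.
have e1 := esc_ge1.
pose a := Num.min 1 (cabs (lead_coef p) / 2 ^+ (size p).-1).
have a0 : 0 < a by rewrite lt_min ltr01 divr_gt0 ?exprn_gt0.
have a1 : a <= 1 by rewrite ge_min lexx.
have a2 : a * 2 ^+ (size p).-1 <= cabs (lead_coef p).
  by rewrite -ler_pdivlMr ?exprn_gt0 // ge_min lexx orbT.
have [r [r1 r2]] : exists r, esc <= r /\ 2 * B <= r.
  by exists (Num.max esc (2 * B)); rewrite !le_max !lexx orbT.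
exists a, r; split=> //; first lra.
have step z : r <= cabs z -> (a * cabs z) ^+ (size p).-1 <= a * cabs p.[z].
  move=> hz; rewrite exprMn.
  have h1 : (cabs z / 2) ^+ (size p).-1 <= \prod_(w <- rs) cabs (z - w).
    rewrite -hs; have : forall w, w \in rs -> cabs z / 2 <= cabs (z - w).
      by move=> w /hB hw; have := cabs_subl z w; lra.
    elim: (rs) => [|w s IH] h; first by rewrite big_nil expr0.
    rewrite big_cons exprS ler_pM ?exprn_ge0 ?divr_ge0 ?cabs_ge0 //; first by apply: h; rewrite mem_head.
    by apply: IH => v vs; apply: h; rewrite inE vs orbT.
  rewrite [in leRHS]hp horner_factors cabsM cabs_prod.
  have h2 : a * cabs z ^+ (size p).-1 <= cabs (lead_coef p) * \prod_(w <- rs) cabs (z - w).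
    apply: (@le_trans _ _ (cabs (lead_coef p) * (cabs z / 2) ^+ (size p).-1)); last first.
      by rewrite ler_wpM2l ?cabs_ge0.
    have -> : cabs z ^+ (size p).-1 = 2 ^+ (size p).-1 * (cabs z / 2) ^+ (size p).-1.
      by rewrite -exprMn mulrCA mulfV ?pnatr_eq0 // mulr1.
    by rewrite mulrA ler_wpM2r ?exprn_ge0 ?divr_ge0 ?cabs_ge0.
  apply: (@le_trans _ _ (a * (a * cabs z ^+ (size p).-1))); last by rewrite ler_wpM2l // ltW.
  rewrite mulrA ler_wpM2r ?exprn_ge0 ?cabs_ge0 // -expr2.
  by rewrite ler_wiXn2l // ltW.
move=> n z hz; elim: n => [|n IH]; first by rewrite expn0 expr1.
have hz' : r <= cabs (iter n (horner p) z).
  exact: le_trans hz (@esc_mono z 0 n (leq0n _) (le_trans r1 hz)).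
rewrite iterS; apply: le_trans (step _ hz'); rewrite expnSr exprM.
by rewrite lerXn2r ?nnegrE ?exprn_ge0 ?mulr_ge0 ?cabs_ge0 // ltW.
Qed.

(* [log|p^m s|] is a positive harmonic function where [s] avoids the filled
   Julia set, and [d^-m log|p^m s|] compares with [log|s|] uniformly in [m]. *)
Lemma omit_filled_bound (M : R) : exists M' : R, forall q y (rho : R), 0 < rho ->
  (forall z, cabs (z - y) <= rho -> ~ filled p q.[z]) -> cabs q.[y] <= M ->
  forall z, cabs (z - y) <= rho / 24 -> cabs q.[z] <= M'.
Proof.
have [c cb hc] := iter_upper 0; have c1 : 1 <= c by apply: le_trans cb; rewrite lerDl.
have [a [r [a0 a1 r1 ha]]] := iter_lower.
have e1 := esc_ge1.
pose B := 4 * (c * Num.max 1 M) ^+ 4.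
have M1 : 1 <= Num.max 1 M by rewrite le_max lexx.
exists (Num.max r (B / a)) => q y rho r0 hom hqy z hz.
(* By compactness of the disc and monotonicity of escape, one [m] moves the whole image of the disc
   beyond the escape radius. *)
have [m hm] : exists m, forall w, cabs (w - y) <= rho -> esc <= cabs (iter m (horner p) q.[w]).
  apply: contrapT => hno.
  have hex m : exists w, cabs (w - y) <= rho /\ cabs (iter m (horner p) q.[w]) < esc.
    apply: contrapT => h; apply: hno; exists m => w hw; rewrite leNgt; apply/negP => h2.
    by apply: h; exists w.
  have [f hf] := choice hex.
  have [l hl] : exists l, forall e : R, 0 < e -> uev (fun n => cabs (f n - l) < e).
    apply: (@uev_lim _ _ (rho + cabs y)); apply: uevT => n; case: (hf n) => h _.
    by have := cabs_subl (f n) y; lra.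
  have ly : cabs (l - y) <= rho.
    rewrite leNgt; apply/negP => hlt.
    have d0 : 0 < cabs (l - y) - rho by rewrite subr_gt0.
    have [n hn] := uev_ex (hl _ d0); case: (hf n) => h _.
    by have := cabs_tri (f n) l y; rewrite (cabsB l (f n)); lra.
  have /nfilledP [N hN] := hom l ly.
  have d0 : 0 < cabs (iter N (horner p) q.[l]) - esc by rewrite subr_gt0.
  have [d d1 hd] := poly_cont (iterp p N \Po q) l d0.
  have [n Nn hn] := uev_ex_ge N (hl d d1); case: (hf n) => _; apply/negP; rewrite -leNgt.
  have := hd (f n); rewrite cabsB => /(_ hn); rewrite !horner_comp !horner_iterp => h2.
  have h3 : esc <= cabs (iter N (horner p) q.[f n]).
    have := cabs_subl (iter N (horner p) q.[l]) (iter N (horner p) q.[f n]); lra.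
  by apply: le_trans h3 (esc_mono Nn h3).
case: (lerP (cabs q.[z]) r) => hr; first by rewrite le_max hr.
rewrite le_max; apply/orP; right; rewrite ler_pdivlMr // mulrC.
have hQ w : cabs (w - y) <= rho -> 1 <= cabs (iterp p m \Po q).[w].
  by move=> /hm; rewrite horner_comp horner_iterp; lra.
have := harnack r0 hQ hz; rewrite !horner_comp !horner_iterp => h1.
have h2 := ha m q.[z] (ltW hr).
have h3 : cabs (iter m (horner p) q.[y]) <= (c * Num.max 1 M) ^+ ((size p).-1 ^ m).
  apply: le_trans (_ : c * Num.max 1 (cabs (iter m (horner p) q.[y])) <= _).
    have k : cabs (iter m (horner p) q.[y]) <= Num.max 1 (cabs (iter m (horner p) q.[y])).
      by rewrite le_max lexx orbT.
    have := cabs_ge0 (iter m (horner p) q.[y]); nra.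
  apply: le_trans (hc m q.[y]) _.
  have hmm : Num.max 1 (cabs q.[y]) <= Num.max 1 M by rewrite ge_max !le_max lexx hqy orbT.
  have h0 : 1 <= Num.max 1 (cabs q.[y]) by rewrite le_max lexx.
  by apply: lerXn2r; rewrite ?nnegrE; nra.
have n0 : (0 < (size p).-1 ^ m)%N by rewrite expn_gt0; case: (size p) sp => [|[|[]]].
have B0 : 0 <= B by rewrite mulr_ge0 // exprn_ge0 // mulr_ge0 //; lra.
(* Both sides are powers with exponent [deg p ^ m]; removing it leaves a bound that does not depend
   on [m]. The constant 4 and the fourth power from [harnack] go into [B]. *)
have h4 : (a * cabs q.[z]) ^+ ((size p).-1 ^ m) <= B ^+ ((size p).-1 ^ m).
  apply: le_trans h2 _; apply: (@le_trans _ _ (cabs (iter m (horner p) q.[z]))).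
    by rewrite ler_piMl ?cabs_ge0.
  apply: le_trans h1 _; rewrite /B exprMn; apply: ler_pM => //.
  - by rewrite exprn_ge0 ?cabs_ge0.
  - by rewrite -[leLHS]expr1 ler_weXn2l // ler1n.
  - rewrite -exprM mulnC exprM; apply: lerXn2r; rewrite ?nnegrE ?cabs_ge0 //.
    by rewrite exprn_ge0 // mulr_ge0 //; lra.
rewrite leNgt; apply/negP => hlt; move: h4; apply/negP; rewrite -ltNge.
by rewrite ltrXn2r ?nnegrE // -lt0n.
Qed.

(** Three cases along the ultrafilter: values in the filled set are bounded; values off it, bounded
    at [z], are bounded nearby by [omit_filled_bound]; otherwise that lemma, applied from nearby
    points towards [z], forces convergence to infinity. *)
Lemma Fatou_of_dichotomy (F : {poly C} -> Prop) z (rho : R) : 0 < rho ->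
  (forall q, F q -> (forall y, cabs (y - z) < rho -> filled p q.[y]) \/
                    (forall y, cabs (y - z) < rho -> ~ filled p q.[y])) ->
  Fatou F (Some z).
Proof.
(* 200 exceeds [2 * 24 * 4]: half the disc, then the loss in [omit_filled_bound], then the quarter
   disc of [normal_seq_bounded]. *)
move=> r0 hF; have rE : 0 < rho / 200 by lra.
exists (ofC (fun y => cabs (y - z) < rho / 200)); split.
- exact/mopen_ofC/mopen_disc.
- by exists z; rewrite // subrr cabs0.
move=> s Fs.
have bounded_case (t M : R) : rho / 50 <= t -> uev (fun n => forall y, cabs (y - z) <= t -> cabs (s n).[y] <= M) ->
  exists phi : nat -> nat, (forall n, (phi n < phi n.+1)%N) /\ exists h : sphere R -> sphere R,
    loc_unif_cvg (ofC (fun y => cabs (y - z) < rho / 200)) (fun n => pext (s (phi n))) h.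
  move=> ht hM; have t0 : 0 < t by lra.
  have [h hh] := normal_seq_bounded t0 hM; apply: (@normal_seq_of_uev _ _ _ h) => e e0.
  apply: uev_mono (hh e e0) => n hn _ [y hy ->]; apply: hn; exists y => //; lra.
have [h1|h1] := uev_or (uevT (fun n => hF (s n) (Fs n))).
  apply: (@bounded_case (rho / 2) esc); first lra.
  by apply: uev_mono h1 => n hn y hy; apply: filled_le; apply: hn; lra.
have r2 : 0 < rho / 2 by lra.
have r4 : 0 < rho / 4 by lra.
have [[M hM]|hM] := pselect (exists M : R, uev (fun n => cabs (s n).[z] <= M)).
  have [M' hM'] := omit_filled_bound M.
  apply: (@bounded_case (rho / 2 / 24) M'); first lra.
  apply: uev_mono (uev_and h1 hM) => n [k1 k2] y hy; apply: (hM' _ z _ r2) hy => // w hw.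
  by apply: k1; lra.
apply: (@normal_seq_of_uev _ _ _ (fun _ => None)) => e e0.
(* A value of modulus at most [2 / e] at [y] would bound the value at [z] by [M']; beyond [2 / e]
   the chordal distance to infinity is below [e]. *)
have [M' hM'] := omit_filled_bound (2 / e).
have hz : uev (fun n => ~ cabs (s n).[z] <= M') by apply: uevN => h; apply: hM; exists M'.
apply: uev_mono (uev_and h1 hz) => n [k1 k2] _ [y hy ->].
have big : 2 / e < cabs (s n).[y].
  rewrite ltNge; apply/negP => hle; apply: k2; apply: (hM' _ y _ r4) => //.
    by move=> w hw; apply: k1; have := cabs_tri y w z; lra.
  rewrite cabsB; lra.
have e2 : 0 < 2 / e by rewrite divr_gt0.
have b0 : 0 < cabs (s n).[y] by apply: lt_trans big.
apply: le_lt_trans (sdist_None b0) _.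
by rewrite ltr_pdivrMr // mulrC -ltr_pdivrMr.
Qed.

End FilledJulia.

(** * Frontiers and their crossing by connected sets *)

Section Frontiers.
Local Open Scope complex_scope.
Variable R : realType.
Local Notation C := R[i].
Implicit Types (A B S : C -> Prop) (x y z : C).

Definition frontier S z := S z /\ forall e : R, 0 < e -> exists2 y, cabs (z - y) < e & ~ S y.

Lemma not_frontier S z : S z -> ~ frontier S z ->
  exists2 e : R, 0 < e & forall y, cabs (z - y) < e -> S y.
Proof.
move=> Sz h; apply: contrapT => h2; apply: h; split=> // e e0; apply: contrapT => h3.
apply: h2; exists e => // y hy; apply: contrapT => h4; by apply: h3; exists y.
Qed.

Lemma bdry_frontier S z : closedC S -> bdry_C S z <-> frontier S z.
Proof.
move=> cS; split=> [h|[Sz h] e e0].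
  split=> [|e /h [_ [y Sy hy]]]; last by exists y.
  by apply: cS => e /h [[a Sa ha] _]; exists a.
split; first by exists z => //; rewrite /cdist subrr cabs0.
by case: (h e e0) => y hy Sy; exists y.
Qed.

Lemma lconst_off_frontier B S : closedC S -> (forall z, B z -> ~ frontier S z) -> lconst B S.
Proof.
move=> cS hno z Bz; case: (pselect (S z)) => Sz.
  by have [e e0 he] := not_frontier Sz (hno z Bz); exists e => // y By /he.
by have [e e0 he] := closedC_far cS Sz; exists e => // y By /he; split.
Qed.

Lemma lconn_meets_frontier B S x y : closedC S -> lconn B -> B x -> S x -> B y -> ~ S y ->
  exists2 z, B z & frontier S z.
Proof.
move=> cS cB Bx Sx By nSy; apply: contrapT => hno; apply: nSy.
have hP : lconst B S by apply: lconst_off_frontier => // z Bz Fz; apply: hno; exists z.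
exact: cB hP x y Bx By Sx.
Qed.

Lemma farthest_frontier S c : (exists z, S z) -> bounded_C S -> closedC S ->
  exists2 x, frontier S x & forall y, S y -> cabs (y - c) <= cabs (x - c).
Proof.
move=> S0 bS cS; have [x Sx hx] := farthest c S0 bS cS; exists x => //; split=> // e e0.
have e2 : 0 < e / 2 by lra.
have [y hy1 hy2] : exists2 y, cabs (x - y) < e & cabs (x - c) < cabs (y - c).
  have sX : (1 < size ('X - c%:P)%R)%N by rewrite size_XsubC.
  by have [y h1] := not_local_max x sX e0; rewrite !hornerXsubC; exists y.
by exists y => // Sy; have := hx y Sy; rewrite leNgt hy2.
Qed.

Lemma level_in_lconn (q : {poly C}) (rho : R) A x y : lconn A -> A x -> A y ->
  cabs q.[x] < rho -> rho < cabs q.[y] -> exists2 z, A z & cabs q.[z] = rho.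
Proof.
move=> cA Ax Ay hx hy; apply: contrapT => hno.
have : cabs q.[y] < rho; last by move/lt_trans/(_ hy); rewrite ltxx.
apply: (cA (fun z => cabs q.[z] < rho) _ x y Ax Ay hx) => z Az.
have e0 : 0 < `|cabs q.[z] - rho|.
  by rewrite normr_gt0 subr_eq0; apply/eqP => h; apply: hno; exists z.
have [d d0 hd] := poly_cont q z e0; exists d => // w Aw /hd.
have := cabs_subl q.[z] q.[w]; have := cabs_subl q.[w] q.[z]; rewrite (cabsB q.[w]).
move: (cabs q.[z]) (cabs q.[w]) (cabs (q.[z] - q.[w])) e0 => a b c e0 h1 h2 h3.
case: (ltrP a rho) => ha; move: e0 h3; [rewrite ltr0_norm ?subr_lt0 // | rewrite ger0_norm ?subr_ge0 //] => e0 h3.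
  by split=> // _; lra.
by split=> // h; lra.
Qed.

End Frontiers.

(** * The Julia set of one polynomial is the frontier of its filled set *)

Section CyclicJulia.
Local Open Scope complex_scope.
Variable R : realType.
Local Notation C := R[i].
Local Notation sd := (@sdist R).
Implicit Types (h q : {poly C}) (z w : C).

Lemma sdistxx (x : sphere R) : sd x x = 0.
Proof. by case: x => [z|] //=; rewrite subrr cabs0 mulr0 mul0r. Qed.

Lemma sdist_lt (e : R) : 0 < e -> forall z w, cabs (z - w) < e / 2 -> sd (Some z) (Some w) < e.
Proof. by move=> e0 z w hw; apply: le_lt_trans (sdist_le z w) _; lra. Qed.

Lemma mopen_near_infty (r : R) :
  mopen sd (fun x : sphere R => if x is Some z then r < cabs z else True).
Proof.
case=> [z|] hz.
  have d0 : 0 < cabs z - r by rewrite subr_gt0.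
  have [e e0 he] := sdist_near (cabs z) d0; exists e => // y hy.
  have [w -> hw] := he z y (lexx _) hy.
  have := cabs_subl z w; lra.
exists (2 / (2 + `|r|)); first by rewrite divr_gt0 // ltr_wpDr.
case=> [w|//] /=.
have w1 := sqrt_1sqr_ge1 (cabs w); have w2 := sqrt_1sqr_le (cabs_ge0 w).
have hr := ler_norm r; have hr0 := normr_ge0 r.
rewrite ltr_pM2l // ltf_pV2 ?posrE; lra.
Qed.

Lemma cyclic_iter h q : cyclic_sg h q -> exists n, forall z, q.[z] = iter n.+1 (horner h) z.
Proof.
elim=> [_|q1 q2 _ [n hn] _ [m hm]]; first by exists 0%N.
by exists (n + m.+1)%N => z; rewrite horner_comp hm hn -iterD addSn.
Qed.

Lemma pext_None q : (1 < size q)%N -> pext q None = None.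
Proof. by move=> h; rewrite /pext ifF // leqNgt h. Qed.

(** Along the ultrafilter the exponents in a sequence of iterates are either constant, and so is the
    sequence, or tend to infinity, and the sequence tends to infinity uniformly beyond the escape
    radius. *)
Lemma Julia1_None h : (2 < size h)%N -> ~ Julia1 h None.
Proof.
move=> sh; apply; exists (fun x => if x is Some z then esc sh < cabs z : Prop else True).
split=> //; first exact: mopen_near_infty.
move=> s hs.
have [N hN] := choice (fun n => cyclic_iter (hs n)).
have pextNone n : pext (s n) None = None.
  have -> : s n = iterp h (N n).+1 by apply: poly_funext => z; rewrite horner_iterp hN.
  by rewrite pext_None // size_iterp.
have [[m hm]|hno] := pselect (exists m, uev (fun n => N n = m)).
  apply: (@normal_seq_of_uev _ _ _ (pext (iterp h m.+1))) => e e0.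
  apply: uev_mono hm => n hn [z|] _; rewrite ?pextNone.
    by rewrite /pext horner_iterp hN hn sdistxx.
  by rewrite pext_None ?sdistxx // size_iterp.
have hbig K : uev (fun n => (K <= N n)%N).
  elim: K => [|K IH]; first exact: uevT.
  have hK : uev (fun n => N n <> K) by apply: uevN => h2; apply: hno; exists K.
  by apply: uev2 IH hK _ => n; rewrite leq_eqVlt => /orP[/eqP ->|].
apply: (@normal_seq_of_uev _ _ _ (fun _ => None)) => e e0.
have [K hK] := invn_lt (divr_gt0 e0 (ltr0n _ 2)).
apply: uev_mono (hbig K) => n hn [z|] hz; last by rewrite pextNone.
have e1 := esc_ge1 sh.
have big : (N n).+1%:R <= cabs (s n).[z].
  have hz1 : esc sh <= cabs z by apply: ltW; exact: hz.
  rewrite hN; apply: le_trans (esc_iter _ hz1).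
  apply: (@le_trans _ _ (2 ^+ (N n).+1)); last by rewrite ler_peMr ?exprn_ge0 //; lra.
  by rewrite -natrX ler_nat; apply: ltnW; apply: ltn_expl.
have b0 : 0 < cabs (s n).[z] by apply: lt_le_trans big; rewrite ltr0n.
apply: le_lt_trans (sdist_None b0) _.
apply: (@le_lt_trans _ _ (2 * (N n).+1%:R^-1)).
  by rewrite ler_wpM2l // lef_pV2 // posrE ltr0n.
have := hK (N n) hn; move: (_^-1) => u; lra.
Qed.

(** The filled set is completely invariant, so a small disc off its frontier satisfies the dichotomy
    for every iterate. *)
Lemma Julia1_frontier h z : (2 < size h)%N -> Julia1 h (Some z) -> frontier (filled h) z.
Proof.
move=> sh hJ; apply: contrapT => hno; apply: hJ.
have hq q y : cyclic_sg h q -> filled h q.[y] <-> filled h y.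
  by move=> /cyclic_iter [n ->]; apply: filled_iter.
have [hz|hz] := pselect (filled h z).
  have [e e0 he] := not_frontier hz hno; apply: (Fatou_of_dichotomy sh e0) => q Gq.
  by left=> y hy; apply/hq => //; apply: he; rewrite cabsB.
have [e e0 he] := closedC_far (filled_closed sh) hz; apply: (Fatou_of_dichotomy sh e0) => q Gq.
by right=> y hy /(hq q y Gq); apply: he; rewrite cabsB.
Qed.

(** The iterates are bounded at [z] and unbounded at points arbitrarily near. A general [F] serves
    both [cyclic_sg h] and the whole semigroup. *)
Lemma frontier_Julia h (F : {poly C} -> Prop) z : (2 < size h)%N ->
  (forall n, F (iterp h n.+1)) -> frontier (filled h) z -> ~ Fatou F (Some z).
Proof.
move=> sh hF [fz hz] /(@Fatou_equibounded _ F (fun q => exists n, q = iterp h n.+1) z (esc sh)).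
case=> [q [n ->] //|q [n ->]|r [M [r0 hM]]].
  by rewrite horner_iterp; move/(filledP sh): fz; apply.
have [y hy nfy] := hz r r0; apply: nfy; exists (Num.max M (cabs y)) => -[|n].
  by rewrite le_max lexx orbT.
by rewrite le_max -horner_iterp hM //; exists n.
Qed.

Lemma cyclic_iterp h n : cyclic_sg h (iterp h n.+1).
Proof.
elim: n => [|n IH]; last by apply: gen_comp IH; apply: (gen_base (fun _ => h) tt).
by rewrite /= comp_polyXr; apply: (gen_base (fun _ => h) tt).
Qed.

Lemma Julia1P h x : (2 < size h)%N -> Julia1 h x <-> ofC (frontier (filled h)) x.
Proof.
move=> sh; split=> [|[z hz ->]]; last by apply: frontier_Julia hz => // n; apply: cyclic_iterp.
case: x => [z|]; last by move/Julia1_None.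
by move/Julia1_frontier => h1; exists z => //; apply: h1.
Qed.

End CyclicJulia.

(** * The semigroup, the set [Khat], and the dense family of frontiers *)

Section Semigroup.
Local Open Scope complex_scope.
Variable R : realType.
Local Notation C := R[i].
Variables (G : {poly C} -> Prop).
Hypothesis Gcomp : forall q r, G q -> G r -> G (q \Po r).
Hypothesis Gdeg : forall q, G q -> (2 < size q)%N.
Hypothesis Gpost : bounded_C (postcrit_star G).
Variable p : {poly C}.
Hypothesis Gp : G p.
Implicit Types (q u : {poly C}) (z w : C).

Let sp := Gdeg Gp.

(** The identity is adjoined so that the filled Julia set of [p] is itself one of the sets
    [Lset u]. *)
Definition monoid_of u := u = 'X \/ G u.

Lemma monoid_size u : monoid_of u -> (1 < size u)%N.
Proof. by case=> [->|/Gdeg/ltnW //]; rewrite size_polyX. Qed.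

Lemma monoid_compl q u : G q -> monoid_of u -> G (q \Po u).
Proof. by move=> Gq [->|Gu]; [rewrite comp_polyXr | apply: Gcomp]. Qed.

Lemma monoid_compr q u : G q -> monoid_of u -> G (u \Po q).
Proof. by move=> Gq [->|Gu]; [rewrite comp_polyX | apply: Gcomp]. Qed.

Lemma monoid_comp v u : monoid_of v -> monoid_of u -> monoid_of (v \Po u).
Proof. by move=> [->|Gv] hu; [rewrite comp_polyX | right; apply: monoid_compl]. Qed.

Lemma monoid_iter n q : G q -> monoid_of (iterp q n).
Proof.
move=> Gq; elim: n => [|n IH]; first by left.
by right; apply: monoid_compl.
Qed.

Lemma iterG n q : G q -> G (iterp q n.+1).
Proof. by move=> Gq; apply: monoid_compl => //; apply: monoid_iter. Qed.

Definition Lset u z := filled p u.[z].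
Definition Eset u := frontier (Lset u).

Lemma crit_postcrit v : crit_values G v -> postcrit_star G v.
Proof. by move=> h e e0; exists (Some v) => //; rewrite sdistxx. Qed.

Lemma crit_bound : exists M : R, forall q c, G q -> (q^`()).[c] = 0 -> cabs q.[c] <= M.
Proof.
have [M hM] := Gpost; exists M => q c Gq hc; apply: hM; apply: crit_postcrit.
by exists q, c.
Qed.

(** For a critical point [c] of [p], each [q.[p.[c]]] is a critical value of [q \Po p], so [p.[c]]
    has a bounded orbit. *)
Lemma Khat_nonempty : exists z, Khat G z.
Proof.
have [M hM] := crit_bound.
have sd : (1 < size (p^`()))%N.
  rewrite ltnNge; apply/negP => h; have p0 : p != 0 by rewrite -size_poly_gt0 (ltn_trans _ sp).
  have := coef_deriv p (size p).-2; rewrite nth_default; last first.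
    by apply: leq_trans h _; case: (size p) sp => [|[|[|n]]].
  have -> : (size p).-2.+1 = (size p).-1 by case: (size p) sp => [|[|n]].
  move/esym/eqP; rewrite mulrn_eq0 -lead_coefE lead_coef_eq0 (negbTE p0) orbF.
  by case: (size p) sp => [|[|n]].
have [c hc] := poly_surj 0 sd; exists p.[c]; exists M => q Gq.
rewrite -horner_comp; apply: hM; first exact: Gcomp.
by rewrite deriv_comp hornerM hc mulr0.
Qed.

Lemma Khat_filled z q : G q -> Khat G z -> filled q z.
Proof.
move=> Gq [M hM]; exists (Num.max M (cabs z)) => -[|n]; first by rewrite le_max lexx orbT.
by rewrite le_max -horner_iterp hM //; apply: iterG.
Qed.

Lemma Khat_horner z q : G q -> Khat G z -> Khat G q.[z].
Proof. by move=> Gq [M hM]; exists M => r Gr; rewrite -horner_comp hM //; apply: Gcomp. Qed.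

Lemma Khat_Lset z u : monoid_of u -> Khat G z -> Lset u z.
Proof.
move=> [->|Gu] Kz; rewrite /Lset ?hornerX; apply: Khat_filled => //; exact: Khat_horner.
Qed.

(** [Khat] is forward invariant and inside the filled set of [p]; hence one bound serves all its
    points, and [Khat] is closed. *)
Lemma Khat_esc z : Khat G z <-> forall q, G q -> cabs q.[z] <= esc sp.
Proof.
split=> [Kz q Gq|h]; last by exists (esc sp).
exact/filled_le/Khat_filled/Khat_horner.
Qed.

Lemma Khat_closed : closedC (Khat G).
Proof.
move=> z hz; apply/Khat_esc => q Gq; rewrite leNgt; apply/negP => hlt.
have e0 : 0 < cabs q.[z] - esc sp by rewrite subr_gt0.
have [d d0 hd] := poly_cont q z e0; have [a /Khat_esc /(_ q Gq) ha /hd] := hz d d0.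
have := cabs_subl q.[z] q.[a]; lra.
Qed.

Lemma Lset_closed u : closedC (Lset u).
Proof.
move=> z hz; apply: (filled_closed sp) => e /(poly_cont u z) [d d0 hd].
by have [a La /hd ha] := hz d d0; exists u.[a].
Qed.

Lemma Lset_bounded u : monoid_of u -> bounded_C (Lset u).
Proof.
move=> hu; have [r r0 hr] := poly_growth (esc sp + 1) (monoid_size hu); exists r => z Lz.
rewrite leNgt; apply/negP => /ltW /hr; have := filled_le sp Lz; lra.
Qed.

Lemma Lset_comp u q z : Lset (u \Po q) z <-> Lset u q.[z].
Proof. by rewrite /Lset horner_comp. Qed.

Lemma Lset_iter n u z : Lset (iterp p n \Po u) z <-> Lset u z.
Proof. by rewrite /Lset horner_comp horner_iterp; apply: filled_iter. Qed.

Lemma LsetX z : Lset 'X z <-> filled p z.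
Proof. by rewrite /Lset hornerX. Qed.

Lemma frontier_preimage (S : C -> Prop) q z : (1 < size q)%N ->
  frontier (fun z => S q.[z]) z <-> frontier S q.[z].
Proof.
move=> sq; split=> -[Sz h]; split=> // e e0.
  have [d d0 hd] := poly_cont q z e0; have [y /hd hy nSy] := h d d0.
  by exists q.[y].
have [d d0 hd] := open_mapping sq e0; have [y hy nSy] := h d d0.
by have [r hr hzr] := hd z y hy; exists r; rewrite ?hr.
Qed.

Lemma Eset_comp u q z : (1 < size q)%N -> Eset (u \Po q) z <-> Eset u q.[z].
Proof.
move=> sq; rewrite /Eset -(frontier_preimage (Lset u)) //.
suff -> : Lset (u \Po q) = (fun z => Lset u q.[z]) by [].
by apply/funext => y; apply/propext; apply: Lset_comp.
Qed.

(* [Eset u] is the limit of the level curves [|p^n u| = rho] for a fixed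
   [rho] above all critical values of the semigroup. *)
Lemma Eset_lconn u : monoid_of u -> lconn (Eset u).
Proof.
move=> hu; have [M hM] := crit_bound; have e1 := esc_ge1 sp.
(* Besides the critical values, [rho] exceeds the escape radius, so that points of [Lset u] stay
   inside all the level curves. *)
pose rho := 1 + `|M| + esc sp.
have hr1 : M < rho by rewrite /rho; have := ler_norm M; lra.
have hr2 : esc sp < rho by rewrite /rho; have := normr_ge0 M; lra.
have r0 : 0 < rho by lra.
clearbody rho.
pose A n z := cabs (iterp p n.+1 \Po u).[z] = rho.
have Gq n : G (iterp p n.+1 \Po u) by apply: monoid_compl => //; apply: iterG.
have hE z n : (iterp p n.+1 \Po u).[z] = iter n.+1 (horner p) u.[z].
  by rewrite horner_comp horner_iterp.
have cA n : lconn (A n).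
  apply: lconn_level => //; first exact/ltnW/Gdeg.
  by move=> c /(hM _ c (Gq n)); lra.
have [B B0 hB] := poly_growth (rho + 1) (monoid_size hu).
have bA n z : A n z -> cabs z <= B.
  rewrite /A hE => hz; rewrite leNgt; apply/negP => /ltW /hB h.
  have h2 : esc sp <= cabs (iter 0 (horner p) u.[z]) by rewrite /=; lra.
  by have := esc_mono (leq0n n.+1) h2; rewrite hz /=; lra.
apply: lconn_eq (lconn_Ulim (uevT bA) (uevT cA)) => z; split=> [hz|[Lz hz] e e0].
  split.
    apply: contrapT => /(nfilledP sp) [N hN].
    have [K hK] := esc_infty (rho + 1) (ltW hN).
    have h1 : rho + 1 <= cabs (iterp p K \Po u).[z] by rewrite horner_comp horner_iterp hK.
    have [d d0 hd] := poly_cont (iterp p K \Po u) z (@ltr01 R).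
    have [n Kn [y Ay hy]] := uev_ex_ge K (hz d d0).
    have := hd y hy; rewrite !horner_comp !horner_iterp in h1 * => h2.
    have h3 : rho < cabs (iter K (horner p) u.[y]).
      have := cabs_subl (iter K (horner p) u.[z]) (iter K (horner p) u.[y]); lra.
    have h4 : esc sp <= cabs (iter K (horner p) u.[y]) by lra.
    have := esc_mono (leqW Kn) h4; move: Ay; rewrite /A hE => ->; lra.
  move=> e e0; have [n [y Ay hy]] := uev_ex (hz e e0); exists y => // Ly.
  have /(filledP sp) /(_ n.+1) := Ly; move: Ay; rewrite /A hE => ->; lra.
have [y hy /(nfilledP sp) [N hN]] := hz e e0.
have [K hK] := esc_infty (rho + 1) (ltW hN).
apply: (@uev_ev K) => n Kn.
have [] := @level_in_lconn _ (iterp p n.+1 \Po u) rho _ z y (@lconn_disc _ z e).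
- by rewrite subrr cabs0.
- by rewrite cabsB.
- by rewrite hE; apply: le_lt_trans hr2; have /(filledP sp) := Lz; apply.
- by rewrite hE; have := hK n.+1 (leqW Kn); lra.
by move=> w hw hwr; exists w; rewrite // cabsB.
Qed.

Definition Jset z := Julia G (Some z).

(** The polynomials [p^n u] are bounded at [z] and unbounded at points arbitrarily near. *)
Lemma Eset_sub u z : monoid_of u -> Eset u z -> Jset z.
Proof.
move=> hu [Lz hz] /(@Fatou_equibounded _ G (fun q => exists n, q = iterp p n.+1 \Po u) z (esc sp)).
case=> [q [n ->]|q [n ->]|r [M [r0 hM]]].
- by apply: monoid_compl => //; apply: iterG.
- by rewrite horner_comp horner_iterp; move/(filledP sp): Lz; apply.
have [y hy nfy] := hz r r0; apply: nfy; exists (Num.max M (cabs u.[y])) => -[|n].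
  by rewrite le_max lexx orbT.
by rewrite le_max -horner_iterp -horner_comp hM //; exists n.
Qed.

Lemma Jset_closed : closedC Jset.
Proof.
move=> z hz [U [oU Uz nU]]; have [e e0 he] := oU _ Uz.
have e2 : 0 < e / 2 by lra.
have [a Ja ha] := hz _ e2; apply: Ja; exists U; split=> //; apply: he.
exact: sdist_lt.
Qed.

(** A disc that misses [Eset u] lies in [Lset u] or in its complement, which is the dichotomy that
    gives normality. *)
Lemma Fatou_disc z (e : R) : 0 < e ->
  (forall u y, G u -> cabs (z - y) < e -> ~ Eset u y) -> ~ Jset z.
Proof.
move=> e0 hno; apply; apply: (Fatou_of_dichotomy sp e0) => u Gu.
have hP : lconst (fun y => cabs (y - z) < e) (Lset u).
  by apply: lconst_off_frontier (Lset_closed (u := u)) _ => y hy; apply: hno; rewrite // cabsB.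
have h := lconn_iff (@lconn_disc _ z e) hP.
have zz : cabs (z - z) < e by rewrite subrr cabs0.
by case: (pselect (Lset u z)) => Lz; [left | right] => y hy; [apply/(h y z hy zz) | move=> /(h y z hy zz)].
Qed.

Lemma JsetP z : Jset z <-> clC (fun y => exists2 u, monoid_of u & Eset u y) z.
Proof.
split=> [Jz e e0|hz].
  apply: contrapT => hno; apply: (@Fatou_disc z e e0) Jz => u y Gu hy Ey.
  by apply: hno; exists y => //; exists u => //; right.
by apply: Jset_closed => e /hz [a [u hu Ea]]; exists a => //; apply: Eset_sub Ea.
Qed.

Lemma Jset_preimage q z : G q -> Jset q.[z] -> Jset z.
Proof.
move=> Gq /JsetP h; apply/JsetP => e e0.
have sq := ltnW (Gdeg Gq).
have [d d0 hd] := open_mapping sq e0; have [a [u hu Ea] ha] := h d d0.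
have [r hr hzr] := hd z a ha; exists r => //; exists (u \Po q).
  by right; apply: monoid_compr.
by apply/Eset_comp; rewrite ?hr.
Qed.

Lemma frontier_Khat_Jset z : frontier (Khat G) z -> Jset z.
Proof.
move=> [Kz hz] /(@Fatou_equibounded _ G G z (esc sp)).
case=> [q //|q Gq|r [M [r0 hM]]]; first exact: (proj1 (Khat_esc z) Kz q Gq).
have [y hy nKy] := hz r r0; apply: nKy; exists M => q Gq; exact: hM.
Qed.

(** Near an interior point of [Khat] all elements take values in the filled set of [p]. *)
Lemma Jset_Khat_frontier z : Jset z -> Khat G z -> frontier (Khat G) z.
Proof.
move=> Jz Kz; apply: contrapT => hno; have [e e0 he] := not_frontier Kz hno.
apply: Jz; apply: (Fatou_of_dichotomy sp e0) => q Gq; left=> y hy.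
by apply: Khat_filled => //; apply: Khat_horner => //; apply: he; rewrite cabsB.
Qed.

Lemma frontier_filled_Jset q z : G q -> frontier (filled q) z -> Jset z.
Proof. by move=> Gq; apply: (frontier_Julia (Gdeg Gq)) => n; apply: iterG. Qed.

End Semigroup.

(** * Lagrange interpolation and a Bernstein-Walsh inequality *)

Section BernsteinWalsh.
Local Open Scope complex_scope.
Variable R : realType.
Local Notation C := R[i].
Implicit Types (q : {poly C}) (x y z w : C).

(** With truncated subtraction [(i - j) + (j - i)] is the distance of [i] and [j]; the product is
    the Lagrange denominator for the nodes [0, ..., n]. *)
Lemma prod_dist_fact n i : (i <= n)%N ->
  (\prod_(0 <= j < n.+1 | j != i) ((i - j) + (j - i)) = i`! * (n - i)`!)%N.
Proof.
have full m : (\prod_(0 <= j < m) (m - j) = m`!)%N.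
  elim: m => [|m IH]; first by rewrite big_nil.
  by rewrite big_nat_recl // subn0 factS -IH.
elim: n i => [|n IH] i.
  rewrite leqn0 => /eqP ->; rewrite big_mkcond big_nat1 //=.
rewrite leq_eqVlt => /orP[/eqP ->|hi].
  rewrite subnn fact0 muln1 -full big_mkcond big_nat_recr //= eqxx /= muln1 [RHS]big_nat_recr //=.
  rewrite subSnn muln1 [LHS]big_nat_recr //= neq_ltn ltnSn /= subSnn.
  have -> : (n - n.+1 = 0)%N by apply/eqP; rewrite subn_eq0.
  rewrite addn0 muln1; apply: eq_big_nat => j /andP[_ hj].
  rewrite neq_ltn ltnS (ltnW hj) /=.
  have -> : (j - n.+1 = 0)%N by apply/eqP; rewrite subn_eq0 ltnW // ltnS ltnW.
  by rewrite addn0.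
rewrite big_mkcond big_nat_recr //= -big_mkcond IH // gtn_eqF //=.
have -> : (i - n.+1 = 0)%N by apply/eqP; rewrite subn_eq0 ltnW.
by rewrite add0n subSn -1?ltnS // factS -mulnA; congr (_ * _)%N; rewrite mulnC.
Qed.

Lemma bin_le_pow2 n k : ('C(n, k) <= 2 ^ n)%N.
Proof.
elim: n k => [|n IH] [|k]; rewrite ?bin0 ?expn_gt0 ?bin0n //.
by rewrite binS expnS mul2n -addnn leq_add.
Qed.

(** The falling factorial of [2n] with [n] factors dominates [n ^ n] and is a binomial coefficient
    times [n!]. *)
Lemma pow_self_le_fact n : (n ^ n <= 4 ^ n * n`!)%N.
Proof.
apply: (@leq_trans ((n + n) ^_ n)%N).
  rewrite ffact_prod -{2}[n]card_ord -prod_nat_const.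
  by apply: leq_prod => i _; rewrite leq_subRL ?leq_add // ltnW // (leq_trans (ltn_ord i)) // leq_addr.
rewrite -bin_ffact leq_mul2r; apply/orP; right.
by apply: leq_trans (bin_le_pow2 _ _) _; rewrite addnn -mul2n expnM.
Qed.

Lemma sum_inv_fact n : \sum_(i < n.+1) ((i`! * (n - i)`!)%:R)^-1 <= (2 ^ n)%:R / n`!%:R :> R.
Proof.
have h (i : 'I_n.+1) : ((i`! * (n - i)`!)%:R)^-1 = 'C(n, i)%:R / n`!%:R :> R.
  have hi : (i <= n)%N by rewrite -ltnS.
  have f0 : (i`! * (n - i)`!)%:R != 0 :> R by rewrite pnatr_eq0 muln_eq0 negb_or -!lt0n !fact_gt0.
  rewrite -(bin_fact hi) [(_ * _)%:R in RHS]natrM invfM mulrA divff ?mul1r //.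
  by rewrite pnatr_eq0 -lt0n bin_gt0.
rewrite (eq_bigr _ (fun i _ => h i)) -mulr_suml -natr_sum ler_wpM2r ?invr_ge0 // ler_nat.
rewrite -[2%N]/(1 + 1)%N expnDn; apply: leq_sum => i _.
by rewrite !exp1n !muln1.
Qed.

(** The [i]-th Lagrange basis polynomial at [w] is at most [(m / d) ^+ n] divided by [i! (n - i)!],
    and these reciprocals are summed by [sum_inv_fact]. *)
Lemma lagrange_bound q (x : nat -> C) (n : nat) (d m M : R) w : (0 < n)%N -> (size q <= n.+1)%N ->
  0 < d -> 0 <= m -> 0 <= M ->
  (forall i j, d * ((i - j) + (j - i))%:R <= cabs (x i - x j)) ->
  (forall i, (i <= n)%N -> cabs q.[x i] <= M) ->
  (forall i, (i <= n)%N -> cabs (w - x i) <= m) ->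
  cabs q.[w] <= M * (m / d) ^+ n * ((2 ^ n)%:R / n`!%:R).
Proof.
move=> n0 sq d0 m0 M0 hx hq hw.
have xinj : injective x.
  move=> i j hij; have := hx i j; rewrite hij subrr cabs0 pmulr_rle0 // => h.
  have : ((i - j) + (j - i) <= 0)%N by rewrite -(ler_nat R).
  lia.
rewrite (lagrange_gen (ltn0Sn n) xinj sq) horner_sum.
apply: le_trans (cabs_sum _ _) _.
apply: (@le_trans _ _ (\sum_(i < n.+1) M * (m / d) ^+ n * ((i`! * (n - i)`!)%:R)^-1)); last first.
  by rewrite -mulr_sumr ler_wpM2l ?sum_inv_fact // mulr_ge0 // exprn_ge0 // divr_ge0 // ltW.
apply: ler_sum => i _.
have hi : (i <= n)%N by rewrite -ltnS.
rewrite hornerM hornerC cabsM lagrangeE //; cbv zeta; rewrite hornerM hornerC -mulrA; apply: ler_pM; rewrite ?cabs_ge0 //.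
  exact: hq.
have hprod (P : pred nat) (F : nat -> C) : cabs (\prod_(j < n.+1 | P j) F j) = \prod_(j < n.+1 | P j) cabs (F j).
  by apply: (big_morph (@cabs R)); [exact: cabsM | exact: cabs1].
have hlow : d ^+ n * (i`! * (n - i)`!)%:R <= cabs (\prod_(j < n.+1 | (j : nat) != i) (x i - x j)).
  rewrite (hprod (fun j => j != i) (fun j => x i - x j)) -(prod_dist_fact hi) big_mkord natr_prod.
  have -> : d ^+ n = \prod_(j < n.+1 | (j : nat) != i) d.
    rewrite prodr_const; congr (_ ^+ _).
    by transitivity #|predC1 i|; [rewrite cardC1 card_ord | apply: eq_card].
  rewrite -big_split /=; apply: ler_prod => j _.
  by rewrite hx mulr_ge0 // ltW.
have hup : cabs (\prod_(j < n.+1 | (j : nat) != i) (w - x j)) <= m ^+ n.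
  rewrite (hprod (fun j => j != i) (fun j => w - x j)).
  apply: (@le_trans _ _ (\prod_(j < n.+1 | (j : nat) != i) m)).
    by apply: ler_prod => j _; rewrite cabs_ge0 hw // -ltnS.
  by rewrite prodr_const (_ : #|_| = n) //; transitivity #|predC1 i|; [apply: eq_card | rewrite cardC1 card_ord].
have pos : 0 < d ^+ n * (i`! * (n - i)`!)%:R.
  by rewrite mulr_gt0 ?exprn_gt0 // ltr0n muln_gt0 !fact_gt0.
rewrite !horner_prod.
under eq_bigr do rewrite hornerXsubC.
under [X in _ * X]eq_bigr do rewrite hornerXsubC.
rewrite cabsM cabsV expr_div_n mulrC -mulrA -invfM; apply: ler_pM => //; rewrite ?cabs_ge0 ?invr_ge0 ?cabs_ge0 //.
by rewrite lef_pV2 ?posrE // (lt_le_trans pos).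
Qed.

(* Equally spaced interpolation nodes exist on a set meeting all the circles
   [|x - c| = t] with [t <= r]; the constant 8 comes from
   [sum_i C(n, i) = 2^n] and [n^n <= 4^n n!]. *)
Lemma bernstein_walsh q (c : C) (r M : R) : (1 < size q)%N -> 0 < r -> 0 <= M ->
  (forall t, 0 <= t <= r -> exists2 x, cabs (x - c) = t & cabs q.[x] <= M) ->
  forall w, cabs q.[w] <= M * (8 * (cabs (w - c) + r) / r) ^+ (size q).-1.
Proof.
move=> sq r0 M0 hr w; pose n := (size q).-1.
have n0 : (0 < n)%N by rewrite /n deg_gt0.
have nR : 0 < n%:R :> R by rewrite ltr0n.
pose d := r / n%:R; have d0 : 0 < d by rewrite divr_gt0.
have hex j : exists x, cabs (x - c) = j%:R * d /\ ((j <= n)%N -> cabs q.[x] <= M).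
  case: (leqP j n) => hj.
    have [|x h1 h2] := hr (j%:R * d); last by exists x.
    rewrite mulr_ge0 ?(ltW d0) //= /d mulrA ler_pdivrMr // mulrC ler_wpM2l ?(ltW r0) // ler_nat //.
  (* The interpolation formula takes an injective sequence over all naturals, so the nodes past [n]
     are put on a ray; nothing is asked of [q] there. *)
  exists (c + (j%:R * d)%:C); split=> //.
  by rewrite addrAC subrr add0r cabs_real ger0_norm // mulr_ge0 // ltW.
have [x hx] := choice hex.
have m0 := cabs_ge0 (w - c).
have := @lagrange_bound q x n d (cabs (w - c) + r) M w n0 _ d0 _ M0 _ _ _.
have h1 : (size q <= n.+1)%N by rewrite /n prednK // ltnW.
have h2 : 0 <= cabs (w - c) + r by lra.
move=> /(_ h1 h2) h; apply: le_trans (h _ _ _) _ => {h}.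
- move=> i j; have [hi _] := hx i; have [hj _] := hx j.
  have := cabs_subl (x i - c) (x j - c); have := cabs_subl (x j - c) (x i - c).
  have -> : x i - c - (x j - c) = x i - x j by ring.
  have -> : x j - c - (x i - c) = x j - x i by ring.
  rewrite (cabsB (x j) (x i)) hi hj => k1 k2.
  case: (leqP i j) => hij.
    have -> : (i - j = 0)%N by apply/eqP; rewrite subn_eq0.
    rewrite add0n natrB //; lra.
  have -> : (j - i = 0)%N by apply/eqP; rewrite subn_eq0 ltnW.
  rewrite addn0 natrB ?(ltnW hij) //; lra.
- by move=> i hi; apply: (hx i).2.
- move=> i hi; have [k1 _] := hx i; have := cabs_tri c w (x i); rewrite (cabsB c (x i)) k1.
  have : i%:R * d <= r.
    rewrite /d mulrA ler_pdivrMr // mulrC ler_wpM2l ?(ltW r0) // ler_nat //.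
  lra.
rewrite -/n -mulrA ler_wpM2l //.
have -> : 8 * (cabs (w - c) + r) / r = 4 * (2 * ((cabs (w - c) + r) / d)) / n%:R.
  by rewrite /d; field; rewrite !gt_eqF.
move: ((cabs (w - c) + r) / d) (divr_ge0 h2 (ltW d0)) => u u0.
have f0 : 0 < n`!%:R :> R by rewrite ltr0n fact_gt0.
have nn : 0 < n%:R ^+ n :> R by rewrite exprn_gt0.
have hk : n%:R ^+ n <= 4 ^+ n * n`!%:R :> R by rewrite -!natrX -natrM ler_nat pow_self_le_fact.
rewrite expr_div_n !exprMn natrX ler_pdivlMr //.
have hq : n%:R ^+ n / n`!%:R <= 4 ^+ n :> R by rewrite ler_pdivrMr.
have -> : u ^+ n * (2 ^+ n / n`!%:R) * n%:R ^+ n = (2 ^+ n * u ^+ n) * (n%:R ^+ n / n`!%:R) by ring.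
by rewrite [leRHS]mulrC ler_wpM2l // mulr_ge0 ?exprn_ge0.
Qed.

End BernsteinWalsh.

(** * Splitting the Julia set into two closed parts *)

Section BoundedJulia.
Local Open Scope complex_scope.
Variable R : realType.
Local Notation C := R[i].
Variables (G : {poly C} -> Prop).
Hypothesis Gcomp : forall q r, G q -> G r -> G (q \Po r).
Hypothesis Gdeg : forall q, G q -> (2 < size q)%N.
Hypothesis Gpost : bounded_C (postcrit_star G).
Variable p : {poly C}.
Hypothesis Gp : G p.
Implicit Types (q u s v : {poly C}) (z w : C).

Let sp := Gdeg Gp.
Let Lc u : closedC (Lset p u) := @Lset_closed _ _ Gdeg _ Gp u.

(** If the circle missed [Lset p u], the connected set [Eset p u] would have a point on each side of
    it: the farthest point of the part inside, and the farthest point of the whole. *)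
Lemma Lset_circle u c w (t : R) : monoid_of G u -> Lset p u c -> Lset p u w ->
  0 <= t <= cabs (w - c) -> exists2 x, cabs (x - c) = t & Lset p u x.
Proof.
move=> hu Lc0 Lw /andP[t0 tw].
have [->|tn0] := eqVneq t 0; first by exists c; rewrite // subrr cabs0.
have [->|tnw] := eqVneq t (cabs (w - c)); first by exists w.
have tp : 0 < t by rewrite lt_neqAle eq_sym tn0.
have {tw tnw}tw : t < cabs (w - c) by rewrite lt_neqAle tnw.
apply: contrapT => hno.
have off x : Lset p u x -> cabs (x - c) != t by move=> Lx; apply/eqP => h; apply: hno; exists x.
have [B hB] := Lset_bounded Gdeg Gp hu.
have [x [Ex hx]] : exists x, Eset p u x /\ cabs (x - c) < t.
  pose S z := Lset p u z /\ cabs (z - c) <= t.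
  have cS : closedC S.
    move=> z hz; split; first by apply: Lc => e /hz [a [La _]]; exists a.
    rewrite leNgt; apply/negP => hlt; have e0 : 0 < cabs (z - c) - t by rewrite subr_gt0.
    have [a [_ ha] hza] := hz _ e0; have := cabs_tri a z c; lra.
  have [|||x [[Lx hx] hfx] _] := @farthest_frontier _ S c.
  - by exists c; split; rewrite // subrr cabs0.
  - by exists B => z [/hB].
  - exact: cS.
  have {}hx : cabs (x - c) < t by rewrite lt_neqAle off.
  exists x; split=> //; split=> // e e0.
  have d0 : 0 < Num.min e (t - cabs (x - c)) by rewrite lt_min e0 subr_gt0.
  have [y hy nSy] := hfx _ d0; move: hy; rewrite lt_min => /andP[y1 y2].
  exists y => // Ly; apply: nSy; split=> //; have := cabs_tri x y c; rewrite (cabsB y x); lra.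
have [y [Ey hy]] : exists y, Eset p u y /\ t < cabs (y - c).
  have [|||y [Ly hfy] hy] := @farthest_frontier _ (Lset p u) c.
  - by exists c.
  - by exists B.
  - exact: Lc.
  by exists y; split=> //; apply: lt_le_trans tw (hy w Lw).
have sX : (1 < size ('X - c%:P)%R)%N by rewrite size_XsubC.
have cE := Eset_lconn Gcomp Gdeg Gpost Gp hu.
have [||z [Lz _]] := level_in_lconn (q := 'X - c%:P) cE Ex Ey (rho := t).
- by rewrite hornerXsubC.
- by rewrite hornerXsubC.
by rewrite hornerXsubC; apply/eqP/off.
Qed.

Variables (X Y : C -> Prop).
Hypothesis JXY : forall z, Jset G z <-> X z \/ Y z.
Hypothesis disXY : forall z, X z -> Y z -> False.
Hypothesis clX : closedC X.
Hypothesis clY : closedC Y.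
Variables (k0 x0 : C) (rho : R).
Hypothesis Kk0 : Khat G k0.
Hypothesis Yx0 : Y x0.
Hypothesis Yrho : forall y, Y y -> cabs (y - k0) <= rho.

Lemma Eset_side u : monoid_of G u -> (forall z, Eset p u z -> X z) \/ (forall z, Eset p u z -> Y z).
Proof.
move=> hu; have EJ z : Eset p u z -> X z \/ Y z by move=> /(Eset_sub Gcomp Gdeg Gp hu) /JXY.
case: (pselect (exists2 z, Eset p u z & X z)) => [[z Ez Xz]|h]; last first.
  by right=> z Ez; case: (EJ z Ez) => // Xz; case: h; exists z.
have hP : lconst (Eset p u) X.
  move=> a Ea; case: (EJ a Ea) => ha.
    have [e e0 he] := closedC_far clY (fun h => disXY ha h).
    by exists e => // b Eb hb; split=> // _; case: (EJ b Eb) => // /(he b hb).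
  have [e e0 he] := closedC_far clX (fun h => disXY h ha).
  by exists e => // b Eb hb; split=> [h|/(he b hb)//]; case: (disXY h ha).
left=> w Ew; exact: (Eset_lconn Gcomp Gdeg Gpost Gp hu hP Ez Ew Xz).
Qed.

(** The elements whose growth beyond the disc can be controlled; for all others [Lset p u] contains
    a fixed disc about [x0], by [high_disc]. *)
Definition low u := forall z, Lset p u z -> cabs (z - k0) <= rho.

Lemma low_of_Eset u (S : C -> Prop) : monoid_of G u -> (forall z, Eset p u z -> S z) ->
  (forall z, S z -> cabs (z - k0) <= rho) -> low u.
Proof.
move=> hu ES hS z Lz.
have [|x Ex hx] := farthest_frontier k0 (ex_intro _ k0 (Khat_Lset Gcomp Gp hu Kk0)) _ (@Lc u).
  exact: (Lset_bounded Gdeg Gp hu).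
by apply: le_trans (hx z Lz) (hS x (ES x Ex)).
Qed.

Lemma Eset_near_Y y (e : R) : Y y -> 0 < e -> exists v a, [/\ monoid_of G v, cabs (y - a) < e,
  Eset p v a & forall z, Eset p v z -> Y z].
Proof.
move=> Yy e0; have [d d0 hd] := closedC_far clX (fun h => disXY h Yy).
have /(JsetP Gcomp Gdeg Gp) hy : Jset G y by apply/JXY; right.
have m0 : 0 < Num.min e d by rewrite lt_min e0.
have [a [v hv Ea]] := hy _ m0; rewrite lt_min => /andP[h1 h2].
exists v, a; split=> //; case: (Eset_side hv) => // h.
by case: (hd a h2); apply: h.
Qed.

(* Two disjoint frontiers of sets with a common point are nested. *)
Lemma low_or_Y u : monoid_of G u -> low u \/ (forall z, Eset p u z -> X z) /\ (forall y, Y y -> Lset p u y).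
Proof.
move=> hu; case: (Eset_side hu) => EX; last by left; apply: low_of_Eset EX Yrho.
case: (pselect (forall y, Y y -> Lset p u y)) => [|/existsNP[y /not_implyP[Yy nLy]]]; first by right.
left; have [e e0 he] := closedC_far (@Lc u) nLy.
(* A frontier inside [Y] with a point off [Lset p u]; it stays off, since it cannot cross
   [Eset p u], which lies in [X]. *)
have [v [a [hv hya Ea EvY]]] := Eset_near_Y Yy e0.
have lowv : low v by apply: low_of_Eset EvY Yrho.
have dis z : Eset p u z -> Eset p v z -> False by move=> /EX h1 /EvY; apply: disXY.
have Evu z : Eset p v z -> ~ Lset p u z.
  move=> Ez Lz; have [w Ew Fw] := lconn_meets_frontier (@Lc u) (Eset_lconn Gcomp Gdeg Gpost Gp hv) Ez Lz Ea (he a hya).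
  exact: dis Fw Ew.
have k0u := Khat_Lset Gcomp Gp hu Kk0; have k0v := Khat_Lset Gcomp Gp hv Kk0.
case: (pselect (exists2 z, Eset p u z & Lset p v z)) => [[z Ez Lz]|hno].
  have EL w : Eset p u w -> Lset p v w.
    move=> Ew; apply: contrapT => nLw.
    have [b Eb Fb] := lconn_meets_frontier (@Lc v) (Eset_lconn Gcomp Gdeg Gpost Gp hu) Ez Lz Ew nLw.
    exact: dis Eb Fb.
  exact: low_of_Eset EL lowv.
(* Now neither frontier meets the other set, so the compact set [S], which contains [k0], would be
   open: impossible at its point farthest from [k0]. *)
exfalso; pose S z := Lset p u z /\ Lset p v z.
have [B hB] := Lset_bounded Gdeg Gp hu.
have [|||x [[Lux Lvx] hx] _] := @farthest_frontier _ S k0.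
- by exists k0.
- by exists B => z [/hB].
- by move=> z hz; split; apply: Lc => d /hz [b [h1 h2]]; exists b.
have [d1 d10 h1] : exists2 d : R, 0 < d & forall y, cabs (x - y) < d -> Lset p u y.
  by apply: not_frontier => // Fx; apply: hno; exists x.
have [d2 d20 h2] : exists2 d : R, 0 < d & forall y, cabs (x - y) < d -> Lset p v y.
  by apply: not_frontier => // Fx; apply: Evu Fx Lux.
have d0 : 0 < Num.min d1 d2 by rewrite lt_min d10.
have [w] := hx _ d0; rewrite lt_min => /andP[w1 w2]; apply; split; [exact: h1 | exact: h2].
Qed.

(** By [low_or_Y] the set contains [x0] and has its frontier in [X], which the disc avoids. *)
Lemma high_disc u (e : R) : monoid_of G u -> ~ low u -> (forall z, cabs (z - x0) <= e -> ~ X z) ->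
  forall z, cabs (z - x0) <= e -> Lset p u z.
Proof.
move=> hu nlow hX z hz; have [//|[EX YL]] := low_or_Y hu; apply: contrapT => nLz.
have e0 : 0 <= e by apply: le_trans hz; apply: cabs_ge0.
have x0e : cabs (x0 - x0) <= e by rewrite subrr cabs0.
have [w hw Fw] := lconn_meets_frontier (@Lc u) (@lconn_cdisc _ x0 e) x0e (YL _ Yx0) hz nLz.
exact: hX hw (EX w Fw).
Qed.

End BoundedJulia.

(** * Growth of polynomials compared with their degree *)

Section DegreeGrowth.
Local Open Scope complex_scope.
Variable R : realType.
Local Notation C := R[i].
Implicit Types (q u s v : {poly C}) (z w : C).

(** The right-hand side is the chord over [[0, 1]] of a convex function of [eta]. *)
Lemma exp1p_le (eta : R) m : 0 <= eta <= 1 -> (1 + eta) ^+ m <= 1 + (2 ^+ m - 1) * eta.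
Proof.
move=> /andP[e0 e1]; elim: m => [|m IH]; first by rewrite !expr0; lra.
have h : 1 <= 2 ^+ m :> R by rewrite exprn_ege1 // ler1n.
rewrite !exprS; move: ((1 + eta) ^+ m) (2 ^+ m) IH h => a b IH h.
have h1 : (1 + eta) * a <= (1 + eta) * (1 + (b - 1) * eta) by rewrite ler_wpM2l //; lra.
have h2 : 0 <= (b - 1) * (eta * (1 - eta)) by rewrite !mulr_ge0 ?subr_ge0.
lra.
Qed.

Lemma root_gt1 (kappa : R) m : 1 < kappa -> exists2 theta : R, 1 < theta & theta ^+ m <= kappa.
Proof.
move=> k1; have h : 0 < 2 ^+ m :> R by rewrite exprn_gt0.
have k0 : 0 < (kappa - 1) / 2 ^+ m by rewrite divr_gt0 // subr_gt0.
have [e [e0 e1]] := pos_below ltr01 k0; rewrite ler_pdivlMr // => e2.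
exists (1 + e); first lra.
by apply: le_trans (exp1p_le _ _) _; [rewrite (ltW e0) | lra].
Qed.

Lemma exp_large (theta B : R) : 1 < theta -> exists N, forall n, (N <= n)%N -> B <= theta ^+ n.
Proof.
move=> t1; have tp : 0 < theta by lra.
have [N hN] : exists N, theta^-1 ^+ N <= (1 + `|B|)^-1.
  apply: expr_small; last by rewrite invr_gt0 ltr_wpDr.
  by rewrite invr_ge0 (ltW tp) /= invf_lt1.
exists N => n hn; apply: (@le_trans _ _ (theta ^+ N)); last by rewrite ler_weXn2l // ltW.
rewrite exprVn lef_pV2 ?posrE ?exprn_gt0 ?ltr_wpDr // in hN.
have := ler_norm B; lra.
Qed.

Lemma cabs_sqr (x y : R) : cabs (x +i* y) ^+ 2 = x ^+ 2 + y ^+ 2.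
Proof. by rewrite /cabs sqr_sqrtr // addr_ge0 // sqr_ge0. Qed.

(* Pythagoras: moving outward along a ray beyond a disc multiplies the
   distances to the points of the disc by a factor bounded away from 1. *)
Lemma outward_ratio (c nu : C) (rho d : R) : cabs nu = 1 -> 0 <= rho -> 0 < d ->
  exists2 kappa : R, 1 < kappa & forall r, cabs (r - c) <= rho ->
    kappa * cabs (c + (rho + d)%:C * nu - r) <= cabs (c + (rho + 2 * d)%:C * nu - r).
Proof.
move=> n1 r0 d0; have nu0 : nu != 0 by rewrite -cabs_gt0 n1.
pose m := (2 * rho + d) ^+ 2; have m0 : 0 < m by rewrite exprn_gt0 //; lra.
have dm : 0 < d ^+ 2 / m by rewrite divr_gt0 // exprn_gt0.
have [e [e0 e1]] := pos_below ltr01 dm; rewrite ler_pdivlMr // => e2.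
exists (1 + e); first lra.
move=> r hr; pose a := (r - c) / nu.
have ha (t : R) : cabs (c + t%:C * nu - r) = cabs (t%:C - a).
  have -> : c + t%:C * nu - r = (t%:C - a) * nu by rewrite /a; field.
  by rewrite cabsM n1 mulr1.
have har : cabs a <= rho by rewrite /a cabs_div n1 divr1.
rewrite !ha; clearbody a; case: a har {ha} => x y har.
have hx : x <= rho by have h : `|x| <= cabs (x +i* y) := cabs_Re (x +i* y); have := ler_norm x; lra.
have hy : x ^+ 2 + y ^+ 2 <= rho ^+ 2.
  by rewrite -cabs_sqr lerXn2r ?nnegrE ?cabs_ge0.
have sq (t : R) : cabs (t%:C - (x +i* y)) ^+ 2 = (t - x) ^+ 2 + y ^+ 2.
  by rewrite -[t%:C - _]/((t - x) +i* (0 - y)) cabs_sqr sub0r sqrrN.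
rewrite -(@ler_pXn2r _ 2) ?nnegrE ?mulr_ge0 ?cabs_ge0 //; last lra.
rewrite exprMn !sq.
have hx' : 0 <= rho + x.
  by have h : `|x| <= cabs (x +i* y) := cabs_Re (x +i* y); have := ler_norm (- x); rewrite normrN; lra.
have p1 : 0 <= (rho + d) * (rho + x) by rewrite mulr_ge0 //; lra.
have p2 : 0 <= d * (rho - x) by rewrite mulr_ge0 ?subr_ge0 // ltW.
have h1 : (rho + d - x) ^+ 2 + y ^+ 2 <= m by rewrite /m; lra.
have h2 : (rho + d - x) ^+ 2 + y ^+ 2 + 3 * d ^+ 2 <= (rho + 2 * d - x) ^+ 2 + y ^+ 2 by lra.
have h3 : (1 + e) ^+ 2 <= 1 + 3 * e by nra.
have h0 : 0 <= (rho + d - x) ^+ 2 + y ^+ 2 by rewrite addr_ge0 ?sqr_ge0.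
move: (_ + _) h0 h1 h2 => S S0 h1 h2; clearbody m.
apply: (le_trans _ h2); nra.
Qed.

Lemma deg_comp q u : (size (q \Po u)).-1 = ((size q).-1 * (size u).-1)%N.
Proof. exact: size_comp_poly. Qed.

Lemma deg_iterp (p : {poly C}) n : (size (iterp p n)).-1 = ((size p).-1 ^ n)%N.
Proof.
elim: n => [|n IH]; first by rewrite /= size_polyX.
by rewrite [iterp p n.+1]/= deg_comp IH expnS.
Qed.

Lemma poly_roots_ratio q (x y : C) (kappa : R) : 0 <= kappa ->
  (forall r, q.[r] = 0 -> kappa * cabs (x - r) <= cabs (y - r)) ->
  kappa ^+ (size q).-1 * cabs q.[x] <= cabs q.[y].
Proof.
move=> k0; have [->|q0] := eqVneq q 0; first by rewrite !horner0 cabs0 mulr0.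
case: (poly_factors q) => rs [hq /(_ q0) hs] hr.
have {}hr r : r \in rs -> kappa * cabs (x - r) <= cabs (y - r).
  move=> rin; apply: hr; apply/eqP; rewrite hq horner_factors mulf_eq0 prodf_seq_eq0.
  by apply/orP; right; apply/hasP; exists r => //=; rewrite subrr.
rewrite [in q.[x]]hq [in leRHS]hq !horner_factors !cabsM !cabs_prod mulrCA -hs ler_wpM2l ?cabs_ge0 //.
elim: (rs) hr => [|r s IH] hr; first by rewrite !big_nil expr0 mulr1.
rewrite !big_cons exprS mulrACA; apply: ler_pM.
- by rewrite mulr_ge0 // cabs_ge0.
- by rewrite mulr_ge0 ?exprn_ge0 // prodr_ge0 // => i _; apply: cabs_ge0.
- by apply: hr; rewrite mem_head.
by apply: IH => v vs; apply: hr; rewrite inE vs orbT.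
Qed.

End DegreeGrowth.

(** * A disconnected Julia set is bounded in the plane *)

Section JuliaBounded.
Local Open Scope complex_scope.
Variable R : realType.
Local Notation C := R[i].
Variables (G : {poly C} -> Prop).
Hypothesis Gcomp : forall q r, G q -> G r -> G (q \Po r).
Hypothesis Gdeg : forall q, G q -> (2 < size q)%N.
Hypothesis Gpost : bounded_C (postcrit_star G).
Variable p : {poly C}.
Hypothesis Gp : G p.
Implicit Types (q u s v : {poly C}) (z w : C).

Let sp := Gdeg Gp.

Section Contradiction.
Variables (X Y : C -> Prop).
Hypothesis JXY : forall z, Jset G z <-> X z \/ Y z.
Hypothesis disXY : forall z, X z -> Y z -> False.
Hypothesis clX : closedC X.
Hypothesis clY : closedC Y.
Hypothesis unbounded : forall M : R, exists2 z, Jset G z & M < cabs z.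
Variables (k0 nu : C) (rho dl : R).
Hypothesis Kk0 : Khat G k0.
Hypothesis nu1 : cabs nu = 1.
Hypothesis rho0 : 0 <= rho.
Hypothesis dl0 : 0 < dl.
Hypothesis Yx0 : Y (k0 + rho%:C * nu).
Hypothesis Yrho : forall y, Y y -> cabs (y - k0) <= rho.
Hypothesis Xfar : forall z, cabs (z - (k0 + rho%:C * nu)) <= 2 * dl -> ~ X z.

Let x1 := k0 + (rho + dl)%:C * nu.
Let x2 := k0 + (rho + 2 * dl)%:C * nu.
Let lo := low p k0 rho.
Let d := (size p).-1.

Let ray_dist (t : R) : 0 <= t -> cabs (k0 + t%:C * nu - k0) = t.
Proof. by move=> t0; rewrite addrAC subrr add0r cabsM nu1 mulr1 cabs_real ger0_norm. Qed.

Let lo_x1 u : lo u -> ~ Lset p u x1.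
Proof. by move=> lu /lu; move: (dl0) (rho0) => a b; rewrite ray_dist; lra. Qed.

Let high u : monoid_of G u -> ~ lo u -> Lset p u x1 /\ Lset p u x2.
Proof.
move=> hu nl; move: (dl0) => a.
have h := high_disc Gcomp Gdeg Gpost Gp JXY disXY clX clY Kk0 Yx0 Yrho hu nl Xfar.
have dist (t : R) : 0 <= t -> cabs (k0 + (rho + t)%:C * nu - (k0 + rho%:C * nu)) = t.
  move=> t0; have -> : k0 + (rho + t)%:C * nu - (k0 + rho%:C * nu) = t%:C * nu.
    by rewrite rmorphD /=; ring.
  by rewrite cabsM nu1 mulr1 cabs_real ger0_norm.
by split; apply: h; rewrite dist; lra.
Qed.

Let d2 : (2 <= d)%N.
Proof. by rewrite /d; case: (size p) sp => [|[|[|n]]]. Qed.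

(* [kappa] bounds the growth at [x2] from below, uniformly for the elements
   whose filled set lies in the disc; each application of [descent] divides the
   normalised growth rate [beta] by [theta]. *)
Variables (kappa theta c : R) (N0 : nat).
Hypothesis kappa1 : 1 < kappa.
Hypothesis kappa_ratio : forall r, cabs (r - k0) <= rho ->
  kappa * cabs (x1 - r) <= cabs (x2 - r).
Hypothesis c1 : 1 + `|cabs k0| <= c.
Let nrm z := c * Num.max 1 (cabs z).
Hypothesis nrm_iter : forall n z, nrm (iter n (horner p) z) <= nrm z ^+ (d ^ n).
Hypothesis theta1 : 1 < theta.
Hypothesis theta_kappa : theta ^+ (2 * d) <= kappa.
Hypothesis theta_large : forall n, (N0 <= n)%N -> 16 * c * esc sp <= theta ^+ n.
Hypothesis N01 : (0 < N0)%N.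

Let cg1 : 1 <= c. Proof. by apply: le_trans c1; rewrite lerDl. Qed.

Let nrm_ge1 z : 1 <= nrm z.
Proof. by rewrite /nrm mulr_ege1 // le_max lexx. Qed.

Let nrm_dist z : cabs (z - k0) <= nrm z.
Proof.
apply: le_trans (cabsD _ _) _; rewrite cabsN /nrm; have h0 := ler_norm (cabs k0).
have k00 := cabs_ge0 k0; move: (c1) => cc.
have h1 : 1 <= Num.max 1 (cabs z) by rewrite le_max lexx.
have h2 : cabs z <= Num.max 1 (cabs z) by rewrite le_max lexx orbT.
move: (Num.max _ _) h1 h2 => m h1 h2.
have : (1 + cabs k0) * m <= c * m by rewrite ler_wpM2r //; lra.
nra.
Qed.

(** The third clause puts [s.[x1]] beyond the escape radius and at distance at least 1 from [k0],
    where [good_kappa] starts; the fourth makes the degree large enough for [theta_large]. *)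
Let good s := [/\ monoid_of G s, lo s, esc sp + cabs k0 + 1 <= cabs s.[x1] & (N0 <= (size s).-1)%N].

(** As [k0] is in the filled set of [p], the roots of [s - k0] lie in [Lset p s], hence in the disc;
    passing from [x1] to [x2] gains a factor [kappa] for each. *)
Let good_kappa s : good s -> kappa ^+ (size s).-1 <= cabs (s.[x2] - k0).
Proof.
move=> [hs ls hx1 _]; have [h1 _] := lead_coefB_const k0 (monoid_size Gdeg hs).
have : kappa ^+ (size (s - k0%:P)).-1 * cabs (s - k0%:P).[x1] <= cabs (s - k0%:P).[x2].
  apply: poly_roots_ratio; first by apply: ltW; apply: lt_trans kappa1.
  move=> r; rewrite hornerD hornerN hornerC => /eqP; rewrite subr_eq0 => /eqP hr.
  apply: kappa_ratio; apply: ls; rewrite /Lset hr.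
  exact: (Khat_filled Gcomp Gp Kk0).
rewrite h1 !(hornerD, hornerN, hornerC) => h; apply: le_trans h.
rewrite ler_peMr ?exprn_ge0 //; first by apply: ltW; apply: lt_trans kappa1.
have := cabs_subl s.[x1] k0; have := esc_ge1 sp; lra.
Qed.

Let good_iter s j : good s -> good (iterp p j \Po s).
Proof.
move=> [hs ls hx1 hN]; split.
- by apply: monoid_comp => //; apply: monoid_iter.
- by move=> z /Lset_iter; apply: ls.
- rewrite horner_comp horner_iterp; apply: (le_trans hx1).
  have h : esc sp <= cabs (iter 0 (horner p) s.[x1]).
    by rewrite /=; have := cabs_ge0 k0; move: hx1; lra.
  exact: (esc_mono (leq0n j) h).
rewrite deg_comp deg_iterp; apply: leq_trans hN _.
by rewrite leq_pmull // expn_gt0 (leq_trans _ d2).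
Qed.

(** The unbounded Julia set supplies a frontier [Eset p v] that reaches beyond the image of the disc
    under [s]. *)
Let far_element s : monoid_of G s -> exists2 v, monoid_of G v & ~ lo (v \Po s).
Proof.
move=> hs; have ss := monoid_size Gdeg hs.
have [B B0 hB] := poly_bound s (rho + cabs k0).
have [z Jz hz] := unbounded (B + 1).
have [y [v hv Ev] hzy] := proj1 (JsetP Gcomp Gdeg Gp z) Jz 1 ltr01.
exists v => // lvs; have [x hx] := poly_surj y ss.
have Lx : Lset p (v \Po s) x by apply/Lset_comp; rewrite hx; case: Ev.
have := lvs x Lx => hxr.
have : cabs s.[x] <= B by apply: hB; have := cabs_subl x k0; lra.
rewrite hx; have := cabs_subl z y; lra.
Qed.

Let escape_low u : monoid_of G u -> lo u -> exists K, forall k, (K <= k)%N ->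
  esc sp + cabs k0 + 1 <= cabs (iterp p k \Po u).[x1].
Proof.
move=> hu lu; have /(nfilledP sp) [n hn] := lo_x1 lu.
have [K hK] := esc_infty (esc sp + cabs k0 + 1) (ltW hn); exists K => k hk.
by rewrite horner_comp horner_iterp; apply: hK.
Qed.

(** With [v] from [far_element], let [v p^(j+1) s] be the first low composition of its kind. As
    [v p^j s] is not low, [q = p^j s] puts [q.[x2]] in [Lset p v], at distance at least
    [kappa ^+ deg q] from [k0]. So [v] is bounded on circles up to that radius, and
    [bernstein_walsh] bounds it at [p.[q.[x2]]]. *)
Let descent s (beta : R) : good s -> 0 < beta -> nrm s.[x2] <= beta ^+ (size s).-1 ->
  exists2 s', good s' & nrm s'.[x2] <= (beta / theta) ^+ (size s').-1.
Proof.
move=> gs b0 hbeta; have [hs ls hx1 hN] := gs.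
have hd0 : (0 < d)%N by apply: leq_trans d2.
have [v hv nlvs] := far_element hs.
have mono j : monoid_of G (v \Po (iterp p j \Po s)).
  by apply: monoid_comp => //; apply: monoid_comp => //; apply: monoid_iter.
(* [p^j s] tends to infinity at [x1], whereas compositions that are not low keep this value in the
   bounded set [Lset p v]. *)
have hexj : exists j, `[< lo (v \Po (iterp p j \Po s)) >].
  apply: contrapT => hno.
  have [B hB] := Lset_bounded Gdeg Gp hv.
  have h1 : esc sp <= cabs (iter 0 (horner p) s.[x1]).
    by rewrite /=; have := cabs_ge0 k0; move: hx1; lra.
  have [K hK] := esc_infty (B + 1) h1.
  have nl : ~ lo (v \Po (iterp p K \Po s)) by move=> h; apply: hno; exists K; apply/asboolP.
  have [/Lset_comp /hB h2 _] := high (mono K) nl.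
  have := hK K (leqnn _); rewrite horner_comp horner_iterp in h2; lra.
have [j /asboolP lj minj] := ex_minnP hexj.
case: j lj minj => [|j] lj minj.
  by case: nlvs; rewrite -[s]comp_polyX.
have {minj} nlj : ~ lo (v \Po (iterp p j \Po s)).
  by move=> /asboolP h; have := minj j h; rewrite ltnn.
pose q := iterp p j \Po s; have gq : good q by apply: good_iter.
have [_ /Lset_comp Lq] := high (mono j) nlj; rewrite -/q in Lq.
have k0v : Lset p v k0 by apply: (Khat_Lset Gcomp Gp).
pose Q := (size q).-1.
have QN0 : (N0 <= Q)%N by case: gq.
have QE : Q = (d ^ j * (size s).-1)%N by rewrite /Q /q deg_comp deg_iterp.
have hr := good_kappa gq; rewrite -/Q in hr.
clearbody Q.
have kp : 0 < kappa by apply: lt_trans kappa1.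
have r0 : 0 < kappa ^+ Q by rewrite exprn_gt0.
have e1 := esc_ge1 sp.
have circ t : 0 <= t <= kappa ^+ Q -> exists2 x, cabs (x - k0) = t & cabs v.[x] <= esc sp.
  move=> /andP[t0 t1]; have [|x hx Lx] := Lset_circle Gcomp Gdeg Gpost Gp hv k0v Lq (t := t).
    by rewrite t0 /=; apply: le_trans hr.
  by exists x => //; apply: (filled_le sp Lx).
have hVs := monoid_size Gdeg hv.
pose w := p.[q.[x2]].
have wE : w = (iterp p j.+1 \Po s).[x2] by rewrite /w /q !horner_comp.
have := bernstein_walsh hVs r0 (le_trans ler01 e1) circ w.
have [V VE] : exists V, V = (size v).-1 by exists (size v).-1.
rewrite -VE => hvw.
have V0 : (0 < V)%N by rewrite VE deg_gt0.
have nq : nrm q.[x2] <= beta ^+ Q.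
  rewrite /q horner_comp horner_iterp; apply: le_trans (nrm_iter _ _) _.
  rewrite QE mulnC exprM; apply: lerXn2r; rewrite ?nnegrE ?exprn_ge0 ?(ltW b0) //.
  by apply: le_trans (nrm_ge1 _).
have nw : nrm w <= beta ^+ (Q * d).
  apply: le_trans (nrm_iter 1 q.[x2]) _; rewrite expn1 exprM.
  apply: lerXn2r; rewrite ?nnegrE ?exprn_ge0 ?(ltW b0) //.
  by apply: le_trans (nrm_ge1 _).
have bQ1 : 1 <= beta ^+ Q by apply: le_trans (nrm_ge1 _) nq.
have bQd : beta ^+ Q <= beta ^+ (Q * d).
  by rewrite exprM -[leLHS]expr1 ler_weXn2l.
have kb : kappa ^+ Q <= beta ^+ (Q * d).
  by apply: le_trans hr (le_trans (nrm_dist _) (le_trans nq bQd)).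
have hw : cabs (w - k0) + kappa ^+ Q <= 2 * beta ^+ (Q * d).
  by have := nrm_dist w; lra.
(* [T ^+ V] will bound [nrm v.[w]]: 8 becomes 16 because [cabs (w - k0) + kappa ^+ Q] is at most
   twice [beta ^+ (Q * d)], and [c * esc sp] is moved into the base. *)
have [T TD] : exists T, T = 16 * c * esc sp * beta ^+ (Q * d) / kappa ^+ Q by eexists.
have ce1 : 1 <= c * esc sp by rewrite mulr_ege1.
have bk1 : 1 <= beta ^+ (Q * d) / kappa ^+ Q by rewrite ler_pdivlMr // mul1r.
have TE : T = 16 * (c * esc sp) * (beta ^+ (Q * d) / kappa ^+ Q) by rewrite TD; ring.
have Tc : c <= T.
  rewrite TE; have h : c <= c * esc sp by rewrite ler_peMr //; exact: le_trans cg1.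
  have h2 : c * esc sp <= 16 * (c * esc sp) by lra.
  apply: le_trans h (le_trans h2 _); rewrite ler_peMr //; lra.
have T1 : 1 <= T by apply: le_trans cg1 Tc.
have nvw : nrm v.[w] <= T ^+ V.
  rewrite /nrm maxr_pMr; last exact: le_trans cg1.
  rewrite ge_max mulr1; apply/andP; split.
    by apply: le_trans Tc _; rewrite -[leLHS]expr1 ler_weXn2l.
  have h8 : 8 * (cabs (w - k0) + kappa ^+ Q) / kappa ^+ Q <= 16 * (beta ^+ (Q * d) / kappa ^+ Q).
    by rewrite mulrA ler_wpM2r ?invr_ge0 ?(ltW r0) //; lra.
  have h80 : 0 <= 8 * (cabs (w - k0) + kappa ^+ Q) / kappa ^+ Q.
    by rewrite divr_ge0 ?(ltW r0) // mulr_ge0 // addr_ge0 ?cabs_ge0 // ltW.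
  have TE2 : T = (c * esc sp) * (16 * (beta ^+ (Q * d) / kappa ^+ Q)) by rewrite TE; ring.
  rewrite TE2 exprMn; apply: (@le_trans _ _ (c * (esc sp * (8 * (cabs (w - k0) + kappa ^+ Q) / kappa ^+ Q) ^+ V))).
    by rewrite ler_wpM2l //; exact: le_trans cg1.
  rewrite mulrA; apply: ler_pM; rewrite ?exprn_ge0 //.
  - by apply: le_trans ler01 ce1.
  - by rewrite -[leLHS]expr1 ler_weXn2l.
  by apply: lerXn2r; rewrite ?nnegrE // (le_trans h80).
(* By [theta_kappa], dividing by [kappa ^+ Q] pays for two factors [theta ^+ (Q * d)]: one absorbs
   the constant, the other is the gain. *)
have hT : T <= (beta / theta) ^+ (Q * d).
  have tp : 0 < theta by apply: lt_trans theta1.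
  have tQ : 0 < theta ^+ (Q * d) by rewrite exprn_gt0.
  have h1 : 16 * c * esc sp <= theta ^+ (Q * d).
    by apply: theta_large; apply: leq_trans QN0 _; rewrite leq_pmulr.
  have h2 : theta ^+ (Q * d) * theta ^+ (Q * d) <= kappa ^+ Q.
    rewrite -expr2 -exprM -mulnA mulnC exprM; apply: lerXn2r; rewrite ?nnegrE ?exprn_ge0 ?(ltW kp) ?(ltW tp) //.
    by rewrite mulnC.
  rewrite TD expr_div_n ler_pdivlMr //.
  have -> : 16 * c * esc sp * beta ^+ (Q * d) / kappa ^+ Q * theta ^+ (Q * d) =
    16 * c * esc sp * theta ^+ (Q * d) / kappa ^+ Q * beta ^+ (Q * d) by ring.
  rewrite ler_piMl ?exprn_ge0 ?(ltW b0) // ler_pdivrMr // mul1r.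
  by apply: le_trans h2; rewrite ler_wpM2r // ltW.
pose m := v \Po (iterp p j.+1 \Po s).
(* Further iterates of [p] restore the third clause of [good]; they keep [Lset] and do not worsen
   the normalised rate. *)
have [K hK] := escape_low (mono j.+1) lj.
exists (iterp p K \Po m).
  split.
  - by apply: monoid_comp => //; [apply: monoid_iter | apply: mono].
  - by move=> z /Lset_iter; apply: lj.
  - exact: hK.
  rewrite deg_comp deg_iterp; apply: leq_trans (leq_pmull _ _); last by rewrite expn_gt0 hd0.
  rewrite /m deg_comp -VE; apply: leq_trans (leq_pmull _ _) => //.
  by case: (good_iter j.+1 gs).
rewrite horner_comp horner_iterp; apply: le_trans (nrm_iter _ _) _.
rewrite deg_comp deg_iterp mulnC exprM.
have mE : m.[x2] = v.[w] by rewrite /m horner_comp wE.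
have sE : (size m).-1 = (Q * d * V)%N.
  rewrite /m deg_comp -VE deg_comp (deg_iterp p j.+1) -/d expnS QE mulnC [(d * _)%N]mulnC.
  by rewrite -!mulnA; congr (_ * _)%N; rewrite !mulnA; congr (_ * _)%N; rewrite mulnC.
have T0 : 0 <= T by apply: le_trans T1.
have bt0 : 0 <= beta / theta by rewrite divr_ge0 ?(ltW b0) //; apply: ltW; apply: lt_trans theta1.
apply: lerXn2r; rewrite ?nnegrE ?exprn_ge0 //; first by apply: le_trans (nrm_ge1 _).
rewrite mE sE exprM; apply: le_trans nvw _; apply: lerXn2r; rewrite ?nnegrE ?exprn_ge0 //.
Qed.

(** After enough descents the normalised rate is at most 1, against the lower bound [kappa] of
    [good_kappa]. *)
Let no_good s : good s -> False.
Proof.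
move=> gs; pose b0 := nrm s.[x2]; have b1 : 1 <= b0 by apply: nrm_ge1.
have b0p : 0 < b0 by apply: lt_le_trans b1.
have tp : 0 < theta by apply: lt_trans theta1.
have chain m : exists2 s', good s' & nrm s'.[x2] <= (b0 / theta ^+ m) ^+ (size s').-1.
  elim: m => [|m [s' gs' hs']].
    exists s => //; rewrite expr0 divr1 -/b0 -[leLHS]expr1 ler_weXn2l //.
    by case: gs => _ _ _; apply: leq_trans.
  have [|s'' gs'' hs''] := descent gs' _ hs'; first by rewrite divr_gt0 ?exprn_gt0.
  by exists s'' => //; rewrite exprSr invfM mulrA.
have [m hm] := exp_large b0 theta1.
have [s' gs' hs'] := chain m; have := good_kappa gs'; apply/negP; rewrite -ltNge.
apply: le_lt_trans (nrm_dist _) (le_lt_trans hs' _).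
have N' : (0 < (size s').-1)%N by case: gs' => _ _ _; apply: leq_trans.
apply: (@le_lt_trans _ _ 1).
  rewrite exprn_ile1 ?divr_ge0 ?exprn_ge0 ?(ltW b0p) ?(ltW tp) //.
  by rewrite ler_pdivrMr ?exprn_gt0 // mul1r hm.
by rewrite exprn_egt1 // -lt0n.
Qed.

Lemma clopen_unbounded_absurd : False.
Proof.
have [v [a [hv _ _ EY]]] := Eset_near_Y Gcomp Gdeg Gpost Gp JXY disXY clX clY Yx0 (@ltr01 R).
have lv : lo v by apply: (low_of_Eset Gcomp Gdeg Gp Kk0 hv EY Yrho).
have [K hK] := escape_low hv lv.
apply: (@no_good (iterp p (K + N0) \Po v)); split.
- by apply: monoid_comp => //; apply: monoid_iter.
- by move=> z /Lset_iter; apply: lv.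
- by apply: hK; rewrite leq_addr.
have V0 : (0 < (size v).-1)%N by rewrite -ltnS prednK ?(monoid_size Gdeg hv) // ltnW // (monoid_size Gdeg hv).
rewrite deg_comp deg_iterp; apply: leq_trans (leq_pmulr _ V0).
apply: (@leq_trans (K + N0)); first by rewrite leq_addl.
by apply: leq_trans (ltnW (ltn_expl _ (ltnSn 1))) _; rewrite leq_exp2r // (leq_trans _ (leq_addl _ _)).
Qed.

End Contradiction.
(** The disc is centred at a point of [Khat] and has the farthest point of [Y] on its boundary
    circle. [X] avoids a small disc about that point, which leaves room for the two test points on
    the ray beyond it. *)
Theorem Jset_bounded_of_clopen (X Y : C -> Prop) :
  (forall z, Jset G z <-> X z \/ Y z) -> (forall z, X z -> Y z -> False) ->
  closedC X -> closedC Y -> bounded_C Y -> (exists y, Y y) -> bounded_C (Jset G).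
Proof.
move=> JXY dis cX cY bY Y0; apply: contrapT => nb.
have unb M : exists2 z, Jset G z & M < cabs z.
  apply: contrapT => h; apply: nb; exists M => z Jz; rewrite leNgt; apply/negP => hz.
  by apply: h; exists z.
have [k0 Kk0] := Khat_nonempty Gcomp Gdeg Gpost Gp.
have [x0 Yx0 hx0] := farthest k0 Y0 bY cY.
pose rho := cabs (x0 - k0); have rho0 : 0 <= rho by apply: cabs_ge0.
have [nu nu1 x0E] : exists2 nu, cabs nu = 1 & x0 = k0 + rho%:C * nu.
  have [h|h] := eqVneq rho 0.
    exists 1; first exact: cabs1.
    by apply/eqP; rewrite h mul0r addr0 -subr_eq0 -cabs_eq0 -/rho h.
  have hC : rho%:C != 0 by rewrite fmorph_eq0.
  exists ((x0 - k0) / rho%:C); last by rewrite mulrC divfK // subrKC.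
  by rewrite cabs_div cabs_real ger0_norm // -/rho divff.
have [e e0 he] := closedC_far cX (fun h => dis _ h Yx0).
have d0 : 0 < e / 4 by lra.
have Xfar z : cabs (z - (k0 + rho%:C * nu)) <= 2 * (e / 4) -> ~ X z.
  by rewrite -x0E => hz; apply: he; rewrite cabsB; lra.
have [kappa k1 hk] := outward_ratio k0 nu1 rho0 d0.
have [c c1 hc] := iter_upper sp (cabs k0).
have [theta t1 ht] := root_gt1 (2 * (size p).-1) k1.
have [N hN] := exp_large (16 * c * esc sp) t1.
rewrite x0E in Yx0.
apply: (@clopen_unbounded_absurd X Y JXY dis cX cY unb k0 nu rho (e / 4) Kk0 nu1 rho0 d0 Yx0 _ Xfar
  kappa theta c N.+1 k1 hk c1 hc t1 ht) => //.
by move=> n hn; apply: hN; apply: ltnW.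
Qed.

(** If infinity is in the Julia set, the side of a separation not containing it is bounded and
    serves as [Y]; otherwise a neighbourhood of infinity is free of Julia points. *)
Theorem Jset_bounded : ~ mconnected (@sdist R) (Julia G) -> bounded_C (Jset G).
Proof.
move=> /contrapT [U [V [[oU oV] cov [x [Jx Ux]] [y [Jy Vy]] dis]]].
have [JN|FN] := pselect (Julia G None); last first.
  have [W [oW WN nW]] := contrapT FN; have [e e0 he] := oW _ WN.
  exists (2 / e) => z Jz; rewrite leNgt; apply/negP => hz.
  have z0 : 0 < cabs z by apply: lt_trans hz; rewrite divr_gt0.
  apply: Jz; exists W; split=> //; apply: he; rewrite sdistC.
  by apply: le_lt_trans (sdist_None z0) _; rewrite ltr_pdivrMr // mulrC -ltr_pdivrMr.
wlog UN : U V oU oV cov x y Jx Jy Ux Vy dis / U None.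
  move=> h; case: (cov _ JN) => hN; first exact: (h U V oU oV cov x y).
  apply: (h V U oV oU _ y x) => //; first by move=> z /cov [|]; [right | left].
  by move=> z Jz Vz Uz; apply: dis Uz Vz.
have part (A B : sphere R -> Prop) : mopen (@sdist R) B -> (forall t, Julia G t -> A t \/ B t) ->
    (forall t, Julia G t -> A t -> B t -> False) -> closedC (fun z => Jset G z /\ A (Some z)).
  move=> oB cAB dAB z hz.
  have Jz : Jset G z by apply: Jset_closed => e /hz [a [Ja _] ha]; exists a.
  split=> //; case: (cAB _ Jz) => // Bz; have [e e0 he] := oB _ Bz.
  have e2 : 0 < e / 2 by lra.
  have [a [Ja Aa] ha] := hz _ e2; case: (dAB _ Ja Aa); apply: he; exact: sdist_lt.
apply: (@Jset_bounded_of_clopen (fun z => Jset G z /\ U (Some z)) (fun z => Jset G z /\ V (Some z))).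
- by move=> z; split=> [Jz|[[]|[]] //]; case: (cov _ Jz) => h; [left | right].
- by move=> z [Jz Uz] [_ Vz]; apply: dis Jz Uz Vz.
- exact: (part U V).
- by apply: (part V U) => // z; [move=> /cov [|]; [right | left] | move=> Jz Vz Uz; apply: dis Uz Vz].
- have [e e0 he] := oU _ UN; exists (2 / e) => z [Jz Vz]; rewrite leNgt; apply/negP => hz.
  have z0 : 0 < cabs z by apply: lt_trans hz; rewrite divr_gt0.
  apply: (dis _ Jz _ Vz); apply: he; rewrite sdistC.
  by apply: le_lt_trans (sdist_None z0) _; rewrite ltr_pdivrMr // mulrC -ltr_pdivrMr.
by case: y Jy Vy => [z|] Jy Vy; [exists z | case: (dis _ Jy UN Vy)].
Qed.

End JuliaBounded.

(** * The unbounded complementary domain of a bounded set *)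

Section OuterDomain.
Local Open Scope complex_scope.
Variable R : realType.
Local Notation C := R[i].
Implicit Types (q h : {poly C}) (A B S : C -> Prop) (x y z w : C).

Lemma ray_direction z : exists v : C, cabs v = 1 /\
  forall t : R, 0 <= t -> cabs (z + t%:C * v) = cabs z + t.
Proof.
have [->|z0] := eqVneq z 0.
  by exists 1; split=> [|t t0]; rewrite ?cabs1 // add0r mulr1 cabs_real ger0_norm // cabs0 add0r.
have cz : 0 < cabs z by rewrite cabs_gt0.
exists (((cabs z)^-1)%:C * z); split=> [|t t0].
  by rewrite cabsM cabs_real ger0_norm ?invr_ge0 ?ltW // mulVf // gt_eqF.
have -> : z + t%:C * (((cabs z)^-1)%:C * z) = (1 + t / cabs z)%:C * z.
  by rewrite rmorphD rmorph1 rmorphM /=; ring.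
rewrite cabsM cabs_real ger0_norm; last by rewrite addr_ge0 // divr_ge0 // ltW.
by rewrite mulrDl mul1r divfK // gt_eqF.
Qed.

(** For bounded closed [S] this is the unbounded component of the complement, described by connected
    witnesses that are easy to map and to enlarge. *)
Definition outer S x := exists B, [/\ lconn B, B x, (forall M : R, exists2 y, B y & M < cabs y)
  & forall y, B y -> ~ S y].

Lemma outer_far S (M : R) z : (forall x, S x -> cabs x <= M) -> M < cabs z -> outer S z.
Proof.
move=> hM hz; have [v [v1 hv]] := ray_direction z.
exists (fun y => exists2 t : R, 0 <= t & y = z + t%:C * v); split.
- exact: lconn_ray.
- by exists 0; rewrite ?lexx // mul0r addr0.
- move=> N; have t0 : 0 <= 1 + `|N| by have := normr_ge0 N; lra.
  exists (z + (1 + `|N|)%:C * v); first by exists (1 + `|N|).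
  by rewrite hv //; have := ler_norm N; have := cabs_ge0 z; lra.
move=> _ [t t0 ->] /hM; rewrite hv //; lra.
Qed.

Lemma outer_lconn_union S B x y : lconn B -> B x -> B y -> (forall z, B z -> ~ S z) ->
  outer S x -> outer S y.
Proof.
move=> cB Bx By hB [D [cD Dx uD hD]]; exists (fun z => B z \/ D z); split.
- exact: (lconn_U cB cD Bx Dx).
- by left.
- by move=> M; have [w Dw hw] := uD M; exists w => //; right.
by move=> z [/hB|/hD].
Qed.

Lemma outer_open S x : closedC S -> outer S x ->
  exists2 e : R, 0 < e & forall y, cabs (y - x) < e -> outer S y.
Proof.
move=> cS ox; have nSx : ~ S x by case: ox => B [_ Bx _ /(_ x Bx)].
have [e e0 he] := closedC_far cS nSx; exists e => // y hy.
apply: (outer_lconn_union (@lconn_disc _ x e) _ hy _ ox); first by rewrite subrr cabs0.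
by move=> z hz; apply: he; rewrite cabsB.
Qed.

(* Otherwise the outer domain [W] of [S] satisfies [h(S u W)] in [W]; its
   iterates omit a disc on [W], so the Julia set of [h] lies strictly inside
   [S], although [S] meets the filled Julia set and so lies inside it. *)
Lemma preimage_not_inside S h c0 : closedC S -> bounded_C S -> lconn S -> S c0 ->
  (2 < size h)%N -> filled h c0 -> exists2 y, S h.[y] & S y \/ outer S y.
Proof.
move=> cS bS lS Sc0 sh fc0; apply: contrapT => hno.
have nin y : S h.[y] -> ~ S y /\ ~ outer S y.
  by move=> Sy; split=> hy; apply: hno; exists y => //; [left | right].
have [cm Scm hcm] := farthest 0 (ex_intro _ c0 Sc0) bS cS.
have {}hcm y : S y -> cabs y <= cabs cm by move=> /hcm; rewrite !subr0.
have far z : cabs cm < cabs z -> outer S z by apply: outer_far.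
have unb B : (forall M : R, exists2 y, B y & M < cabs y) ->
    forall M : R, exists2 y, (exists2 x, B x & y = h.[x]) & M < cabs y.
  move=> uB M; have [r r0 hr] := poly_growth (M + 1) (ltnW sh).
  by have [y By hy] := uB r; exists h.[y]; [exists y | have := hr y (ltW hy); lra].
have outer_h x : outer S x -> outer S h.[x].
  move=> [B [cB Bx uB hB]]; exists (fun y => exists2 z, B z & y = h.[z]); split.
  - by apply: lconn_image => //; apply: poly_cont_on.
  - by exists x.
  - exact: unb.
  - by move=> _ [z Bz ->] /nin [_]; apply; exists B.
(* [S] is prolonged by a ray from its farthest point [cm], which makes its image unbounded; beyond
   [cm] the ray is in the outer domain, so the image misses [S]. *)
have S_h x : S x -> outer S h.[x].
  move=> Sx; have [v [v1 hv]] := ray_direction cm.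
  pose B y := S y \/ exists2 t : R, 0 <= t & y = cm + t%:C * v.
  have cB : lconn B.
    apply: (lconn_U lS (@lconn_ray _ cm v) Scm).
    by exists 0; rewrite ?lexx // mul0r addr0.
  exists (fun y => exists2 z, B z & y = h.[z]); split.
  - by apply: lconn_image => //; apply: poly_cont_on.
  - by exists x => //; left.
  - apply: unb => M; have t0 : 0 <= 1 + `|M| by have := normr_ge0 M; lra.
    exists (cm + (1 + `|M|)%:C * v); first by right; exists (1 + `|M|).
    by rewrite hv //; have := ler_norm M; have := cabs_ge0 cm; lra.
  move=> _ [z [Sz|[t t0 zE]] ->] /nin [h1 h2]; first exact: h1.
  have [tE|tn] := eqVneq t 0; first by apply: h1; rewrite zE tE mul0r addr0.
  apply: h2; apply: far; rewrite zE hv // ltrDl lt_neqAle eq_sym tn //.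
(* A preimage [b] of [c0] is neither in [S] nor outer, so the outer domain keeps some distance [s]
   from [b]: this is the omitted disc. *)
have [b hb] := poly_surj c0 (ltnW sh).
have Sb : S h.[b] by rewrite hb.
have [nSb nob] := nin b Sb.
have [s s0 hs] : exists2 s : R, 0 < s & forall y, outer S y -> s <= cabs (y - b).
  have [e e0 he] := closedC_far cS nSb; exists e => // y oy; rewrite leNgt; apply/negP => hy.
  apply: nob; apply: (outer_lconn_union (@lconn_disc _ b e) hy _ _ oy); first by rewrite subrr cabs0.
  by move=> z hz; apply: he; rewrite cabsB.
have outer_iter n x : outer S x -> outer S (iter n (horner h) x).
  by move=> ox; elim: n => // n IH; apply: outer_h.
have nJ_outer x : outer S x -> ~ frontier (filled h) x.
  move=> ox [fx hx]; have [e e0 he] := outer_open cS ox.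
  have e2 : 0 < e / 2 by lra.
  have e48 : 0 < e / 2 / 24 by lra.
  have [y hy nfy] := hx _ e48; apply: nfy.
  pose A := s^-1 * (esc sh + cabs b).
  exists (s * (4 * A ^+ 4) + cabs b) => n.
  (* Iterates keep outer points outer, so [q] has modulus at least 1 near [x], and [harnack] carries
     its bound at the filled point [x] over to [y], uniformly in [n]. *)
  pose q := (s^-1)%:C *: (iterp h n - b%:P).
  have qE z : cabs q.[z] = s^-1 * cabs (iter n (horner h) z - b).
    by rewrite /q hornerZ cabsM cabs_real ger0_norm ?invr_ge0 ?(ltW s0) // hornerD hornerN hornerC horner_iterp.
  have q1 z : cabs (z - x) <= e / 2 -> 1 <= cabs q.[z].
    move=> hz; rewrite qE mulrC ler_pdivlMr // mul1r; apply: hs; apply: outer_iter; apply: he; lra.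
  have hyx : cabs (y - x) <= e / 2 / 24 by rewrite cabsB ltW.
  have := harnack e2 q1 hyx; rewrite !qE => h1.
  have hA : s^-1 * cabs (iter n (horner h) x - b) <= A.
    rewrite ler_wpM2l ?invr_ge0 ?(ltW s0) //; apply: le_trans (cabsD _ _) _; rewrite cabsN lerD2r.
    by move/(filledP sh): fx; apply.
  have h2 : (s^-1 * cabs (iter n (horner h) x - b)) ^+ 4 <= A ^+ 4.
    have h0 : 0 <= s^-1 * cabs (iter n (horner h) x - b) by rewrite mulr_ge0 ?invr_ge0 ?cabs_ge0 ?(ltW s0).
    by apply: lerXn2r; rewrite ?nnegrE // (le_trans h0).
  have h3 : s^-1 * cabs (iter n (horner h) y - b) <= 4 * A ^+ 4 by lra.
  rewrite mulrC ler_pdivrMr // mulrC in h3.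
  by have := cabs_subl (iter n (horner h) y) b; lra.
have nJ_S x : S x -> ~ frontier (filled h) x.
  move=> Sx Fx; apply: (nJ_outer _ (S_h x Sx)); apply/(frontier_preimage (filled h) _ (ltnW sh)).
  suff -> : (fun z => filled h h.[z]) = filled h by [].
  by apply/funext => z; apply/propext/filled_horner.
(* [S] meets the filled set and no frontier point of it, so it lies in the interior. The filled set
   then extends beyond [cm], and its farthest point is a frontier point in the outer domain. *)
have fS := lconst_off_frontier (filled_closed sh) nJ_S.
have fcm : filled h cm by apply: (lS _ fS c0 cm).
have [e e0 he] := not_frontier fcm (nJ_S cm Scm).
have [v [v1 hv]] := ray_direction cm.
have e2 : 0 <= e / 2 by lra.
have fy : filled h (cm + (e / 2)%:C * v).
  by apply: he; rewrite opprD addNKr cabsN cabsM v1 mulr1 cabs_real ger0_norm //; lra.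
have [x Fx hx] := farthest_frontier 0 (ex_intro _ cm fcm) (ex_intro _ (esc sh) (filled_le sh)) (filled_closed sh).
apply: (nJ_outer x) Fx; apply: far.
by have := hx _ fy; rewrite !subr0 hv //; lra.
Qed.

End OuterDomain.

(** * Components of the Julia set that carry a frontier *)

Section MinimalComponent.
Local Open Scope complex_scope.
Variable R : realType.
Local Notation C := R[i].
Variables (Lam : Type) (g : Lam -> {poly C}) (l0 : Lam).
Local Notation G := (gen_semigroup g).
Hypothesis Gdeg : forall q, G q -> (2 < size q)%N.
Hypothesis Gpost : bounded_C (postcrit_star G).
Hypothesis Jbounded : bounded_C (Jset G).
Local Notation p := (g l0).
Implicit Types (q u w : {poly C}) (B : C -> Prop) (x y z k : C).

Let Gp : G p := gen_base g l0.
Let Gcomp : forall q r, G q -> G r -> G (q \Po r) := @gen_comp R Lam g.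
Let Gg l : G (g l) := gen_base g l.

Hypothesis Jmin_off : forall B z x l, lconn B -> (forall y, B y -> Jset G y) ->
  B z -> Khat G z -> B x -> frontier (filled (g l)) x -> False.

Let Jc : closedC (Jset G) := @Jset_closed R G.

Lemma Eset_nonempty w : monoid_of G w -> exists x, Eset p w x.
Proof.
move=> hw; have [k Kk] := Khat_nonempty Gcomp Gdeg Gpost Gp.
have [|||x Ex _] := @farthest_frontier _ (Lset p w) 0.
- by exists k; apply: (Khat_Lset Gcomp Gp).
- exact: (Lset_bounded Gdeg Gp hw).
- exact: (Lset_closed Gdeg Gp).
by exists x.
Qed.

(** Over [Eset p w] the preimage is the connected set [Eset p (w \Po q)]. Whether some preimage of
    [c] disagrees with it under [P] is locally constant in [c], because [q] is open and proper, and
    false over [Eset p w]. *)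
Lemma preimage_lconn w q (S : C -> Prop) : monoid_of G w -> G q -> lconn S -> bounded_C S ->
  (forall x, Eset p w x -> S x) -> lconn (fun z => S q.[z]).
Proof.
move=> hw Gq cS [M hM] ES P hP.
have sq := ltnW (Gdeg Gq).
have hwq : monoid_of G (w \Po q) by right; apply: (monoid_compr Gcomp).
have [e0 Ee0] := Eset_nonempty hwq.
have ES' x : Eset p (w \Po q) x -> S q.[x] by move=> /(Eset_comp _ _ _ sq) /ES.
have PE x : Eset p (w \Po q) x -> P x <-> P e0.
  move=> Ex; apply: (lconn_iff (Eset_lconn Gcomp Gdeg Gpost Gp hwq)) => //.
  exact: lconst_sub hP.
pose T c := exists2 y, q.[y] = c & ~ (P y <-> P e0).
have hT : lconst S T.
  move=> c Sc; case: (pselect (T c)) => [[y yc nPy]|nT].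
    have Tc : T c by exists y.
    have Sy : S q.[y] by rewrite yc.
    have [e e1 he] := hP y Sy; have [d d0 hd] := open_mapping sq e1.
    exists d => // c' Sc' hc; split=> // _.
    have [|r rc hyr] := hd y c'; first by rewrite yc.
    exists r => //; have Sr : S q.[r] by rewrite rc.
    by rewrite -(he r Sr hyr).
  apply: contrapT => hno.
  have hex n : exists y, [/\ S q.[y], cabs (c - q.[y]) < n.+1%:R^-1 & ~ (P y <-> P e0)].
    apply: contrapT => h; apply: hno; exists n.+1%:R^-1; first by rewrite invr_gt0 ltr0n.
    move=> c' Sc' hc; split=> [h1|[y yc nPy]]; first by case: (nT h1).
    by case: h; exists y; rewrite yc.
  have [f hf] := choice hex.
  have [r r0 hr] := poly_growth (M + 1) sq.
  have [l hl] : exists l, forall e : R, 0 < e -> uev (fun n => cabs (f n - l) < e).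
    apply: (@uev_lim _ _ r); apply: uevT => n; rewrite leNgt; apply/negP => /ltW /hr.
    by case: (hf n) => /hM; lra.
  have lc : q.[l] = c.
    apply/eqP; rewrite -subr_eq0 -cabs_eq0 eq_le cabs_ge0 andbT leNgt; apply/negP => hgt.
    have h2 : 0 < cabs (q.[l] - c) / 2 by lra.
    have [n [k1 k2]] := uev_ex (uev_and (poly_lim q hl h2) (uev_invn h2)).
    case: (hf n) => _ h3 _; have := cabs_tri q.[f n] q.[l] c.
    rewrite (cabsB q.[l] q.[f n]) (cabsB q.[f n] c).
    by move: h3 k2 k1; move: (n.+1%:R^-1) => u; lra.
  have Sl : S q.[l] by rewrite lc.
  have [e e1 he] := hP l Sl; have [n hn] := uev_ex (hl e e1).
  case: (hf n) => Sn _; apply; rewrite -(he _ Sn); last by rewrite cabsB.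
  by apply: contrapT => h; apply: nT; exists l.
have noT c : S c -> ~ T c.
  move=> Sc Tc; have Te0 : T q.[e0] := cS T hT c q.[e0] Sc (ES' _ Ee0) Tc.
  case: Te0 => y yE; apply; apply: PE; apply/(Eset_comp _ _ _ sq).
  by rewrite yE; apply/(Eset_comp _ _ _ sq).
have Pall x : S q.[x] -> P x <-> P e0.
  by move=> Sx; apply: contrapT => h; apply: (noT _ Sx); exists x.
by move=> x y Sx Sy /(Pall x Sx) /(Pall y Sy).
Qed.

Definition unlinked w := forall B z x, lconn B -> (forall y, B y -> Jset G y) ->
  B z -> Khat G z -> B x -> Eset p w x -> False.

Section Component.
Variables (w : {poly C}) (x0 : C).
Hypothesis hw : monoid_of G w.
Hypothesis unl : unlinked w.
Hypothesis Ex0 : Eset p w x0.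

Let S := comp (Jset G) x0.

Lemma component_closed : closedC S.
Proof. exact: comp_closed Jc. Qed.

Lemma component_Eset x : Eset p w x -> S x.
Proof.
move=> Ex; exists (Eset p w); split=> // [z|]; first exact: (Eset_sub Gcomp Gdeg Gp).
exact: (Eset_lconn Gcomp Gdeg Gpost Gp).
Qed.

Lemma component_bounded : bounded_C S.
Proof. by have [M hM] := Jbounded; exists M => z /comp_sub /hM. Qed.

Lemma component_Khat k : Khat G k -> ~ S k.
Proof.
move=> Kk Sk; apply: (unl (@comp_lconn _ _ x0) (@comp_sub _ _ x0) Sk Kk _ Ex0).
exact: component_Eset.
Qed.

(** [Khat] lies in the bounded set [Lset p w], whose frontier lies in [S]; a path to infinity would
    cross it. *)
Lemma Khat_not_outer k : Khat G k -> ~ outer S k.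
Proof.
move=> Kk [B [cB Bk uB hB]]; have [M hM] := Lset_bounded Gdeg Gp hw.
have [y By hy] := uB M.
have nLy : ~ Lset p w y by move=> /hM; lra.
have Lk : Lset p w k by apply: (Khat_Lset Gcomp Gp).
have [z Bz Fz] := lconn_meets_frontier (@Lset_closed _ _ Gdeg _ Gp w) cB Bk Lk By nLy.
by apply: (hB z Bz); apply: component_Eset.
Qed.

(** Otherwise [B] and the connected preimage [Q] of [S] join [Khat] to the point given by
    [preimage_not_inside]. [Q] lies in [J(G)] and misses [S], since otherwise it would be part of
    [S] and meet [B]; so that point is outer, against [Khat_not_outer]. *)
Lemma component_preimage_off l c0 B k b : S c0 -> filled (g l) c0 ->
  lconn B -> (forall y, B y -> ~ S y) -> B k -> Khat G k -> B b -> ~ S (g l).[b].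
Proof.
move=> Sc0 fc0 cB hB Bk Kk Bb Sb.
have [y Sy hy] := preimage_not_inside component_closed component_bounded (@comp_lconn _ _ x0) Sc0 (Gdeg (Gg l)) fc0.
pose Q z := S (g l).[z].
have cQ : lconn Q by apply: (preimage_lconn hw (Gg l) (@comp_lconn _ _ x0) component_bounded component_Eset).
have QJ z : Q z -> Jset G z by move=> /comp_sub; apply: (Jset_preimage Gcomp Gdeg Gp (Gg l)).
have nQS z : Q z -> ~ S z.
  by move=> Qz Sz; apply: (hB b Bb); apply: (comp_max QJ cQ (ex_intro2 _ _ z Sz Qz)).
case: hy => hy; first exact: nQS Sy hy.
apply: (Khat_not_outer Kk).
have cBQ : lconn (fun z => B z \/ Q z) by apply: (lconn_U cB cQ Bb).
apply: (outer_lconn_union cBQ _ _ _ hy); [by right | by left |].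
by move=> z [/hB|/nQS].
Qed.

End Component.

(** [B] misses the component [S] through [(g l).[x]] because [w] is unlinked. By [Jmin_off] it does
    not cross the Julia set of [g l], so [x] and [(g l).[x]] are in the filled set of [g l], and
    [component_preimage_off] forbids [(g l).[x]] to be in [S]. *)
Lemma unlinked_gen w l : monoid_of G w -> unlinked w -> unlinked (w \Po g l).
Proof.
move=> hw unl B k x cB BJ Bk Kk Bx Ex.
have sg := ltnW (Gdeg (Gg l)).
have Eg : Eset p w (g l).[x] by apply/(Eset_comp _ _ _ sg).
pose S := comp (Jset G) (g l).[x].
have SE : S (g l).[x] by apply: (component_Eset hw Eg Eg).
have BS y : B y -> ~ S y.
  move=> By Sy.
  apply: (unl (fun z => B z \/ S z) k (g l).[x]) => //; last by right.
  - exact: (lconn_U cB (@comp_lconn _ _ _) By Sy).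
  - by move=> z [/BJ|/comp_sub].
  - by left.
have fB : lconst B (filled (g l)).
  apply: lconst_off_frontier (filled_closed (Gdeg (Gg l))) _ => y By Fy.
  exact: (Jmin_off cB BJ Bk Kk By Fy).
have fx : filled (g l) x := cB _ fB k x Bk Bx (Khat_filled Gcomp (Gg l) Kk).
have fgx : filled (g l) (g l).[x] by apply/filled_horner.
exact: (component_preimage_off hw Eg SE fgx cB BS Bk Kk Bx SE).
Qed.

Lemma unlinked_all w : monoid_of G w -> unlinked w.
Proof.
have base : unlinked 'X.
  move=> B k x cB BJ Bk Kk Bx Ex; apply: (Jmin_off (l := l0) cB BJ Bk Kk Bx).
  suff <- : Lset p 'X = filled p by [].
  by apply/funext => z; apply/propext/LsetX.
(* Letters are added on the right, so that each new frontier is the preimage of the previous one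
   under a generator. *)
have step q : G q -> forall u, monoid_of G u -> unlinked u -> unlinked (u \Po q).
  elim=> [l|q1 q2 G1 IH1 G2 IH2] u hu unl; first exact: unlinked_gen.
  rewrite comp_polyA; apply: IH2; last exact: IH1.
  by right; apply: (monoid_compr Gcomp).
move=> [->//|Gw]; rewrite -[w]comp_polyX; apply: step => //; by left.
Qed.

(* If the Julia sets of the generators missed a disc about [z], a component [S]
   of the Julia set close to [z] would be crossed by no generator, and the
   components of its complement which meet [Khat] would form a forward
   invariant bounded neighbourhood of [Khat]. *)
Lemma frontier_Khat_approx z (e : R) : frontier (Khat G) z -> 0 < e ->
  exists l x, frontier (filled (g l)) x /\ cabs (z - x) < e.
Proof.
move=> Fz e0; apply: contrapT => hno.
have Kz : Khat G z by case: Fz.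
have Jz := frontier_Khat_Jset Gcomp Gdeg Gp Fz.
have [a [w hw Ea] hza] := proj1 (JsetP Gcomp Gdeg Gp z) Jz e e0.
have unl := unlinked_all hw.
pose S := comp (Jset G) a.
have Sa : S a by apply: (component_Eset hw Ea Ea).
(* The disc about [z] avoids the frontier of each filled set, so [a] is on the same side as [z]. *)
have fa l : filled (g l) a.
  apply: (@lconn_disc _ z e (filled (g l)) _ z a); rewrite ?subrr ?cabs0 // 1?cabsB //.
    apply: lconst_off_frontier (filled_closed (Gdeg (Gg l))) _ => y hy Fy.
    by apply: hno; exists l, y; rewrite cabsB.
  exact: (Khat_filled Gcomp (Gg l) Kz).
pose V y := exists B, [/\ lconn B, (forall x, B x -> ~ S x), B y & exists2 k, B k & Khat G k].
have Vg l y : V y -> V (g l).[y].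
  move=> [B [cB hB By [k Bk Kk]]]; exists (fun x => exists2 b, B b & x = (g l).[b]); split.
  - by apply: lconn_image => //; apply: poly_cont_on.
  - move=> _ [b Bb ->].
    exact: (component_preimage_off hw Ea Sa (fa l) cB hB Bk Kk Bb).
  - by exists y.
  - by exists (g l).[k]; [exists k | apply: (Khat_horner Gcomp)].
have VG q : G q -> forall y, V y -> V q.[y].
  by elim=> [l|q1 q2 _ IH1 _ IH2] y Vy; [apply: Vg | rewrite horner_comp; apply/IH1/IH2].
have [M hM] := component_bounded a.
have VM y : V y -> cabs y <= M.
  move=> [B [cB hB By [k Bk Kk]]]; rewrite leNgt; apply/negP => hy.
  apply: (Khat_not_outer hw Ea Kk).
  exact: (outer_lconn_union cB By Bk hB (outer_far hM hy)).
have VK y : V y -> Khat G y by move=> Vy; exists M => q Gq; apply: VM; apply: VG.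
have nSz := component_Khat hw unl Ea Kz.
have [d d0 hd] := closedC_far (@component_closed a) nSz.
case: Fz => _ /(_ d d0) [y hy]; apply; apply: VK.
exists (fun x => cabs (x - z) < d); split.
- exact: lconn_disc.
- by move=> x hx; apply: hd; rewrite cabsB.
- by rewrite cabsB.
- by exists z; rewrite // subrr cabs0.
Qed.

End MinimalComponent.

(** * Components of the closed union of the generators' Julia sets *)

Section MinimalComponentOfGenerators.
Local Open Scope complex_scope.
Variable R : realType.
Local Notation C := R[i].
Local Notation sd := (@sdist R).
Variables (Lam : Type) (g : Lam -> {poly C}).
Local Notation G := (gen_semigroup g).
Implicit Types (B : C -> Prop) (x y z : C).

(** With no generator every sequence condition is vacuous and the Julia set is empty; so
    disconnectedness supplies a generator to play the part of [p]. *)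
Lemma empty_gen_Julia : (Lam -> False) -> mconnected sd (Julia G).
Proof.
move=> noL; have nG q : ~ G q by elim=> // l; case: (noL l).
move=> [U [V [_ _ [x [Jx _]] _ _]]]; apply: Jx; exists (fun _ => True); split=> //.
  by move=> y _; exists 1.
by move=> s hs; case: (nG _ (hs 0%N)).
Qed.

Hypothesis Gdeg : forall q, G q -> (2 < size q)%N.
Hypothesis Gpost : bounded_C (postcrit_star G).
Hypothesis Jdis : ~ mconnected sd (Julia G).
Let UJ : sphere R -> Prop := fun t => exists l, Julia1 (g l) t.
Let clUJ := mclosure sd UJ.
Hypothesis Jmin_UJ : forall A, is_Jmin G A -> forall t, A t -> UJ t -> False.

Let Gcomp : forall q r, G q -> G r -> G (q \Po r) := @gen_comp R Lam g.
Let Gg l : G (g l) := gen_base g l.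

Let l0_ex : exists l : Lam, True.
Proof. by apply: contrapT => h; apply: Jdis; apply: empty_gen_Julia => l; apply: h; exists l. Qed.

Let Jb : bounded_C (Jset G).
Proof. by have [l _] := l0_ex; apply: (Jset_bounded Gcomp Gdeg Gpost (Gg l) Jdis). Qed.

Let UJE x : UJ (Some x) <-> exists l, frontier (filled (g l)) x.
Proof.
split=> -[l hl]; exists l; last by apply/(Julia1P _ (Gdeg (Gg l))); exists x.
by have [y hy [->]] := proj1 (Julia1P _ (Gdeg (Gg l))) hl.
Qed.

(** As [J(G)] is bounded, its component through [z] avoids infinity, and [z] is on the boundary of
    [Khat]; so this component satisfies [is_Jmin] and contains [x]. *)
Lemma Jmin_off B z x l : lconn B -> (forall y, B y -> Jset G y) ->
  B z -> Khat G z -> B x -> frontier (filled (g l)) x -> False.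
Proof.
move=> cB BJ Bz Kz Bx Fx; have Gp := Gg l.
have inB y : B y -> mcomponent sd (Julia G) (Some z) (Some y).
  move=> By; exists (ofC B); split=> //; [|exact: lconn_mconnected_ofC | by exists z | by exists y].
  by move=> _ [w Bw ->]; apply: BJ.
apply: (Jmin_UJ (A := mcomponent sd (Julia G) (Some z)) _ (inB x Bx)); last first.
  by apply/UJE; exists l.
split; first by exists (Some z) => //; apply: BJ.
  move=> [D [DJ cD Dz DN]]; have [M hM] := Jb; apply: cD.
  exists (ofC (fun w => cabs (w - 0) < M + 1)).
  exists (fun t : sphere R => if t is Some w then M < cabs w : Prop else True); split.
  - by split; [apply/mopen_ofC/mopen_disc | apply: mopen_near_infty].
  - move=> [w|] Dw; last by right.
    by left; exists w => //; rewrite subr0; have := hM w (DJ _ Dw); lra.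
  - exists (Some z); split=> //; exists z => //; rewrite subr0; have := hM z (DJ _ Dz); lra.
  - by exists None.
  - by move=> t Dt [w hw wE]; move: Dt; rewrite wE => /DJ /hM; move: (cabs w) => u h1 h2; lra.
exists z; split; first exact: inB.
apply/(bdry_frontier _ (Khat_closed Gcomp Gdeg Gp)).
by apply: (Jset_Khat_frontier Gcomp Gdeg Gp); first apply: BJ.
Qed.

Let frontier_bounded : exists M : R, forall l x, frontier (filled (g l)) x -> cabs x <= M.
Proof.
have [M hM] := Jb; exists M => l x Fx; apply: hM.
exact: (frontier_filled_Jset Gcomp Gdeg (Gg l) Fx).
Qed.

Let clUJ_None : ~ clUJ None.
Proof.
have [M hM] := frontier_bounded.
have [|e e0 he] := @mopen_near_infty R M None; first by [].
move=> /(_ e e0) [[x|] ]; last by case=> l /(Julia1_None (Gdeg (Gg l))).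
by move=> /UJE [l /hM h] /he; rewrite ltNge h.
Qed.

Lemma frontier_Khat_clUJ z : frontier (Khat G) z -> clUJ (Some z).
Proof.
move=> Fz e e0; have [l0 _] := l0_ex; have e2 : 0 < e / 2 by lra.
have [l [x [Fx hx]]] := frontier_Khat_approx l0 Gdeg Gpost Jb Jmin_off Fz e2.
by exists (Some x); [apply/UJE; exists l | apply: sdist_lt].
Qed.

Lemma frontier_filled_lconn l : lconn (frontier (filled (g l))).
Proof.
have <- : Lset (g l) 'X = filled (g l) by apply/funext => z; apply/propext/LsetX.
by apply: (Eset_lconn Gcomp Gdeg Gpost (Gg l)); left.
Qed.

(* A component of the closed union contains the limit of some filled Julia
   set boundaries, which separates [Khat] from infinity. *)
Lemma component_surrounds (M' : sphere R -> Prop) z : is_component sd clUJ M' -> frontier (Khat G) z ->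
  ~ M' (Some z) -> surr_le (toC (mcomponent sd clUJ (Some z))) (toC M').
Proof.
move=> [[a|/clUJ_None //] clA M'E] Fz nMz; have [M hM] := frontier_bounded.
have hex n : exists lx : Lam * C, frontier (filled (g lx.1)) lx.2 /\ sd (Some a) (Some lx.2) < n.+1%:R^-1.
  have n0 : 0 < n.+1%:R^-1 :> R by rewrite invr_gt0 ltr0n.
  have [[x|] Ux hx] := clA _ n0; last by case: Ux => l /(Julia1_None (Gdeg (Gg l))).
  by move/UJE: Ux => [l Fl]; exists (l, x).
have [f hf] := choice hex.
pose A n := frontier (filled (g (f n).1)).
have AM n y : A n y -> cabs y <= M by apply: hM.
have cL : lconn (Ulim A) by apply: (@lconn_Ulim _ _ M); apply: uevT => n; [apply: AM | apply: frontier_filled_lconn].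
have La : Ulim A a.
  move=> e e0; have [d d0 hd] := sdist_near (cabs a) e0.
  apply: uev_mono (uev_invn d0) => n hn; case: (hf n) => h1 h2.
  have [w [wE] hw] := hd a _ (lexx _) (lt_trans h2 hn).
  by exists (f n).2 => //; rewrite wE.
have LU y : Ulim A y -> clUJ (Some y).
  move=> hy e e0; have e2 : 0 < e / 2 by lra.
  have [n [w Aw hw]] := uev_ex (hy _ e2); exists (Some w); last exact: sdist_lt.
  by apply/UJE; exists (f n).1.
have LM y : Ulim A y -> M' (Some y).
  move=> Ly; rewrite M'E; exists (ofC (Ulim A)); split; [|exact: lconn_mconnected_ofC | by exists a | by exists y].
  by move=> _ [w Lw ->]; apply: LU.
right; exists (mcomponent (@cdist R) (fun y => ~ toC M' y) z); split.
- by exists z.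
- exists M => y [D [DM cD Dz Dy]].
  (* Membership in the filled sets for many [n] is locally constant off the limit of their frontiers
     and holds at [z]; and a filled set reaches no farther than its frontier. *)
  pose P x := uev (fun n => filled (g (f n).1) x).
  have hP : lconst D P.
    move=> x Dx; have [e e0 he] := closedC_far (@Ulim_closed _ A) (fun h => DM x Dx (LM x h)).
    have nL : ~ Ulim A x by move=> /LM; apply: DM.
    have [e' e'0 he'] : exists2 e : R, 0 < e & uev (fun n => ~ exists2 y, A n y & cabs (x - y) < e).
      apply: contrapT => h; apply: nL => e1 e10; apply: contrapT => h2; apply: h.
      by exists e1 => //; apply: uevN.
    exists e' => // w Dw hw.
    have iffn n : ~ (exists2 y, A n y & cabs (x - y) < e') -> filled (g (f n).1) x <-> filled (g (f n).1) w.
      move=> hn; apply: (lconn_iff (@lconn_disc _ x e')); rewrite ?subrr ?cabs0 // 1?cabsB //.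
      apply: lconst_off_frontier (filled_closed (Gdeg (Gg _))) _ => v hv Fv.
      by apply: hn; exists v; rewrite // cabsB.
    by split=> h; apply: uev2 h he' _ => n k1 /iffn k2; apply/k2.
  have Pz : P z by apply: uevT => n; apply: (Khat_filled Gcomp (Gg _)); case: Fz.
  have [n fn] := uev_ex (mconnected_lconn cD hP Dz Dy Pz).
  have [x Fx hx] := farthest_frontier 0 (ex_intro _ y fn)
    (ex_intro _ _ (filled_le (Gdeg (Gg (f n).1)))) (filled_closed (Gdeg (Gg (f n).1))).
  by have := hx y fn; rewrite !subr0 => h; apply: le_trans h (hM _ _ Fx).
move=> y [D [DU cD Dz Dy]].
have noN (E : sphere R -> Prop) : (forall t, E t -> clUJ t) -> ~ E None by move=> h /h /clUJ_None.
have lD := mconnected_toC (noN _ DU) cD.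
exists (toC D); split=> //; last exact: lconn_mconnected.
(* A common point would merge the two components and put [z] in [M']. *)
move=> t Dt; rewrite /toC M'E => -[E [EU cE Ea Et]]; apply: nMz; rewrite M'E.
have lE := mconnected_toC (noN _ EU) cE.
exists (ofC (fun x => toC D x \/ toC E x)); split.
- by move=> _ [w [/DU|/EU] hw ->].
- by apply: lconn_mconnected_ofC; apply: (lconn_U lD lE Dt Et).
- by exists a => //; right.
- by exists z => //; left.
Qed.

End MinimalComponentOfGenerators.

Unset Implicit Arguments.

Theorem theorem4p13 (R : realType) (Lam : Type) (g : Lam -> {poly R[i]}) :
  let G := gen_semigroup g in
  let UJ : sphere R -> Prop := fun x => exists l, Julia1 (g l) x in
  let clUJ := mclosure (@sdist R) UJ in
  in_calG_dis G ->
  (forall A, is_Jmin G A -> forall x, A x -> UJ x -> False) ->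
  forall M' : sphere R -> Prop,
    is_component (@sdist R) clUJ M' ->
    (forall K, is_component (@sdist R) clUJ K ->
       surr_le (toC K) (toC M') -> K = M') ->
    (forall z, bdry_C (Khat G) z -> M' (Some z)) /\
    (forall x, M' x -> clUJ x).
Proof.
move=> G UJ clUJ [[Gdeg Gpost] Jdis] hJ M' cM' minM'; split; last first.
  by case: cM' => a _ -> x [B [BU _ _ Bx]]; apply: BU.
have [l0 _] : exists l : Lam, True.
  by apply: contrapT => h; apply: Jdis; apply: empty_gen_Julia => l; apply: h; exists l.
move=> z /(bdry_frontier z (Khat_closed (@gen_comp R Lam g) Gdeg (gen_base g l0))) Fz.
apply: contrapT => nMz; apply: (nMz).
have clz : clUJ (Some z) by apply: frontier_Khat_clUJ.
(* [component_surrounds] places the component of [z] below [M'], and minimality then identifies the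
   two. *)
rewrite -(minM' (mcomponent (@sdist R) clUJ (Some z))).
- exists (ofC (fun y => y = z)); split; [|by apply: lconn_mconnected_ofC; apply: lconn1|by exists z|by exists z].
  by move=> _ [y -> ->].
- by exists (Some z).
exact: component_surrounds.
Qed.
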